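(* Let $M$ be a smooth manifold of dimension $n$. There is a one-to-one correspondence between the following: (1) pairs consisting of a connection on $TM$ and an infinitesimal deformation of it; (2) connections on the principal $\mathrm{GL}_n(\mathbb R)\ltimes\mathfrak{gl}_n(\mathbb R)$-bundle $P^1(M)\ltimes\underline{\mathfrak{gl}_n}(\mathbb R)$; (3) sections from $P^1(M)\ltimes\underline{\mathfrak{gl}_n}(\mathbb R)$ to $\widetilde P^2(M)\ltimes\underline{\widetilde{\mathfrak g}^2_n}$ equivariant under the $\mathrm{GL}_n(\mathbb R)\ltimes\mathfrak{gl}_n(\mathbb R)$-action.
   Context: Connections on $TM$ are linear connections (torsion allowed). An infinitesimal deformation of a connection $\nabla$ on $TM$ is a $\mathrm{Hom}(TM,TM)$-valued $1$-form on $M$, i.e. in charts a family $\mu^i{}_{jk}$ with $\mu^i{}_{jk}\,\frac{\partial}{\partial x^i}\otimes dx^j\otimes dx^k$ a tensor field of type $(1,2)$ (the difference tensor allowed when varying the Christoffel symbols of $\nabla$). $P^1(M)$ is the linear frame bundle. Let $o\in\mathbb R^n$ be the origin. $\widetilde P^2(M)$ (bundle of formal $2$-frames) is the set of $j^1_o(F)$, where $F=(f,F_\bullet)$ is a germ at $o$ of a vector bundle isomorphism onto the image $T\mathbb R^n\to TM$ over a local diffeomorphism $f$ (not necessarily $Df$), with $F_o=Df(o)$; $j^1_o(F)$ is the $1$-jet at $o$ of $x\mapsto F_x\in P^1(M)$. Its projections are $\pi^2(j^1_o(F))=f(o)$ and $\pi^2_1(j^1_o(F))=F_o\in P^1(M)$.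 $\widetilde G^2_n$ is the fibre of $\widetilde P^2(\mathbb R^n)$ over $o$, a Lie group under composition, with Lie algebra $\widetilde{\mathfrak g}^2_n$; $\widetilde P^2(M)$ is a principal $\widetilde G_n^2$-bundle over $M$ by $j^1_o(F).j^1_o(G)=j^1_o(F\circ G)$. Writing elements of $\widetilde G^2_n$ as $(a^i{}_j,a^i{}_{jk})$ with $a^i{}_j=F^i{}_j(o)$, $a^i{}_{jk}=\frac{\partial F^i{}_j}{\partial x^k}(o)$, $\mathrm{GL}_n(\mathbb R)$ is a subgroup of $\widetilde G^2_n$ by $a\mapsto(a,0)$. For a Lie group $G$ with Lie algebra $\mathfrak g$, $G\ltimes\mathfrak g$ (isomorphic to the tangent group $TG$) has product $(A,X).(B,Y)=(AB,\mathrm{Ad}_{B^{-1}}X+Y)$. For a principal $G$-bundle $P\to M$, $\underline{\mathfrak g}=M\times\mathfrak g$, and $P\ltimes\underline{\mathfrak g}$ is the fibre product of $P$ and $\underline{\mathfrak g}$ over $M$, made a principal $G\ltimes\mathfrak g$-bundle over $M$ by $(u,X).(B,Y)=(u.B,\mathrm{Ad}_{B^{-1}}X+Y)$. Thus $\widetilde P^2(M)\ltimes\underline{\widetilde{\mathfrak g}^2_n}$ is a principal $\widetilde G_n^2\ltimes\widetilde{\mathfrak g}_n^2$-bundle, on which the subgroup $\mathrm{GL}_n(\mathbb R)\ltimes\mathfrak{gl}_n(\mathbb R)$ acts. The sections in (3) are sections of the natural projection $\widetilde P^2(M)\ltimes\underline{\widetilde{\mathfrak g}^2_n}\to P^1(M)\ltimes\underline{\mathfrak{gl}_n}(\mathbb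 R)$ induced by $\pi^2_1$ and by the differential of $\widetilde G_n^2\to\mathrm{GL}_n(\mathbb R)$, $(a^i{}_j,a^i{}_{jk})\mapsto(a^i{}_j)$. *)

(* Defs.v *)
From HB Require Import structures.
From mathcomp Require Import all_boot all_order all_algebra.
From mathcomp Require Import all_classical all_reals all_analysis.
Set Implicit Arguments.
Unset Strict Implicit.
Unset Printing Implicit Defensive.
Import Order.TTheory GRing.Theory Num.Theory.
Import numFieldNormedType.Exports.
Local Open Scope classical_set_scope.
Local Open Scope ring_scope.

Section NormedSpaces.
Context {R : realType} {V W : normedModType R}.

(* For finite-dimensional V and open U this is the class C^k: the total
   derivative exists and, along each fixed vector, is of class C^(k-1). *)
Fixpoint class_C (k : nat) (U : set V) (f : V -> W) : Prop :=
  if k is k'.+1 then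
    (forall x, U x -> differentiable f x) /\
    (forall v, class_C k' U (fun x => 'd f x v))
  else forall x, U x -> {for x, continuous f}.

Definition smooth_on (U : set V) (f : V -> W) : Prop :=
  forall k, class_C k U f.

End NormedSpaces.

Definition local_diffeo {R : realType} {V W : normedModType R}
    (f : V -> W) (x : V) : Prop :=
  exists (U : set V) (g : W -> V),
    [/\ open U, U x & open (f @` U)] /\
    [/\ smooth_on U f, smooth_on (f @` U) g & forall y, U y -> g (f y) = y].

(* A set with a family of partial charts valued in E.  No compatibility is
   required here: it is an axiom of [manifold] below, and it is inherited by
   the bundles constructed from a manifold. *)
Record charted (R : realType) (E : normedModType R) := Charted {
  pt :> Type;
  chart : Type;
  dom : chart -> set pt;
  loc : chart -> pt -> E }.
Arguments Charted {R E pt chart}.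
Arguments dom {R E N} c x : rename.
Arguments loc {R E N} c x : rename.

Definition vec {R : realType} (V : normedModType R) : charted V :=
  Charted (fun _ : unit => setT) (fun _ : unit => id).

Definition prodc {R : realType} {E1 E2 : normedModType R}
    (N1 : charted E1) (N2 : charted E2) : charted (E1 * E2)%type :=
  @Charted R (E1 * E2)%type (N1 * N2)%type (chart N1 * chart N2)%type
    (fun c x => dom c.1 x.1 /\ dom c.2 x.2)
    (fun c x => (loc c.1 x.1, loc c.2 x.2)).

Section SmoothMaps.
Context {R : realType} {E1 E2 : normedModType R}.
Context {N1 : charted E1} {N2 : charted E2}.

(* loc d \o f \o (loc c)^-1, extended by 0 *)
Definition local_rep (f : N1 -> N2) (c : chart N1) (d : chart N2) (y : E1)
    : E2 :=
  xget 0 [set z | exists x,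
    [/\ dom c x, dom d (f x), loc c x = y & loc d (f x) = z]].

(* Openness of the domains of the local expressions is continuity of f. *)
Definition smooth_map (f : N1 -> N2) : Prop :=
  forall (c : chart N1) (d : chart N2),
    let U := loc c @` (dom c `&` f @^-1` dom d) in
    open U /\ smooth_on U (local_rep f c d).

End SmoothMaps.

Definition transition {R : realType} {E : normedModType R} {N : charted E}
    (c d : chart N) : E -> E := local_rep (fun x : N => x) c d.

Record manifold (R : realType) (n : nat) := Manifold {
  mspace : topologicalType;
  mchart : Type;
  mdom : mchart -> set mspace;
  mloc : mchart -> mspace -> 'cV[R]_n;
  mhausdorff : hausdorff_space mspace;
  msecond_countable : @second_countable mspace;
  mcover : forall x, exists c, mdom c x;
  mdom_open : forall c, open (mdom c);
  mloc_inj : forall c x y, mdom c x -> mdom c y -> mloc c x = mloc c y -> x = y;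
  mloc_continuous : forall c x, mdom c x -> {for x, continuous (mloc c)};
  mloc_open : forall c (U : set mspace),
    open U -> U `<=` mdom c -> open (mloc c @` U);
  mcompat : @smooth_map R _ _ (Charted mdom mloc) (Charted mdom mloc) id }.

Coercion manifold_charted (R : realType) (n : nat) (M : manifold R n)
  : charted 'cV[R]_n := Charted (@mdom R n M) (@mloc R n M).

Section TangentSpace.
Context {R : realType} {E : normedModType R} (N : charted E).

(* A tangent vector at x is given by its components in all the charts around x,
   related by the derivatives of the transition maps; the components in the
   other charts are set to 0 so that the encoding is unique. *)
Definition tangent_pred (x : N) : {pred (chart N -> E)} := fun v =>
  `[< (forall c d, dom c x -> dom d x ->
        v d = 'd (transition c d) (loc c x) (v c)) /\
      (forall c, ~ dom c x -> v c = 0) >].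

Fact tangent_submod_closed x : submod_closed (tangent_pred x).
Proof.
split.
  apply/asboolP; split=> // c d _ _.
  by rewrite [RHS](linear0 ('d (transition c d) (loc c x))).
move=> a u v /asboolP[u1 u2] /asboolP[v1 v2]; apply/asboolP; split=> [c d cx dx|c cx].
  have -> : (a *: u + v) d = a *: u d + v d by [].
  have -> : (a *: u + v) c = a *: u c + v c by [].
  by rewrite linearP -u1 // -v1.
have -> : (a *: u + v) c = a *: u c + v c by [].
by rewrite u2 // v2 // scaler0 addr0.
Qed.

HB.instance Definition _ x :=
  GRing.isSubmodClosed.Build R (chart N -> E) (tangent_pred x)
    (tangent_submod_closed x).

Definition tangent (x : N) := {v : chart N -> E | v \in tangent_pred x}.

HB.instance Definition _ x := SubChoice.on (tangent x).
HB.instance Definition _ x := [SubChoice_isSubLmodule of tangent x by <:].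

Definition tangent_bundle : charted (E * E)%type :=
  @Charted R (E * E)%type {x : N & tangent x} (chart N)
    (fun c v => dom c (tag v))
    (fun c v => (loc c (tag v), val (tagged v) c)).

Definition vfield :=
  {X : forall x : N, tangent x |
     smooth_map (fun x : N => existT _ x (X x) : tangent_bundle)}.

End TangentSpace.

Section Differentials.
Context {R : realType} {E1 E2 : normedModType R}.

Definition dmap {N1 : charted E1} {N2 : charted E2} (f : N1 -> N2) (x : N1)
    (X : tangent x) : tangent (f x) :=
  xget 0 [set Y : tangent (f x) | forall c d, dom c x -> dom d (f x) ->
    val Y d = 'd (local_rep f c d) (loc c x) (val X c)].

Definition vdiff {N : charted E2} (f : E1 -> N) (x v : E1) : tangent (f x) :=
  xget 0 [set Y : tangent (f x) | forall d, dom d (f x) ->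
    val Y d = 'd (fun y => loc d (f y)) x v].

Definition smooth_germ {N : charted E2} (f : E1 -> N) (x : E1) : Prop :=
  exists U : set E1, [/\ open U, U x & forall c : chart N,
    let Uc := U `&` f @^-1` dom c in
    open Uc /\ smooth_on Uc (fun y => loc c (f y))].

End Differentials.

Section ConnectionsOnTM.
Context {R : realType} {n : nat} (M : manifold R n).

Definition dirder (f : M -> R^o) (x : M) (v : tangent x) : R^o :=
  val (dmap (N2 := vec R^o) f v) tt.

Definition is_covariant_derivative
    (nabla : vfield M -> vfield M -> vfield M) : Prop :=
  (forall (f : M -> R^o) (X X' Z Y : vfield M),
     smooth_map (N2 := vec R^o) f ->
     (forall x, sval Z x = f x *: sval X x + sval X' x) ->
     forall x, sval (nabla Z Y) x =
       f x *: sval (nabla X Y) x + sval (nabla X' Y) x) /\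
  (forall (f : M -> R^o) (X Y Y' Z : vfield M),
     smooth_map (N2 := vec R^o) f ->
     (forall x, sval Z x = f x *: sval Y x + sval Y' x) ->
     forall x, sval (nabla X Z) x =
       dirder f (sval X x) *: sval Y x + f x *: sval (nabla X Y) x
         + sval (nabla X Y') x).

Definition connection := {nabla | is_covariant_derivative nabla}.

(* The first vector argument is the one of the 1-form: mu v : T_x M -> T_x M.
   Bilinearity on each T_x M is contained in the local expression. *)
Definition is_deformation
    (mu : forall x : M, tangent x -> tangent x -> tangent x) : Prop :=
  forall c : chart M, exists m : 'I_n -> 'I_n -> 'I_n -> 'cV[R]_n -> R^o,
    (forall i j k, smooth_on (loc c @` dom c) (m i j k)) /\
    forall x (v w : tangent x), dom c x ->
      val (mu x v w) c = \col_i \sum_j \sum_k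
        m i j k (loc c x) * val w c j 0 * val v c k 0.

Definition deformation := {mu | is_deformation mu}.

End ConnectionsOnTM.

(* The operations of a Lie group which is an open subset gdom of a vector space
   V; V is then identified with the Lie algebra (the tangent space at gone).
   The values of the operations outside gdom are irrelevant. *)
Record lie_group (R : realType) (V : normedModType R) := LieGroup {
  gdom : set V;
  gone : V;
  gmul : V -> V -> V;
  ginv : V -> V }.

Section LieGroups.
Context {R : realType} {V : normedModType R} (G : lie_group V).

Definition Ad (g X : V) : V :=
  'd (fun h => gmul G (gmul G g h) (ginv G g)) (gone G) X.

Definition semidirect : lie_group (V * V)%type := {|
  gdom := [set g | gdom G g.1];
  gone := (gone G, 0);
  gmul := fun g h => (gmul G g.1 h.1, Ad (ginv G h.1) g.2 + h.2);
  ginv := fun g => (ginv G g.1, - Ad g.1 g.2) |}.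

Context {E : normedModType R} (P : charted E).

(* The fibre product of P with the trivial bundle of fibre V is P x V. *)
Definition semidirect_bundle : charted (E * V)%type := prodc P (vec V).

Definition semidirect_act (act : P -> V -> P) (q : semidirect_bundle)
    (g : V * V) : semidirect_bundle :=
  (act q.1 g.1, Ad (ginv G g.1) q.2 + g.2).

(* Connection forms on P for the right action act; vdiff (act p) (gone G) A is
   the value at p (that is, at act p (gone G)) of the fundamental vector field
   of A. *)
Definition is_connection_form (act : P -> V -> P)
    (omega : forall p : P, tangent p -> V) : Prop :=
  [/\ forall p, linear (omega p),
      smooth_map (N1 := tangent_bundle P) (N2 := vec V)
        (fun X => omega (tag X) (tagged X)),
      forall p A, omega _ (vdiff (act p) (gone G) A) = A
    & forall p g (X : tangent p), gdom G g ->
        omega _ (dmap (act^~ g) X) = Ad (ginv G g) (omega p X)].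

Definition principal_connection (act : P -> V -> P) :=
  {omega | is_connection_form act omega}.

End LieGroups.

Section FrameBundle.
Context {R : realType} {n : nat} (M : manifold R n).

Definition GL : lie_group 'M[R]_n := {|
  gdom := [set a | a \in unitmx];
  gone := 1%:M;
  gmul := mulmx;
  ginv := invmx |}.

Definition frame_map (x : M) (u : 'I_n -> tangent x) (xi : 'cV[R]_n)
    : tangent x := \sum_j xi j 0 *: u j.

Definition frame (x : M) :=
  {u : 'I_n -> tangent x | `[< bijective (frame_map u) >]}.

Definition frame_bundle_pt := {x : M & frame x}.

Definition fvec (u : frame_bundle_pt) (j : 'I_n) : tangent (tag u) :=
  val (tagged u) j.

Definition frame_bundle : charted ('cV[R]_n * 'M[R]_n)%type :=
  @Charted R ('cV[R]_n * 'M[R]_n)%type frame_bundle_pt (chart M)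
    (fun c u => dom c (tag u))
    (fun c u => (loc c (tag u), \matrix_(i, j) val (fvec u j) c i 0)).

(* insubd: u is returned when a is not invertible *)
Definition frame_act (u : frame_bundle) (a : 'M[R]_n) : frame_bundle :=
  existT _ (tag u)
    (insubd (tagged u) (fun j => \sum_i a i j *: fvec u i)).

(* u^-1 : T_x M -> R^n *)
Definition frame_coord (u : frame_bundle) (v : tangent (tag u)) : 'cV[R]_n :=
  xget 0 [set xi | frame_map (fvec u) xi = v].

End FrameBundle.
Arguments GL {R n}.

Section FormalFrames.
Context {R : realType} {n : nat}.

(* Arrays a^i_jk are stored as matrices: a^i_jk is b i (mxvec_index j k). *)
Definition array (D : 'I_n -> 'M[R]_n) : 'M[R]_(n, n * n) :=
  \matrix_i mxvec (\matrix_(j, k) D k i j).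

(* a^i_jk x^k *)
Definition array_eval (b : 'M[R]_(n, n * n)) (x : 'cV[R]_n) : 'M[R]_n :=
  \matrix_(i, j) \sum_k b i (mxvec_index j k) * x k 0.

(* An element (a^i_j, a^i_jk) of the group of formal 2-frames is the jet of the
   germ F with f(x) = a x and F_x = a^i_j + a^i_jk x^k. *)
Definition germ2 (g : 'M[R]_n * 'M[R]_(n, n * n)) (x : 'cV[R]_n) : 'M[R]_n :=
  g.1 + array_eval g.2 x.

Definition jet2 (F : 'cV[R]_n -> 'M[R]_n) : 'M[R]_n * 'M[R]_(n, n * n) :=
  (F 0, array (fun k => 'd F 0 (delta_mx k 0))).

(* Jets of the composite x |-> F_(g x) G_x and of the inverse
   x |-> (F_(f^-1 x))^-1. *)
Definition G2 : lie_group ('M[R]_n * 'M[R]_(n, n * n))%type := {|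
  gdom := [set g | g.1 \in unitmx];
  gone := (1%:M, 0);
  gmul := fun g h => jet2 (fun x => germ2 g (h.1 *m x) *m germ2 h x);
  ginv := fun g => jet2 (fun x => invmx (germ2 g (invmx g.1 *m x))) |}.

Context (M : manifold R n).
Notation P1 := (frame_bundle M).

(* F is the map x |-> F_x, and f(x) is the base point of F_x. *)
Definition is_formal_frame (F : 'cV[R]_n -> P1) : Prop :=
  let f : 'cV[R]_n -> M := fun x => tag (F x) in
  [/\ smooth_germ F 0,
      forall c : chart M, dom c (f 0) -> local_diffeo (fun x => loc c (f x)) 0
    & forall k, fvec (F 0) k = vdiff f 0 (delta_mx k 0)].

(* 1-jets at o of maps from R^n to P1: the value and the partial derivatives *)
Definition jet1_pt := {u : P1 & 'I_n -> tangent u}.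

Definition jet1 (F : 'cV[R]_n -> P1) : jet1_pt :=
  existT _ (F 0) (fun k => vdiff F 0 (delta_mx k 0)).

Definition formal_frame_bundle_pt :=
  {j : jet1_pt | `[< exists F, is_formal_frame F /\ j = jet1 F >]}.

Definition pi21 (j : formal_frame_bundle_pt) : P1 := tag (val j).

Definition formal_frame_bundle
    : charted (('cV[R]_n * 'M[R]_n) * 'M[R]_(n, n * n))%type :=
  @Charted R (('cV[R]_n * 'M[R]_n) * 'M[R]_(n, n * n))%type
    formal_frame_bundle_pt (chart M)
    (fun c j => dom c (tag (pi21 j)))
    (fun c j => (loc (N := P1) c (pi21 j),
                 array (fun k => (val (tagged (val j) k) c).2))).

Fact formal_frame_ex (j : formal_frame_bundle_pt) :
  exists F, is_formal_frame F /\ val j = jet1 F.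
Proof. exact/asboolP/(valP j). Qed.

Definition representative (j : formal_frame_bundle) : 'cV[R]_n -> P1 :=
  sval (cid (formal_frame_ex j)).

(* j^1(F).j^1(G) = j^1(F \o G) *)
Definition formal_frame_act (j : formal_frame_bundle)
    (g : 'M[R]_n * 'M[R]_(n, n * n)) : formal_frame_bundle :=
  insubd (j : formal_frame_bundle_pt)
    (jet1 (fun x => frame_act (representative j (g.1 *m x)) (germ2 g x))).

End FormalFrames.
Arguments G2 {R n}.

Section Correspondences.
Context {R : realType} {n : nat} (M : manifold R n).

Definition P1g := semidirect_bundle (V := 'M[R]_n) (frame_bundle M).

Definition P1g_act : P1g -> 'M[R]_n * 'M[R]_n -> P1g :=
  semidirect_act GL (@frame_act R n M).

Definition P2g :=
  semidirect_bundle (V := ('M[R]_n * 'M[R]_(n, n * n))%type)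
    (formal_frame_bundle M).

Definition P2g_act :
    P2g -> ('M[R]_n * 'M[R]_(n, n * n)) * ('M[R]_n * 'M[R]_(n, n * n)) -> P2g :=
  semidirect_act G2 (@formal_frame_act R n M).

Definition P1g_connection := principal_connection (semidirect GL) P1g_act.

(* The projection of G2 onto GL is linear, hence equal to its differential. *)
Definition P2g_proj (q : P2g) : P1g := (pi21 q.1, q.2.1).

Definition GLg_inj (h : 'M[R]_n * 'M[R]_n) :
    ('M[R]_n * 'M[R]_(n, n * n)) * ('M[R]_n * 'M[R]_(n, n * n)) :=
  ((h.1, 0), (h.2, 0)).

Definition is_equivariant_section (s : P1g -> P2g) : Prop :=
  [/\ smooth_map s,
      forall q, P2g_proj (s q) = q
    & forall q h, gdom (semidirect GL) h ->
        s (P1g_act q h) = P2g_act (s q) (GLg_inj h)].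

Definition equivariant_section := {s | is_equivariant_section s}.

(* Along the zero section u |-> (u, 0), the first component of omega is the
   connection form of nabla, i.e. for f_Y(u) = u^-1(Y) and T over X,
     f_(nabla_X Y)(u) = T f_Y + omega(T).1 f_Y(u),
   and the second component is the tensorial form of mu. *)
Definition connection_form_of (p : connection M * deformation M)
    (omega : P1g_connection) : Prop :=
  let fY (Y : vfield M) : P1g -> vec 'cV[R]_n :=
    fun q => frame_coord (u := q.1) (sval Y (tag q.1)) in
  forall (u : frame_bundle M) (T : tangent ((u, 0) : P1g)) (X Y : vfield M),
    dmap (N2 := M) (fun q : P1g => tag q.1) T = sval X (tag u) ->
    dmap (N2 := vec 'M[R]_n) (fun q : P1g => q.2) T = 0 ->
    let w := sval omega _ T in
    frame_coord (u := u) (sval (sval p.1 X Y) (tag u)) =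
      val (dmap (fY Y) T) tt + w.1 *m fY Y (u, 0) /\
    frame_coord (u := u) (sval p.2 _ (sval X (tag u)) (sval Y (tag u))) =
      w.2 *m fY Y (u, 0).

(* For (j, tau) = s(u, 0), j is the 1-jet of a moving frame which is horizontal
   at o for the first component of omega; tau = (0, b^i_jk) is the first order
   variation of j, in which -b is the second component of omega. *)
Definition section_of (omega : P1g_connection) (s : equivariant_section)
    : Prop :=
  forall (u : frame_bundle M) (k : 'I_n),
    let j := (sval s (u, 0)).1 in
    let tau := (sval s (u, 0)).2 in
    forall T : tangent ((pi21 j, 0) : P1g),
      dmap (N2 := frame_bundle M) (fun q : P1g => q.1) T = tagged (val j) k ->
      dmap (N2 := vec 'M[R]_n) (fun q : P1g => q.2) T = 0 ->
      sval omega _ T = (0, - array_eval tau.2 (delta_mx k 0)).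

End Correspondences.

(* Main.v *)
Require Import Defs.
From HB Require Import structures.
From mathcomp Require Import all_boot all_order all_algebra fingroup perm ring.
From mathcomp Require Import all_classical all_reals all_analysis.
Set Implicit Arguments.
Unset Strict Implicit.
Unset Printing Implicit Defensive.
Import Order.TTheory GRing.Theory Num.Theory.
Import numFieldNormedType.Exports.
Local Open Scope classical_set_scope.
Local Open Scope ring_scope.

(* In charts, each of the three kinds of objects is a pair (G, m) of families of
   smooth arrays: G obeys the transformation rule of Christoffel symbols and m
   that of tensors of type (1,2).
   - A covariant derivative is D_X Y = dY(X) + G(X) Y; locality, hence the
     existence of G, comes from smooth cutoff functions, built from exp(-1/t).
   - A connection form on the semidirect bundle is determined by its values on
     the vectors (v, 0, 0) at the coordinate frame (y, 1, 0), which are (G(v), m(v)).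
   - An equivariant section is determined by its value at (y, 1, 0), a formal
     2-frame with array -G together with the Lie algebra element (0, -m).
   So each correspondence is a relation "to have the same symbols" that is total
   and functional in both directions. *)

(** * Differential calculus in finite dimension *)

(** Symbols are functions on all of R^n whose values outside the chart images carry no meaning, so
    pairs (G, m) are not literally in bijection with the three kinds of objects; relations that
    compare symbols only at points of the charts avoid a quotient. The transformation rules of a
    given object come from reading it in two charts; for forms and sections this is done at the
    frame that is the coordinate frame of the first chart. Conversely, the second derivative of the
    transition maps, which enters the tangent vectors of the frame bundle, is cancelled by the
    inhomogeneous term of the Christoffel rule. The minus signs in the third case express
    horizontality: a moving frame through (y, a) is horizontal at o when its derivative along e_k is
    -G(a e_k) a. The Hausdorff axiom enters through the cutoffs: a closed box in a chart is compact,
    hence closed in M, and extension by zero is then smooth. *)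

Section IsDiff.
Context {R : realType}.
Implicit Types U V W Z : normedModType R.

(** Existence and value of the differential in one relation. As [df] is a bare function, the
    expression produced by a chain of rules can be rewritten by [isdiff_ext] and compared with
    another one by [isdiff_uniq]. *)
Definition isdiff {V W} (f : V -> W) (x : V) (df : V -> W) :=
  differentiable f x /\ forall v, 'd f x v = df v.

Lemma isdiffP {V W} (f : V -> W) x : differentiable f x -> isdiff f x ('d f x).
Proof. by split. Qed.

Lemma isdiff_ext {V W} (f : V -> W) x df df' :
  isdiff f x df -> df =1 df' -> isdiff f x df'.
Proof. by move=> [df1 df2] e; split=> // v; rewrite df2 e. Qed.

Lemma isdiff_uniq {V W} (f : V -> W) x df df' :
  isdiff f x df -> isdiff f x df' -> df =1 df'.
Proof. by move=> [_ d1] [_ d2] v; rewrite -d1 d2. Qed.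

(** Local representatives are extended by 0 and agree with explicit formulas only near a point. Both
    functions have the same first-order expansion there, and [diff_unique] identifies the
    differentials. *)
Lemma isdiff_near {V W} (f g : V -> W) x df :
  (\forall y \near x, f y = g y) -> isdiff f x df -> isdiff g x df.
Proof.
move=> fg [dfx dfE].
have fgx : f x = g x by apply: nbhs_singleton fg.
have h : g \o shift x = cst (g x) + 'd f x +o_ 0 id.
  apply/eqaddoP => e e0.
  have /diff_locallyP[_ /eqaddoP /(_ e e0) H] := dfx.
  have fg0 : \forall y \near 0, f (y + x) = g (y + x).
    by move: fg; rewrite (near_shift 0 x); apply: filterS => y /=; rewrite subr0.
  near=> y.
  have -> : (g \o shift x - (cst (g x) + 'd f x)) y =
            (f \o shift x - (cst (f x) + 'd f x)) y.
    rewrite !fctE /= -fgx; congr (_ - _); apply/esym.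
    by near: y.
  by near: y.
have dg : 'd g x = 'd f x :> (V -> W).
  by apply: diff_unique h; apply: diff_continuous.
split; last by move=> v; rewrite dg.
by apply/diff_locallyP; rewrite dg; split=> //; apply: diff_continuous.
Unshelve. all: by end_near. Qed.

Lemma isdiff_cst {V W} (a : W) (x : V) : isdiff (fun=> a) x (fun=> 0).
Proof. by split; [exact: differentiable_cst | move=> v; rewrite diff_cst]. Qed.

Lemma isdiff_id {V} (x : V) : isdiff id x id.
Proof.
have H := is_diff_id x.
by split; [exact: ex_diff | move=> v; rewrite diff_val].
Qed.

Lemma isdiff_lin {V W} (f : {linear V -> W}) x : continuous f -> isdiff f x f.
Proof.
by move=> fc; split; [exact: linear_differentiable|move=> v; rewrite diff_lin].
Qed.

Lemma isdiffD {V W} (f g df dg : V -> W) x : isdiff f x df -> isdiff g x dg ->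
  isdiff (fun y => f y + g y) x (fun v => df v + dg v).
Proof.
move=> [f1 f2] [g1 g2]; split; first exact: differentiableD.
by move=> v; rewrite -f2 -g2 -[LHS]/('d (f + g) x v) diffD.
Qed.

Lemma isdiffN {V W} (f df : V -> W) x : isdiff f x df ->
  isdiff (fun y => - f y) x (fun v => - df v).
Proof.
move=> [f1 f2]; split; first exact: differentiableN.
by move=> v; rewrite -f2 -[LHS]/('d (- f) x v) diffN.
Qed.

Lemma isdiff_comp {U V W} (f df : U -> V) (g dg : V -> W) x :
  isdiff f x df -> isdiff g (f x) dg ->
  isdiff (fun y => g (f y)) x (fun v => dg (df v)).
Proof.
move=> [f1 f2] [g1 g2]; split; first exact: (differentiable_comp f1 g1).
by move=> v; rewrite -[LHS]/('d (g \o f) x v) diff_comp //= f2 g2.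
Qed.

Lemma isdiff_comp_eq {U V W} (f df : U -> V) (g dg : V -> W) x y :
  isdiff f x df -> f x = y -> isdiff g y dg ->
  isdiff (fun y => g (f y)) x (fun v => dg (df v)).
Proof. by move=> Hf <-; exact: isdiff_comp. Qed.

Lemma isdiff_pair {U V W} (f df : U -> V) (g dg : U -> W) x :
  isdiff f x df -> isdiff g x dg ->
  isdiff (fun y => (f y, g y)) x (fun v => (df v, dg v)).
Proof.
move=> [f1 f2] [g1 g2]; split; first exact: differentiable_pair.
by move=> v; rewrite diff_pair // f2 g2.
Qed.

Lemma isdiff_sum {V W} (I : Type) (r : seq I) (f df : I -> V -> W) x :
  (forall i, isdiff (f i) x (df i)) ->
  isdiff (fun y => \sum_(i <- r) f i y) x (fun v => \sum_(i <- r) df i v).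
Proof.
move=> H; elim: r => [|i r IH].
  split; last by move=> v; under eq_fun do rewrite big_nil; rewrite big_nil diff_cst.
  by under eq_fun do rewrite big_nil; exact: differentiable_cst.
under eq_fun do rewrite big_cons.
by apply: isdiff_ext (isdiffD (H i) IH) _ => v /=; rewrite big_cons.
Qed.

Lemma isdiffZl {V W} (k dk : V -> R^o) (w : W) x : isdiff k x dk ->
  isdiff (fun y => k y *: w) x (fun v => dk v *: w).
Proof.
move=> [k1 k2]; split; first exact: (differentiableZl w k1).
by move=> v; rewrite (diffZl w k1) k2.
Qed.

Lemma isdiff_inv (x : R^o) : x != 0 ->
  isdiff (fun y : R^o => y^-1 : R^o) x (fun v => - x ^- 2 * v).
Proof.
by move=> x0; split; [exact: differentiable_Rinv|move=> v; rewrite diff_Rinv].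
Qed.

End IsDiff.

Section FiniteDimension.
Context {R : realType}.
Implicit Types U V W Z : normedModType R.

(** Continuous linear coordinates along a finite family: enough to make every linear map continuous,
    and to reduce bilinear and composite maps to scalar multiples of fixed vectors. *)
Class fin_dim (V : normedModType R) : Prop :=
  FinDim : exists (m : nat) (e : 'I_m -> V) (l : 'I_m -> {linear V -> R^o}),
    (forall i, continuous (l i)) /\ forall x, x = \sum_i (l i x : R) *: e i.

Lemma fin_dim_continuous {V W} {fV : fin_dim V} (f : {linear V -> W}) :
  continuous f.
Proof.
have [m [e [l [lc le]]]] := fV.
have -> : (f : V -> W) = fun x => \sum_i (l i x : R) *: f (e i).
  by apply/funext => x; rewrite {1}(le x) linear_sum; apply: eq_bigr => i _; rewrite linearZ.
move=> x; apply: differentiable_continuous.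
have := @isdiff_sum R V W _ (index_enum 'I_m)
  (fun i x => (l i x : R) *: f (e i)) (fun i x => (l i x : R) *: f (e i)) x.
by case=> // i; apply: (isdiffZl (k := l i)); apply: isdiff_lin.
Qed.

Lemma isdiff_linear {V W} {fV : fin_dim V} (f : V -> W) x :
  linear f -> isdiff f x f.
Proof.
move=> lf; pose fM := GRing.isLinear.Build _ _ _ _ f lf.
pose fL : {linear _ -> _} := HB.pack f fM.
by apply: (@isdiff_lin R V W fL); exact: fin_dim_continuous.
Qed.

(** In coordinates of [W] this is the product rule for real functions, multiplied by the fixed
    vectors [e i]. *)
Lemma isdiff_scale {V W} (k dk : V -> R^o) (f df : V -> W) x :
  fin_dim W -> isdiff k x dk -> isdiff f x df ->
  isdiff (fun y => k y *: f y) x (fun v => dk v *: f x + k x *: df v).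
Proof.
move=> [m [e [l [lc le]]]] [k1 k2] [f1 f2].
have -> : (fun y => k y *: f y) =
          fun y => \sum_i (k y * (l i (f y) : R)) *: e i.
  apply/funext => y; rewrite [in LHS](le (f y)) scaler_sumr.
  by apply: eq_bigr => i _; rewrite scalerA.
pose dd i := fun v => (k x * (l i (df v) : R) + (l i (f x) : R) * dk v : R^o).
apply: isdiff_ext (isdiff_sum (df := fun i v => dd i v *: e i) _ _) _.
  move=> i; apply: isdiffZl.
  have [l1 l2] := isdiff_comp (isdiffP f1) (isdiff_lin (f x) (lc i)).
  split; first by apply: differentiableM.
  move=> v; rewrite -[LHS]/('d (k * (fun y => l i (f y) : R^o)) x v).
  by rewrite diffM // /dd -k2 -f2 -l2.
move=> v; rewrite [in RHS](le (df v)) [in RHS](le (f x)) !scaler_sumr -big_split.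
by apply: eq_bigr => i _; rewrite /dd scalerDl addrC !scalerA [dk v * _]mulrC.
Qed.

Global Instance fin_dim_R : fin_dim R^o.
Proof.
exists 1%N, (fun=> 1 : R^o), (fun=> idfun); split; first by move=> i x; exact: cvg_id.
by move=> x; rewrite big_ord1 [RHS]mulr1.
Qed.

Lemma fin_dim_fin V (T : finType) (e : T -> V) (l : T -> V -> R^o) :
  (forall i, linear (l i)) -> (forall i, continuous (l i)) ->
  (forall x, x = \sum_i (l i x : R) *: e i) -> fin_dim V.
Proof.
move=> ll lc le.
pose lL i : {linear V -> R^o} := HB.pack (l i) (GRing.isLinear.Build _ _ _ _ (l i) (ll i)).
exists #|T|, (fun i => e (enum_val i)), (fun i => lL (enum_val i)); split.
  by move=> i; exact: lc.
move=> x; rewrite {1}(le x) (reindex (@enum_val T T)) //=.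
by apply: onW_bij; exact: enum_val_bij.
Qed.

Global Instance fin_dim_matrix m n : fin_dim 'M[R]_(m, n).
Proof.
apply: (@fin_dim_fin _ ('I_m * 'I_n)%type (fun ij => delta_mx ij.1 ij.2)
  (fun ij A => A ij.1 ij.2)).
- by move=> [i j] a u v /=; rewrite !mxE.
- by move=> [i j]; exact: coord_continuous.
- move=> A; rewrite {1}(matrix_sum_delta A) pair_bigA /=.
  by apply: eq_bigr.
Qed.

Lemma fst_sum V W (I : finType) (F : I -> V * W) :
  (\sum_i F i).1 = \sum_i (F i).1.
Proof. exact: (big_morph fst). Qed.

Lemma snd_sum V W (I : finType) (F : I -> V * W) :
  (\sum_i F i).2 = \sum_i (F i).2.
Proof. exact: (big_morph snd). Qed.

Global Instance fin_dim_prod V W {fV : fin_dim V} {fW : fin_dim W} :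
  fin_dim (V * W)%type.
Proof.
have [m [e [l [lc le]]]] := fV; have [m' [e' [l' [lc' le']]]] := fW.
apply: (@fin_dim_fin _ ('I_m + 'I_m')%type
  (fun i => match i with inl i => (e i, 0) | inr i => (0, e' i) end)
  (fun i x => match i with inl i => l i x.1 | inr i => l' i x.2 end)).
- by case=> i a u v /=; rewrite linearP.
- case=> i x /=.
    by apply: (@continuous_comp _ _ _ fst (l i)); [exact: cvg_fst|exact: lc].
  by apply: (@continuous_comp _ _ _ snd (l' i)); [exact: cvg_snd|exact: lc'].
- move=> [x y]; rewrite big_sumType /=.
  apply/pair_equal_spec; split.
    rewrite !fst_sum /=.
    by rewrite [X in _ + X]big1 ?addr0 -?le // => i _; rewrite scaler0.
  rewrite !snd_sum /=.
  by rewrite [X in X + _]big1 ?add0r -?le' // => i _; rewrite scaler0.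
Qed.

(** Expanding the first argument in coordinates turns [B] into a sum of scalar functions times
    linear images of [g], a case of [isdiff_scale]. *)
Lemma isdiff_bilin {V W Z Y : normedModType R} {fZ : fin_dim Z} {fW : fin_dim W}
   {fV : fin_dim V} (B : V -> W -> Z) (f df : Y -> V) (g dg : Y -> W) x :
  (forall v, linear (B v)) -> (forall w, linear (B^~ w)) ->
  isdiff f x df -> isdiff g x dg ->
  isdiff (fun y => B (f y) (g y)) x (fun v => B (df v) (g x) + B (f x) (dg v)).
Proof.
move=> Bl Br Hf Hg.
have [m [e [l [lc le]]]] := fV.
have Be v w : B v w = \sum_i (l i v : R) *: B (e i) w.
  pose bL : {linear V -> Z} := HB.pack (B^~ w) (GRing.isLinear.Build _ _ _ _ _ (Br w)).
  rewrite -[LHS]/(bL v) {1}(le v) linear_sum.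
  by apply: eq_bigr => i _; rewrite linearZ.
under eq_fun do rewrite Be.
apply: isdiff_ext (isdiff_sum (df := fun i v => (l i (df v) : R) *: B (e i) (g x) +
   (l i (f x) : R) *: B (e i) (dg v)) _ _) _.
  move=> i; apply: (isdiff_scale (k := fun y => l i (f y)) (f := fun y => B (e i) (g y))).
  - exact: isdiff_comp Hf (isdiff_lin (f x) (lc i)).
  - exact: isdiff_comp Hg (isdiff_linear (g x) (Bl (e i))).
by move=> v; rewrite big_split /= -!Be.
Qed.

Lemma isdiff_mulmx {Y : normedModType R} m n p (f df : Y -> 'M[R]_(m, n))
    (g dg : Y -> 'M[R]_(n, p)) x : isdiff f x df -> isdiff g x dg ->
  isdiff (fun y => f y *m g y) x (fun v => df v *m g x + f x *m dg v).
Proof.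
apply: (isdiff_bilin (B := fun a b => a *m b)).
  by move=> v a u w; rewrite linearP.
by move=> w a u v; rewrite mulmxDl scalemxAl.
Qed.

Lemma isdiff_fst {V W} {fV : fin_dim V} {fW : fin_dim W} (x : V * W) :
  isdiff fst x fst.
Proof. exact: isdiff_linear. Qed.

Lemma isdiff_snd {V W} {fV : fin_dim V} {fW : fin_dim W} (x : V * W) :
  isdiff snd x snd.
Proof. exact: isdiff_linear. Qed.

End FiniteDimension.

(** * Maps of class C^k and smooth maps *)

Section Smooth.
Context {R : realType}.
Implicit Types U V W Z : normedModType R.

(** The iterated differentials do not depend on the set, so being of class C^k on [O] is a condition
    at each point. Restriction to subsets and gluing over covers follow from this. *)
Lemma class_C_pointwise {V W} k (O : set V) (f : V -> W) :
  class_C k O f <-> forall x, O x -> class_C k [set x] f.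
Proof.
elim: k f => [|k IH] f /=.
  by split=> [H x Ox _ -> | H x Ox]; [exact: H | exact: (H x)].
split=> [[H1 H2] x Ox|H]; split.
- by move=> _ ->; exact: H1.
- by move=> v; exact: (proj1 (IH _) (H2 v)).
- by move=> x Ox; exact: (proj1 (H x Ox)).
- by move=> v; apply/IH => x Ox; exact: (proj2 (H x Ox)).
Qed.

Lemma class_C_sub {V W} k (O O' : set V) (f : V -> W) :
  O' `<=` O -> class_C k O f -> class_C k O' f.
Proof.
move=> s /class_C_pointwise H; apply/class_C_pointwise => x /s; exact: H.
Qed.

Lemma open_near {V} (O : set V) (P : V -> Prop) x :
  open O -> O x -> (forall y, O y -> P y) -> \forall y \near x, P y.
Proof. by move=> Oo Ox H; apply: filterS H _; exact: open_nbhs_nbhs. Qed.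

(** Openness of [O] turns equality on [O] into equality near each point, which differentials
    require. *)
Lemma class_C_ext {V W} k (O : set V) (f g : V -> W) : open O ->
  (forall x, O x -> f x = g x) -> class_C k O f -> class_C k O g.
Proof.
move=> Oo; elim: k f g => [|k IH] f g fg /=.
  move=> H x Ox; have := H x Ox; rewrite /prop_for /continuous_at fg //.
  by apply: cvg_trans; apply: near_eq_cvg; apply: open_near Ox _ => // y /fg.
move=> [H1 H2].
have D x (Ox : O x) : isdiff g x ('d f x).
  by apply: isdiff_near (isdiffP (H1 x Ox)); exact: open_near fg.
split=> [x Ox|v]; first by case: (D x Ox).
by apply: IH (H2 v) => x Ox; case: (D x Ox) => _ ->.
Qed.

Lemma class_CW {V W} k (O : set V) (f : V -> W) :
  class_C k.+1 O f -> class_C k O f.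
Proof.
elim: k f => [|k IH] f /= [H1 H2].
  by move=> x Ox; apply: differentiable_continuous; exact: H1.
by split=> // v; exact: IH (H2 v).
Qed.

Lemma class_C_isdiff {V W} k (O : set V) (f : V -> W) (df : V -> V -> W) :
  open O -> (forall x, O x -> isdiff f x (df x)) ->
  (forall v, class_C k O (df^~ v)) -> class_C k.+1 O f.
Proof.
move=> Oo H1 H2; split=> [x Ox|v]; first by case: (H1 x Ox).
by apply: class_C_ext (H2 v) => // x Ox; case: (H1 x Ox) => _ ->.
Qed.

Lemma class_C_cst {V W} k (O : set V) (a : W) : open O -> class_C k O (fun=> a).
Proof.
move=> Oo; elim: k a => [|k IH] a; first by move=> x _; exact: cst_continuous.
by apply: (class_C_isdiff (df := fun _ _ => 0)) => // x _; exact: isdiff_cst.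
Qed.

Lemma class_CD {V W} k (O : set V) (f g : V -> W) : open O ->
  class_C k O f -> class_C k O g -> class_C k O (fun x => f x + g x).
Proof.
move=> Oo; elim: k f g => [|k IH] f g /=.
  by move=> Hf Hg x Ox; apply: continuousD; [exact: Hf|exact: Hg].
move=> [f1 f2] [g1 g2].
apply: (class_C_isdiff (df := fun x v => 'd f x v + 'd g x v)) => // [x Ox|v].
  by apply: isdiffD; apply: isdiffP; [exact: f1|exact: g1].
exact: IH.
Qed.

Lemma class_C_sum {V W} (I : Type) (r : seq I) k (O : set V) (f : I -> V -> W) :
  open O -> (forall i, class_C k O (f i)) ->
  class_C k O (fun x => \sum_(i <- r) f i x).
Proof.
move=> Oo H; elim: r => [|i r IH].
  by under eq_fun do rewrite big_nil; exact: class_C_cst.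
by under eq_fun do rewrite big_cons; exact: class_CD.
Qed.

Lemma class_C_bilin {V W Z Y : normedModType R} {fZ : fin_dim Z}
  {fW : fin_dim W} {fV : fin_dim V} (B : V -> W -> Z) k (O : set Y)
  (f : Y -> V) (g : Y -> W) :
  (forall v, linear (B v)) -> (forall w, linear (B^~ w)) -> open O ->
  class_C k O f -> class_C k O g -> class_C k O (fun x => B (f x) (g x)).
Proof.
move=> Bl Br Oo; elim: k f g => [|k IH] f g.
  move=> Hf Hg x Ox.
  have [d1 _] := isdiff_bilin (fZ := fZ) Bl Br (isdiff_fst (f x, g x)) (isdiff_snd (f x, g x)).
  apply: (@continuous_comp _ _ _ (fun x => (f x, g x)) (fun p => B p.1 p.2)).
    by apply: cvg_pair; [exact: Hf|exact: Hg].
  exact: differentiable_continuous.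
move=> Hf Hg; have [f1 f2] := Hf; have [g1 g2] := Hg.
apply: (class_C_isdiff (df := fun x v => B ('d f x v) (g x) + B (f x) ('d g x v))) => //.
  move=> x Ox; apply: (isdiff_bilin Bl Br (isdiffP _) (isdiffP _)); [exact: f1|exact: g1].
move=> v; apply: class_CD => //; apply: IH => //; try exact: class_CW.
all: by [exact: f2|exact: g2].
Qed.

Lemma class_C_lin {V W} {fV : fin_dim V} k (O : set V) (f : V -> W) :
  open O -> linear f -> class_C k O f.
Proof.
move=> Oo lf; case: k => [|k].
  by move=> x _; apply: differentiable_continuous; case: (isdiff_linear x lf).
apply: (class_C_isdiff (df := fun _ => f)) => // [x _|v].
  exact: isdiff_linear.
exact: class_C_cst.
Qed.

Lemma scale_bilinear {V} (v : V) :
  linear (fun k : R^o => k *: v) /\ forall k : R^o, linear (fun v : V => k *: v).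
Proof.
split=> [a x y|k a x y]; first by rewrite scalerDl scalerA.
by rewrite scalerDr !scalerA mulrC.
Qed.

Lemma class_C_scale {V W} {fW : fin_dim W} k (O : set V) (a : V -> R^o) (f : V -> W) :
  open O -> class_C k O a -> class_C k O f -> class_C k O (fun x => a x *: f x).
Proof.
apply: (class_C_bilin (B := fun (a : R^o) w => a *: w)).
  by move=> v; case: (@scale_bilinear W 0).
by move=> w; case: (@scale_bilinear W w).
Qed.

(** Separate from [class_C_comp], whose proof applies it to the coordinates of ['d g x v]. *)
Lemma class_C_lin_comp {U V W} k (O : set U) (L : {linear V -> W}) (g : U -> V) :
  continuous L -> open O -> class_C k O g -> class_C k O (fun x => L (g x)).
Proof.
move=> Lc Oo; elim: k g => [|k IH] g.
  by move=> Hg x Ox; apply: continuous_comp; [exact: Hg|exact: Lc].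
move=> [g1 g2]; apply: (class_C_isdiff (df := fun x v => L ('d g x v))) => //.
  by move=> x Ox; exact: isdiff_comp (isdiffP (g1 x Ox)) (isdiff_lin _ Lc).
by move=> v; apply: IH; exact: g2.
Qed.

(** In the chain rule the differential of [f] is applied to a direction that moves with [x].
    Expanding this direction in coordinates leaves the maps ['d f (g x) (e i)], composites of maps
    of one class lower, so induction on [k] applies. *)
Lemma class_C_comp {U V W} {fV : fin_dim V} {fW : fin_dim W} k (O : set U)
  (O' : set V) (g : U -> V) (f : V -> W) : open O ->
  (forall x, O x -> O' (g x)) -> class_C k O' f -> class_C k O g ->
  class_C k O (fun x => f (g x)).
Proof.
move=> Oo; elim: k f g => [|k IH] f g OO' Hf Hg.
  by move=> x Ox; apply: continuous_comp; [exact: Hg|apply/Hf/OO'].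
have [f1 f2] := Hf; have [g1 g2] := Hg; have [m [e [l [lc le]]]] := fV.
apply: (class_C_isdiff
  (df := fun x v => \sum_i (l i ('d g x v) : R^o) *: 'd f (g x) (e i))) => //.
  move=> x Ox; have H1 := isdiffP (g1 x Ox); have H2 := isdiffP (f1 _ (OO' _ Ox)).
  apply: isdiff_ext (isdiff_comp H1 H2) _ => v /=.
  by rewrite {1}(le ('d g x v)) linear_sum; apply: eq_bigr => i _; rewrite linearZ.
move=> v; apply: class_C_sum => // i; apply: class_C_scale => //.
  by apply: class_C_lin_comp => //; exact: g2.
by apply: (IH (fun y => 'd f y (e i))) => //; [exact: f2|exact: class_CW].
Qed.

Lemma class_C_pair {U V W} k (O : set U) (f : U -> V) (g : U -> W) : open O ->
  class_C k O f -> class_C k O g -> class_C k O (fun x => (f x, g x)).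
Proof.
move=> Oo; elim: k f g => [|k IH] f g.
  by move=> Hf Hg x Ox; apply: cvg_pair; [exact: Hf|exact: Hg].
move=> [f1 f2] [g1 g2].
apply: (class_C_isdiff (df := fun x v => ('d f x v, 'd g x v))) => //.
  by move=> x Ox; apply: isdiff_pair; apply: isdiffP; [exact: f1|exact: g1].
by move=> v; apply: IH; [exact: f2|exact: g2].
Qed.

Lemma smooth_sub {V W} (O O' : set V) (f : V -> W) :
  O' `<=` O -> smooth_on O f -> smooth_on O' f.
Proof. by move=> s H k; exact: class_C_sub (H k). Qed.

Lemma smooth_ext {V W} (O : set V) (f g : V -> W) : open O ->
  (forall x, O x -> f x = g x) -> smooth_on O f -> smooth_on O g.
Proof. by move=> Oo e H k; exact: class_C_ext (H k). Qed.

Lemma smooth_local {V W} (O : set V) (f : V -> W) :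
  (forall x, O x -> exists2 O', O' x & smooth_on O' f) -> smooth_on O f.
Proof.
move=> H k; apply/class_C_pointwise => x Ox; have [P Px HP] := H x Ox.
by have /class_C_pointwise := HP k; apply.
Qed.

Lemma smooth_cst {V W} (O : set V) (a : W) : open O -> smooth_on O (fun=> a).
Proof. by move=> Oo k; exact: class_C_cst. Qed.

Lemma smooth_lin {V W} {fV : fin_dim V} (O : set V) (f : V -> W) :
  open O -> linear f -> smooth_on O f.
Proof. by move=> Oo lf k; exact: class_C_lin. Qed.

Lemma smooth_id {V} {fV : fin_dim V} (O : set V) : open O -> smooth_on O id.
Proof. by move=> Oo; exact: smooth_lin. Qed.

Lemma smoothD {V W} (O : set V) (f g : V -> W) : open O ->
  smooth_on O f -> smooth_on O g -> smooth_on O (fun x => f x + g x).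
Proof. by move=> Oo Hf Hg k; exact: class_CD. Qed.

Lemma smooth_sum {V W} (I : Type) (r : seq I) (O : set V) (f : I -> V -> W) :
  open O -> (forall i, smooth_on O (f i)) ->
  smooth_on O (fun x => \sum_(i <- r) f i x).
Proof. by move=> Oo H k; apply: class_C_sum => // i; exact: H. Qed.

Lemma smooth_bilin {V W Z Y : normedModType R} {fZ : fin_dim Z}
  {fW : fin_dim W} {fV : fin_dim V} (B : V -> W -> Z) (O : set Y)
  (f : Y -> V) (g : Y -> W) :
  (forall v, linear (B v)) -> (forall w, linear (B^~ w)) -> open O ->
  smooth_on O f -> smooth_on O g -> smooth_on O (fun x => B (f x) (g x)).
Proof. by move=> Bl Br Oo Hf Hg k; exact: (class_C_bilin Bl Br Oo (Hf k) (Hg k)). Qed.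

Lemma smooth_scale {V W} {fW : fin_dim W} (O : set V) (a : V -> R^o) (f : V -> W) :
  open O -> smooth_on O a -> smooth_on O f -> smooth_on O (fun x => a x *: f x).
Proof. by move=> Oo Hf Hg k; exact: (class_C_scale Oo (Hf k) (Hg k)). Qed.

Lemma smooth_comp {U V W} {fV : fin_dim V} {fW : fin_dim W} (O : set U)
  (O' : set V) (g : U -> V) (f : V -> W) : open O ->
  (forall x, O x -> O' (g x)) -> smooth_on O' f -> smooth_on O g ->
  smooth_on O (fun x => f (g x)).
Proof. by move=> Oo OO' Hf Hg k; exact: (class_C_comp Oo OO' (Hf k) (Hg k)). Qed.

Lemma smooth_pair {U V W} (O : set U) (f : U -> V) (g : U -> W) : open O ->
  smooth_on O f -> smooth_on O g -> smooth_on O (fun x => (f x, g x)).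
Proof. by move=> Oo Hf Hg k; exact: (class_C_pair Oo (Hf k) (Hg k)). Qed.

Lemma smooth_isdiff {V W} (O : set V) (f : V -> W) x :
  smooth_on O f -> O x -> isdiff f x ('d f x).
Proof. by move=> /(_ 1%N)[H _] /H /isdiffP. Qed.

Lemma smooth_continuous {V W} (O : set V) (f : V -> W) x :
  smooth_on O f -> O x -> {for x, continuous f}.
Proof. by move=> /(_ 0%N) H /H. Qed.

Lemma smooth_diff_dir {V W} (O : set V) (f : V -> W) v :
  smooth_on O f -> smooth_on O (fun x => 'd f x v).
Proof. by move=> H k; case: (H k.+1) => _; apply. Qed.

Lemma smooth_linear_comp {U V W} {fV : fin_dim V} {fW : fin_dim W} (O : set U)
  (g : U -> V) (f : V -> W) : open O -> linear f -> smooth_on O g ->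
  smooth_on O (fun x => f (g x)).
Proof.
move=> Oo lf; apply: (smooth_comp (O' := setT)) => //.
by apply: smooth_lin => //; exact: openT.
Qed.

Lemma smoothN {V W} {fW : fin_dim W} (O : set V) (f : V -> W) : open O ->
  smooth_on O f -> smooth_on O (fun x => - f x).
Proof.
move=> Oo; apply: smooth_linear_comp => // a x y.
by rewrite opprD scalerN.
Qed.

Lemma smooth_fst {U V W} {fV : fin_dim V} {fW : fin_dim W} (O : set U)
  (g : U -> V * W) : open O -> smooth_on O g -> smooth_on O (fun x => (g x).1).
Proof. by move=> Oo; apply: (smooth_linear_comp (f := fst)). Qed.

Lemma smooth_snd {U V W} {fV : fin_dim V} {fW : fin_dim W} (O : set U)
  (g : U -> V * W) : open O -> smooth_on O g -> smooth_on O (fun x => (g x).2).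
Proof. by move=> Oo; apply: (smooth_linear_comp (f := snd)). Qed.

Lemma smooth_diff {U V W} {fV : fin_dim V} {fW : fin_dim W} (O : set U)
  (O' : set V) (f : V -> W) (g h : U -> V) : open O -> smooth_on O' f ->
  (forall x, O x -> O' (g x)) -> smooth_on O g -> smooth_on O h ->
  smooth_on O (fun x => 'd f (g x) (h x)).
Proof.
move=> Oo Hf OO' Hg Hh; have [m [e [l [lc le]]]] := fV.
have -> : (fun x => 'd f (g x) (h x)) =
          fun x => \sum_i (l i (h x) : R^o) *: 'd f (g x) (e i).
  apply/funext => x; rewrite [in LHS](le (h x)) linear_sum.
  by apply: eq_bigr => i _; rewrite linearZ.
apply: smooth_sum => // i; apply: smooth_scale => //.
  by apply: (smooth_linear_comp (f := l i)) => // a x y; rewrite linearP.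
by apply: (smooth_comp (O' := O') (f := fun y => 'd f y (e i))) => //; exact: smooth_diff_dir.
Qed.

Lemma open_preim {V W} (O : set V) (f : V -> W) (A : set W) :
  open O -> (forall x, O x -> {for x, continuous f}) -> open A ->
  open (O `&` f @^-1` A).
Proof.
move=> Oo fc Ao; rewrite openE => x [Ox Ax]; apply: filterI.
  exact: open_nbhs_nbhs.
by apply: (fc x Ox); exact: open_nbhs_nbhs.
Qed.

(** The derivative is a polynomial in the inverse itself, so the induction on the class closes
    up. *)
Lemma smooth_inv : smooth_on [set x : R^o | x != 0] (fun x : R^o => x^-1 : R^o).
Proof.
have Oo : open [set x : R^o | x != 0] := @open_neq R 0.
elim=> [|k IH]; first by move=> x x0; exact: inv_continuous.
apply: (@class_C_isdiff R^o R^o k _ _ (fun x v => - (v * (x^-1 * x^-1)) : R^o)) => //.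
  move=> x x0; apply: isdiff_ext (isdiff_inv x0) _ => v.
  by rewrite mulNr mulrC expr2 invfM.
move=> v; apply: (@class_C_comp R^o R^o R^o _ _ k _ setT _ (fun y : R^o => - (v * y) : R^o)) => //.
  apply: class_C_lin; first exact: openT.
  move=> a x y; rewrite -[RHS]/(a * (- (v * x)) - (v * y)).
  by rewrite -[a *: x]/(a * x) mulrDr opprD mulrN mulrCA.
exact: (@class_C_scale R^o R^o _ k _ (fun x : R^o => x^-1) (fun x : R^o => x^-1)).
Qed.

Lemma smoothM {V} (O : set V) (f g : V -> R^o) : open O ->
  smooth_on O f -> smooth_on O g -> smooth_on O (fun x => f x * g x : R^o).
Proof. by move=> Oo Hf Hg; apply: (smooth_scale (f := g)). Qed.

Lemma smooth_prod {V} (I : Type) (r : seq I) (O : set V) (f : I -> V -> R^o) :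
  open O -> (forall i, smooth_on O (f i)) ->
  smooth_on O (fun x => \prod_(i <- r) f i x : R^o).
Proof.
move=> Oo H; elim: r => [|i r IH].
  by under eq_fun do rewrite big_nil; exact: smooth_cst.
by under eq_fun do rewrite big_cons; exact: smoothM.
Qed.

Lemma smooth_mulmx {V} m n p (O : set V) (f : V -> 'M[R]_(m, n))
  (g : V -> 'M[R]_(n, p)) : open O -> smooth_on O f -> smooth_on O g ->
  smooth_on O (fun x => f x *m g x).
Proof.
apply: (smooth_bilin (B := fun (a : 'M[R]_(m, n)) (b : 'M[R]_(n, p)) => a *m b)).
  by move=> v a u w; rewrite linearP.
by move=> w a u v; rewrite mulmxDl scalemxAl.
Qed.

Lemma smooth_coord {V} m n (O : set V) (f : V -> 'M[R]_(m, n)) i j : open O ->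
  smooth_on O f -> smooth_on O (fun x => f x i j : R^o).
Proof.
move=> Oo; apply: (smooth_linear_comp (f := fun A : 'M[R]_(m, n) => A i j : R^o)) => //.
by move=> a u v; rewrite !mxE.
Qed.

Lemma smooth_matrix {V} m n (O : set V) (f : V -> 'M[R]_(m, n)) : open O ->
  (forall i j, smooth_on O (fun x => f x i j : R^o)) -> smooth_on O f.
Proof.
move=> Oo H.
have -> : f = fun x => \sum_i \sum_j (f x i j : R^o) *: delta_mx i j.
  by apply/funext => x; exact: matrix_sum_delta.
apply: smooth_sum => // i; apply: smooth_sum => // j; apply: smooth_scale => //.
exact: smooth_cst.
Qed.

Lemma smooth_det n : smooth_on setT (fun A : 'M[R]_n => \det A : R^o).
Proof.
have -> : (fun A : 'M[R]_n => \det A : R^o) = fun A =>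
    \sum_(s : 'S_n) ((-1) ^+ s : R^o) *: (\prod_i A i (s i) : R^o) by [].
apply: smooth_sum => [|s]; first exact: openT.
apply: (smooth_scale (a := fun=> (-1) ^+ s)); first exact: openT.
  by apply: smooth_cst; exact: openT.
apply: smooth_prod => [|i]; first exact: openT.
by apply: smooth_coord; [exact: openT|apply: smooth_id; exact: openT].
Qed.

Lemma open_unitmx n : open [set A : 'M[R]_n | A \in unitmx].
Proof.
have -> : [set A : 'M[R]_n | A \in unitmx] =
    setT `&` (fun A : 'M[R]_n => \det A : R^o) @^-1` [set x | x != 0].
  by apply/seteqP; split=> A /=; rewrite unitmxE unitfE; [|case].
apply: open_preim; first exact: openT.
  by move=> x _; exact: smooth_continuous (@smooth_det n) _.
exact: (@open_neq R 0).
Qed.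

(** Cramer's rule: the inverse of the determinant times the adjugate, whose entries are signed
    minors. *)
Lemma smooth_invmx n : smooth_on [set A : 'M[R]_n | A \in unitmx] (@invmx R n).
Proof.
have Oo := @open_unitmx n.
apply: (smooth_ext (f := fun A : 'M[R]_n => ((\det A)^-1 : R^o) *: \adj A)) => //.
  by move=> A /= uA; rewrite /invmx uA.
apply: smooth_scale => //.
  apply: (smooth_comp (O' := [set x : R^o | x != 0]) (f := fun x : R^o => x^-1 : R^o)) => //.
  - by move=> A /=; rewrite unitmxE unitfE.
  - exact: smooth_inv.
  - by apply: smooth_sub (@smooth_det n).
apply: smooth_matrix => // i j.
have -> : (fun A : 'M[R]_n => (\adj A) i j : R^o) =
   fun A : 'M[R]_n => (-1) ^+ (j + i) *: (\det (row' j (col' i A)) : R^o).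
  by apply/funext => A; rewrite mxE.
apply: (smooth_scale (a := fun=> (-1) ^+ (j + i))) => //; first exact: smooth_cst.
apply: (smooth_comp (O' := setT) (f := fun A : 'M[R]_(n.-1) => \det A : R^o)) => //.
  exact: smooth_det.
by apply: smooth_lin => // a u v; rewrite linearP /= linearP.
Qed.

(** Obtained by differentiating A A^-1 = 1 on the open set of invertible matrices rather than
    Cramer's formula. *)
Lemma isdiff_invmx {V} n (f df : V -> 'M[R]_n) x :
  f x \in unitmx -> isdiff f x df ->
  isdiff (fun y => invmx (f y)) x
    (fun v => - (invmx (f x) *m df v *m invmx (f x))).
Proof.
move=> ux Hf.
have Hi := isdiff_comp Hf (smooth_isdiff (@smooth_invmx n) ux).
apply: isdiff_ext Hi _ => v /=.
have H1 : isdiff (fun A : 'M[R]_n => A *m invmx A) (f x) (fun=> 0).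
  apply: isdiff_near (isdiff_cst (1%:M : 'M[R]_n) (f x)).
  by apply: open_near (@open_unitmx n) _ _ => // A /= uA; rewrite mulmxV.
have H2 := isdiff_mulmx (isdiff_id (f x)) (smooth_isdiff (@smooth_invmx n) ux).
have /esym/eqP := isdiff_uniq H1 H2 (df v).
rewrite addrC addr_eq0 => /eqP H3.
by rewrite -[LHS]mul1mx -(mulVmx ux) -[LHS]mulmxA H3 mulmxN mulmxA.
Qed.

End Smooth.

(** * Charted spaces *)

(** What the manifold axioms provide without reference to the topology of the space; openness of the
    chart images is part of [smooth_map]. Products, tangent bundles and the frame bundle inherit
    these properties. *)
Class atlas {R : realType} {E : normedModType R} (N : charted E) : Prop := Atlas {
  atlas_inj : forall c (x y : N), dom c x -> dom c y -> loc c x = loc c y -> x = y;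
  atlas_cover : forall x : N, exists c, dom c x;
  atlas_smooth : smooth_map (N1 := N) (N2 := N) (fun x => x) }.

Section LocalRepresentatives.
Context {R : realType} {E1 E2 : normedModType R} {N1 : charted E1} {N2 : charted E2}.
Context {fE1 : fin_dim E1} {fE2 : fin_dim E2}.

(** Injectivity of the chart is a hypothesis, not taken from [atlas], because the lemma serves to
    build instances of [atlas] through [smooth_map_intro]. *)
Lemma local_rep_inj (f : N1 -> N2) c d x :
  (forall y, dom c x -> dom c y -> loc c x = loc c y -> x = y) ->
  dom c x -> dom d (f x) -> local_rep f c d (loc c x) = loc d (f x).
Proof.
move=> inj cx dx; rewrite /local_rep; case: xgetP.
  by move=> _ -> [y [cy dy xy <-]]; rewrite (inj y).
by move=> /(_ (loc d (f x))) H; exfalso; apply: H; exists x.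
Qed.

Lemma local_repE {aN : atlas N1} (f : N1 -> N2) c d x :
  dom c x -> dom d (f x) -> local_rep f c d (loc c x) = loc d (f x).
Proof. by apply: local_rep_inj => y; exact: atlas_inj. Qed.

Lemma smooth_map_intro (f : N1 -> N2) c d (O : set E1) (F : E1 -> E2) :
  (forall x y, dom c x -> dom c y -> loc c x = loc c y -> x = y) ->
  open O -> loc c @` (dom c `&` f @^-1` dom d) = O -> smooth_on O F ->
  (forall x, dom c x -> dom d (f x) -> loc d (f x) = F (loc c x)) ->
  let U := loc c @` (dom c `&` f @^-1` dom d) in
  open U /\ smooth_on U (local_rep f c d).
Proof.
move=> inj Oo OE sF FE /=; rewrite OE; split=> //.
apply: smooth_ext sF => // y; rewrite -OE => -[x [cx dx] <-].
by rewrite local_rep_inj ?FE // => z; exact: inj.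
Qed.

Lemma smooth_map_isdiff (f : N1 -> N2) c d x : smooth_map f ->
  dom c x -> dom d (f x) ->
  isdiff (local_rep f c d) (loc c x) ('d (local_rep f c d) (loc c x)).
Proof.
by move=> /(_ c d)[Uo sU] cx dx; apply: smooth_isdiff sU _; exists x.
Qed.

Lemma local_rep_near {aN : atlas N1} (f : N1 -> N2) c d x (F : E1 -> E2) :
  smooth_map f -> dom c x -> dom d (f x) ->
  (forall x', dom c x' -> dom d (f x') -> loc d (f x') = F (loc c x')) ->
  \forall y \near loc c x, F y = local_rep f c d y.
Proof.
move=> sf cx dx FE; have [Uo _] := sf c d.
apply: (open_near Uo); first by exists x.
by move=> _ [z [cz dz] <-]; rewrite local_repE ?FE.
Qed.

End LocalRepresentatives.

Section Transitions.
Context {R : realType} {E : normedModType R} {N : charted E}.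
Context {fE : fin_dim E} {aN : atlas N}.
Implicit Types (c d e : chart N) (x : N).

Lemma transitionE c d x : dom c x -> dom d x -> transition c d (loc c x) = loc d x.
Proof. exact: (local_repE (f := fun x : N => x)). Qed.

Lemma open_overlap c d : open (loc c @` (dom c `&` dom d)).
Proof. by case: (atlas_smooth (N := N) c d). Qed.

Lemma open_dom c : open (loc c @` dom c).
Proof. by have := open_overlap c c; rewrite setIid. Qed.

Lemma transition_smooth c d :
  smooth_on (loc c @` (dom c `&` dom d)) (transition c d).
Proof. by case: (atlas_smooth (N := N) c d). Qed.

Lemma overlap_loc c d x : dom c x -> (loc c @` (dom c `&` dom d)) (loc c x) -> dom d x.
Proof. by move=> cx [y [cy dy] /(atlas_inj cy cx) <-]. Qed.

Lemma transition_isdiff c d x : dom c x -> dom d x ->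
  isdiff (transition c d) (loc c x) ('d (transition c d) (loc c x)).
Proof. by apply: smooth_map_isdiff; exact: atlas_smooth. Qed.

Lemma diff_transition_id c x v : dom c x -> 'd (transition c c) (loc c x) v = v.
Proof.
move=> cx; suff H : isdiff (transition c c) (loc c x) id.
  exact: (isdiff_uniq (transition_isdiff cx cx) H).
apply: isdiff_near (isdiff_id _); apply: (open_near (open_dom c)); first by exists x.
by move=> _ [y cy <-]; rewrite transitionE.
Qed.

Lemma diff_transition_comp c d e x v : dom c x -> dom d x -> dom e x ->
  'd (transition c e) (loc c x) v =
  'd (transition d e) (loc d x) ('d (transition c d) (loc c x) v).
Proof.
move=> cx dx ex; pose D w := 'd (transition d e) (loc d x) ('d (transition c d) (loc c x) w).
suff H : isdiff (transition c e) (loc c x) D.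
  exact: (isdiff_uniq (transition_isdiff cx ex) H).
have H := transition_isdiff dx ex.
apply: isdiff_near (isdiff_comp_eq (transition_isdiff cx dx) (transitionE cx dx) H).
have Oo := openI (open_overlap c d) (open_overlap c e).
apply: (open_near Oo); first by split; exists x.
move=> _ [[y [cy dy] <-] [z [cz ez]]] /(atlas_inj cz cy) yz.
by rewrite !transitionE // -yz.
Qed.

End Transitions.

Section Tangents.
Context {R : realType} {E : normedModType R} {N : charted E}.
Context {fE : fin_dim E} {aN : atlas N}.
Implicit Types (c d : chart N) (x : N).

Lemma tangent_val c d x (v : tangent x) : dom c x -> dom d x ->
  val v d = 'd (transition c d) (loc c x) (val v c).
Proof. by have /asboolP[+ _] := valP v; exact. Qed.

Lemma tangent_inj c x (v w : tangent x) : dom c x -> val v c = val w c -> v = w.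
Proof.
move=> cx vw; apply/val_inj/funext => d.
have [dx|ndx] := pselect (dom d x); first by rewrite !(tangent_val _ cx dx) vw.
by have /asboolP[_ ->] := valP v => //; have /asboolP[_ ->] := valP w.
Qed.

Definition tvec c x (e : E) : tangent x := xget 0 [set v | val v c = e].

Lemma tvecK c x e : dom c x -> val (tvec c x e) c = e.
Proof.
move=> cx; rewrite /tvec; case: xgetP => [v _ //|H].
(* The components in the other charts are forced by the transition maps, and the cocycle rule makes
   them consistent. *)
pose f d := if pselect (dom d x) then 'd (transition c d) (loc c x) e else 0.
have fP : f \in tangent_pred x.
  apply/asboolP; split=> [d d' dx d'x|d ndx].
    rewrite /f; case: (pselect (dom d' x)) => // ?; case: (pselect (dom d x)) => // ?.
    exact: diff_transition_comp.
  by rewrite /f; case: pselect.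
exfalso; apply: (H (exist _ f fP)).
by rewrite /= /f; case: (pselect (dom c x)) => // ?; rewrite diff_transition_id.
Qed.

Lemma val_tangent0 x c : val (0 : tangent x) c = 0. Proof. by []. Qed.

Lemma val_tangentD x c (v w : tangent x) : val (v + w) c = val v c + val w c.
Proof. by []. Qed.

Lemma val_tangentZ x c a (v : tangent x) : val (a *: v) c = a *: val v c.
Proof. by []. Qed.

Lemma val_tangent_sum x c (I : Type) (r : seq I) (F : I -> tangent x) :
  val (\sum_(i <- r) F i) c = \sum_(i <- r) val (F i) c.
Proof. by elim: r => [|i r IH]; rewrite ?big_nil // !big_cons val_tangentD IH. Qed.

End Tangents.

Section SmoothCriterion.
Context {R : realType} {E1 E2 : normedModType R} {N1 : charted E1} {N2 : charted E2}.
Context {fE1 : fin_dim E1} {fE2 : fin_dim E2} {aN1 : atlas N1}.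

(** Charts of the source may be chosen point by point, while charts of the target stay arbitrary.
    The requirement [dom d (f y)] on [O] supplies the openness, that is the continuity of [f]. *)
Lemma smooth_map_crit (f : N1 -> N2) :
  (forall d x, dom d (f x) -> exists c (O : set E1) (F : E1 -> E2),
    [/\ dom c x, open O, O (loc c x), smooth_on O F &
     forall y, dom c y -> O (loc c y) -> dom d (f y) /\ loc d (f y) = F (loc c y)]) ->
  smooth_map f.
Proof.
move=> H c d /=; set U := loc c @` _.
pose good x O := [/\ open O, O (loc c x), O `<=` U & smooth_on O (local_rep f c d)].
have G x : dom c x -> dom d (f x) -> exists O, good x O.
  move=> cx dx; have [e [A [F [ex Oo Oe sF FE]]]] := H d x dx.
  pose O' := loc c @` (dom c `&` dom e) `&` transition c e @^-1` A.
  have O'o : open O'.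
    apply: open_preim => //; first exact: open_overlap.
    by move=> y Uy; apply: smooth_continuous (transition_smooth c e) Uy.
  have O'P y : O' y -> exists z, [/\ dom c z, dom d (f z), loc c z = y, dom e z & loc d (f z) = F (loc e z)].
    move=> [[z [cz ez] <-] /=]; rewrite transitionE // => Oz.
    by have [dz zE] := FE z ez Oz; exists z.
  exists O'; split=> //.
  - by split; [exists x | rewrite /= transitionE].
  - by move=> y /O'P[z [cz dz <- _ _]]; exists z.
  - apply: (smooth_ext (f := fun y => F (transition c e y))) => //.
      by move=> y /O'P[z [cz dz <- ez zE]]; rewrite transitionE // local_repE.
    apply: (smooth_comp (O' := A)) => //; first by move=> y [].
    by apply: smooth_sub (transition_smooth c e) => y [].
split.
  rewrite openE => _ [x [cx dx] <-]; have [A [Oo Ox OU _]] := G x cx dx.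
  by apply: filterS OU _; exact: open_nbhs_nbhs.
apply: smooth_local => _ [x [cx dx] <-]; have [A [Oo Ox OU sO]] := G x cx dx.
by exists A.
Qed.

End SmoothCriterion.

Section Differential.
Context {R : realType} {E1 E2 : normedModType R} {N1 : charted E1} {N2 : charted E2}.
Context {fE1 : fin_dim E1} {fE2 : fin_dim E2} {aN1 : atlas N1} {aN2 : atlas N2}.

(** [dmap] is a choice with default 0, so a vector with the required components in all pairs of
    charts has to exist. It is built in the pair [c], [d], and the chain rule through the transition
    maps gives the other pairs. *)
Lemma dmapE (f : N1 -> N2) x (X : tangent x) c d : smooth_map f ->
  dom c x -> dom d (f x) ->
  val (dmap f X) d = 'd (local_rep f c d) (loc c x) (val X c).
Proof.
move=> sf cx dx; rewrite /dmap; case: xgetP => [Y _ /(_ c d cx dx) //|H].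
pose Y := tvec d (f x) ('d (local_rep f c d) (loc c x) (val X c)).
exfalso; apply: (H Y) => c' d' c'x d'x.
rewrite (tangent_val _ dx d'x) tvecK // (tangent_val _ c'x cx).
have L := smooth_map_isdiff sf cx dx.
have T := transition_isdiff (aN := aN2) dx d'x.
have C := transition_isdiff (aN := aN1) c'x cx.
have CL := isdiff_comp_eq C (transitionE (aN := aN1) c'x cx) L.
have fE : local_rep f c d (transition c' c (loc c' x)) = loc d (f x).
  by rewrite transitionE // local_repE.
have CLT := isdiff_comp_eq CL fE T.
suff K : isdiff (local_rep f c' d') (loc c' x) (fun w => 'd (transition d d')
    (loc d (f x)) ('d (local_rep f c d) (loc c x) ('d (transition c' c) (loc c' x) w))).
  by rewrite (isdiff_uniq (smooth_map_isdiff sf c'x d'x) K).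
apply: isdiff_near CLT.
have [Uo _] := sf c' d'; have [Wo _] := sf c d.
pose W := loc c' @` (dom c' `&` dom c) `&` transition c' c @^-1` (loc c @` (dom c `&` f @^-1` dom d)).
have Wopen : open W.
  apply: open_preim => //; first exact: open_overlap.
  by move=> y Uy; exact: smooth_continuous (transition_smooth c' c) Uy.
apply: (open_near (openI Wopen Uo)).
  split; last by exists x.
  by split; [exists x | rewrite /= transitionE //; exists x].
move=> _ [[[y [c'y cy] <-] /=]]; rewrite transitionE //.
move=> [z [cz dz] /(atlas_inj cz cy) zy]; subst z.
move=> [z [c'z d'z] /(atlas_inj c'z c'y) zy]; subst z.
by rewrite !local_repE // transitionE.
Qed.

Lemma dmap_formula (f : N1 -> N2) x (X : tangent x) c d (F : E1 -> E2) D :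
  smooth_map f -> dom c x -> dom d (f x) ->
  (forall y, dom c y -> dom d (f y) -> loc d (f y) = F (loc c y)) ->
  isdiff F (loc c x) D -> val (dmap f X) d = D (val X c).
Proof.
move=> sf cx dx FE dF; rewrite (dmapE _ sf cx dx).
apply: (isdiff_uniq (smooth_map_isdiff sf cx dx)).
exact: isdiff_near (local_rep_near sf cx dx FE) dF.
Qed.

(** Differentiability is assumed in the single chart [d0]; the transition maps carry it to any other
    chart, and show that the vector chosen by [vdiff] exists. *)
Lemma vdiffE (f : E1 -> N2) x d0 d : (\forall y \near x, dom d0 (f y)) ->
  differentiable (fun y => loc d0 (f y)) x -> dom d (f x) ->
  isdiff (fun y => loc d (f y)) x (fun v => val (vdiff f x v) d).
Proof.
move=> nd0 df dx; have d0x := nbhs_singleton nd0.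
have G d' : dom d' (f x) -> isdiff (fun y => loc d' (f y)) x
    (fun v => 'd (transition d0 d') (loc d0 (f x)) ('d (fun y => loc d0 (f y)) x v)).
  move=> d'x; apply: isdiff_near (isdiff_comp (isdiffP df) (transition_isdiff d0x d'x)).
  have := differentiable_continuous df.
  have : nbhs (loc d0 (f x)) (loc d0 @` (dom d0 `&` dom d')).
    by apply: open_nbhs_nbhs; split; [exact: open_overlap | exists (f x)].
  move=> O /(_ _ O) /= nO; near=> y.
  have d0y : dom d0 (f y) by near: y.
  have d'y : dom d' (f y) by apply: (overlap_loc d0y); near: y.
  by rewrite transitionE.
apply: isdiff_ext (G d dx) _ => v; rewrite /vdiff; case: xgetP => [Y _ /(_ d dx) ->|H].
  by case: (G d dx).
pose Y := tvec d0 (f x) ('d (fun y => loc d0 (f y)) x v).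
exfalso; apply: (H Y) => d' d'x; rewrite (tangent_val _ d0x d'x) tvecK //.
by case: (G d' d'x).
Unshelve. all: by end_near. Qed.

End Differential.

(** * Linear frames *)

Section AtlasInstances.
Context {R : realType}.

Lemma open_prod {V W : normedModType R} (A : set V) (B : set W) :
  open A -> open B -> open [set p : V * W | A p.1 /\ B p.2].
Proof.
move=> Ao Bo; have -> : [set p : V * W | A p.1 /\ B p.2] =
  (setT `&` fst @^-1` A) `&` (setT `&` snd @^-1` B).
  by apply/seteqP; split=> p /=; [case=> ? ?|case=> -[_ ?] [_ ?]].
by apply: openI; apply: open_preim => //; try exact: openT;
  move=> x _; [exact: cvg_fst|exact: cvg_snd].
Qed.

Lemma open_prodl {V W : normedModType R} (A : set V) :
  open A -> open [set p : V * W | A p.1].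
Proof.
move=> Ao; have -> : [set p : V * W | A p.1] = [set p : V * W | A p.1 /\ setT p.2].
  by apply/seteqP; split=> p //= [].
by apply: open_prod => //; exact: openT.
Qed.

Global Instance atlas_vec (V : normedModType R) {fV : fin_dim V} : atlas (vec V).
Proof.
split=> [? x y _ _ // | x | c d]; first by exists tt.
apply: (smooth_map_intro (O := setT) (F := id)) => //.
- exact: openT.
- by apply/seteqP; split=> // x _; exists x.
- by apply: smooth_id; exact: openT.
Qed.

Global Instance atlas_prod {E1 E2 : normedModType R} {f1 : fin_dim E1}
  {f2 : fin_dim E2} (N1 : charted E1) (N2 : charted E2) {a1 : atlas N1}
  {a2 : atlas N2} : atlas (prodc N1 N2).
Proof.
have inj (c : chart (prodc N1 N2)) (x y : prodc N1 N2) :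
    dom c x -> dom c y -> loc c x = loc c y -> x = y.
  case: c x y => [c1 c2] [x1 x2] [y1 y2] /= [? ?] [? ?] [e1 e2].
  by rewrite (atlas_inj _ _ e1) // (atlas_inj _ _ e2).
split=> // [[x1 x2]|c d].
  have [[c1 ?] [c2 ?]] := (atlas_cover x1, atlas_cover x2).
  by exists (c1, c2).
pose proof (open_prod (open_overlap c.1 d.1) (open_overlap c.2 d.2)) as Oo.
apply: (smooth_map_intro (N1 := prodc N1 N2) (N2 := prodc N1 N2)
  (f := fun x => x) (d := d) (F := fun p => (transition c.1 d.1 p.1, transition c.2 d.2 p.2)) (inj c) Oo).
- apply/seteqP; split=> [_ [x [[? ?] [? ?]] <-]|[p1 p2] /= [[x1 [? ?] <-] [x2 [? ?] <-]]] /=.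
    by split; [exists x.1 | exists x.2].
  by exists (x1, x2).
- apply: smooth_pair => //.
    apply: (smooth_comp (f := transition c.1 d.1) _ _ (transition_smooth c.1 d.1)) => //.
      by move=> x [].
    by apply: smooth_fst => //; exact: smooth_id.
  apply: (smooth_comp (f := transition c.2 d.2) _ _ (transition_smooth c.2 d.2)) => //.
    by move=> x [].
  by apply: smooth_snd => //; exact: smooth_id.
- by move=> x [? ?] [? ?] /=; rewrite !transitionE.
Qed.

Global Instance atlas_tangent {E : normedModType R} {fE : fin_dim E}
  (N : charted E) {aN : atlas N} : atlas (tangent_bundle N).
Proof.
have inj (c : chart (tangent_bundle N)) (x y : tangent_bundle N) :
    dom c x -> dom c y -> loc c x = loc c y -> x = y.
  move: x y => [x v] [y w] /= cx cy [xy vw].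
  have e : x = y by exact: atlas_inj xy.
  subst y.
  by rewrite (tangent_inj cx vw).
split=> // [[x v]|c d]; first by have [c cx] := atlas_cover x; exists c.
have Oo : open [set p : E * E | (loc (N := N) c @` (dom (N := N) c `&` dom (N := N) d)) p.1].
  exact: open_prodl (open_overlap (N := N) c d).
pose F (p : E * E) : E * E := let f := transition (N := N) c d in (f p.1, 'd f (p.1 : E) p.2).
apply: (smooth_map_intro (N1 := tangent_bundle N) (N2 := tangent_bundle N)
  (f := fun x => x) (d := d) (F := F) (inj c) Oo).
- apply/seteqP; split=> [_ [x [? ?] <-]|[p1 p2] /= [x [cx dx] <-]] /=; first by exists (tag x).
  by exists (existT _ x (tvec (N := N) c x p2)) => //=; rewrite tvecK.
- have s1 : smooth_on [set p : E * E | (loc (N := N) c @` (dom (N := N) c `&` dom (N := N) d)) p.1] fst.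
    by apply: smooth_fst => //; exact: smooth_id.
  have s2 : smooth_on [set p : E * E | (loc (N := N) c @` (dom (N := N) c `&` dom (N := N) d)) p.1] snd.
    by apply: smooth_snd => //; exact: smooth_id.
  pose proof (transition_smooth (N := N) c d) as st.
  by apply: smooth_pair => //; [exact: (smooth_comp (f := transition (N := N) c d) _ _ st)
    | exact: (smooth_diff _ st)].
- by move=> [x v] /= cx dx; rewrite /F /= transitionE // -(tangent_val v cx dx).
Qed.

Global Instance atlas_manifold n (M : manifold R n) : atlas M.
Proof.
split; [exact: mloc_inj | exact: mcover | exact: mcompat].
Qed.

End AtlasInstances.

Section Jacobian.
Context {R : realType} {n : nat}.
Notation E := 'cV[R]_n.

Definition jac (f : E -> E) (y : E) : 'M[R]_n :=
  \matrix_(i, j) 'd f y (delta_mx j 0) i 0.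

Lemma cV_sum_delta (v : E) : v = \sum_j v j 0 *: delta_mx j 0.
Proof.
rewrite [LHS]matrix_sum_delta; apply: eq_bigr => i _.
by rewrite (bigD1 0) //= big1 ?addr0 // => j; rewrite ord1 eqxx.
Qed.

Lemma jacE f y v : 'd f y v = jac f y *m v.
Proof.
rewrite [in LHS](cV_sum_delta v) linear_sum; apply/matrixP => i k; rewrite ord1 !mxE summxE.
by apply: eq_bigr => j _; rewrite linearZ /= !mxE mulrC.
Qed.

Lemma jac_smooth (O : set E) f : open O -> smooth_on O f -> smooth_on O (jac f).
Proof.
move=> Oo sf; apply: smooth_matrix => // i j.
have -> : (fun y => jac f y i j : R^o) = fun y => ('d f y (delta_mx j 0)) i 0 : R^o.
  by apply/funext => y; rewrite mxE.
by apply: smooth_coord => //; exact: smooth_diff_dir.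
Qed.

End Jacobian.

Section FrameAtlas.
Context {R : realType} {n : nat} {M : manifold R n}.
Notation P1 := (frame_bundle M).
Implicit Types (c d : chart M) (u : P1).

Definition fmat c u : 'M[R]_n := \matrix_(i, j) val (fvec u j) c i 0.

Lemma frame_map_val c (x : M) (w : 'I_n -> tangent x) xi :
  val (frame_map w xi) c = (\matrix_(i, j) val (w j) c i 0) *m xi.
Proof.
rewrite /frame_map val_tangent_sum; apply/matrixP => i k.
rewrite ord1 mxE summxE; apply: eq_bigr => j _.
by rewrite val_tangentZ !mxE mulrC.
Qed.

Lemma frame_map_bij c (x : M) (w : 'I_n -> tangent x) : dom c x ->
  bijective (frame_map w) <-> (\matrix_(i, j) val (w j) c i 0) \in unitmx.
Proof.
move=> cx; set a := matrix_of_fun _ _; split=> [[g fg gf]|ua].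
  (* The columns of [b] are the preimages of the coordinate vectors, so [b] is a right inverse of
     [a]. *)
  pose b : 'M[R]_n := \matrix_(i, j) (g (tvec c x (delta_mx j 0))) i 0.
  suff /mulmx1_unit[] : a *m b = 1%:M by [].
  apply/matrixP => i j.
  have : val (frame_map w (g (tvec c x (delta_mx j 0)))) c = delta_mx j 0.
    by rewrite gf tvecK.
  rewrite frame_map_val -/a => /matrixP /(_ i 0); rewrite !mxE eqxx andbT.
  by move=> <-; apply: eq_bigr => k _; rewrite !mxE.
exists (fun v => invmx a *m val v c) => [xi|v].
  by rewrite frame_map_val -/a mulKmx.
by apply: (tangent_inj cx); rewrite frame_map_val -/a mulKVmx.
Qed.

Lemma fmat_unit c u : dom c (tag u) -> fmat c u \in unitmx.
Proof. by move=> cx; apply/(frame_map_bij _ cx); exact/asboolP/(valP (tagged u)). Qed.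

Lemma frame_inj c u u' : dom c (tag u) -> dom c (tag u') ->
  loc c (tag u) = loc c (tag u') -> fmat c u = fmat c u' -> u = u'.
Proof.
case: u u' => [x w] [x' w'] /= cx cx' xx' e; have xE : x = x' by exact: atlas_inj xx'.
subst x'.
congr existT; apply/val_inj/funext => j; apply: (tangent_inj cx).
apply/matrixP => i k; rewrite ord1; have /matrixP /(_ i j) := e.
by rewrite !mxE.
Qed.

Lemma frame_ex c (x : M) (a : 'M[R]_n) : dom c x -> a \in unitmx ->
  exists u : P1, tag u = x /\ fmat c u = a.
Proof.
move=> cx ua; pose w j := tvec c x (col j a).
have wa : \matrix_(i, j) val (w j) c i 0 = a.
  by apply/matrixP => i j; rewrite mxE tvecK // mxE.
have wP : `[< bijective (frame_map w) >].
  by apply/asboolP/(frame_map_bij _ cx); rewrite wa.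
by exists (existT _ x (exist _ w wP)); split.
Qed.

Lemma frame_coordE c u (v : tangent (tag u)) : dom c (tag u) ->
  frame_coord v = invmx (fmat c u) *m val v c.
Proof.
move=> cx; rewrite /frame_coord; case: xgetP => [xi _ /= <-|H].
  by rewrite frame_map_val -/(fmat c u) mulKmx ?fmat_unit.
exfalso; apply: (H (invmx (fmat c u) *m val v c)); apply: (tangent_inj cx).
by rewrite frame_map_val -/(fmat c u) mulKVmx ?fmat_unit.
Qed.

Lemma frame_act_fmat c u a : dom c (tag u) -> a \in unitmx ->
  fmat c (frame_act u a) = fmat c u *m a.
Proof.
move=> cx ua; pose w j := \sum_i a i j *: fvec u i.
have wE : \matrix_(i, j) val (w j) c i 0 = fmat c u *m a.
  apply/matrixP => i j; rewrite !mxE val_tangent_sum summxE; apply: eq_bigr => k _.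
  by rewrite val_tangentZ !mxE mulrC.
have wP : `[< bijective (frame_map w) >].
  by apply/asboolP/(frame_map_bij _ cx); rewrite wE unitmx_mul fmat_unit.
(* [insubd] does not fall back on [u], since [w] is a frame when [a] is invertible. *)
have wa : val (tagged (frame_act u a)) = w := insubdK (tagged u) wP.
rewrite -wE; apply/matrixP => i j; rewrite !mxE.
exact: (congr1 (fun f : 'I_n -> tangent (tag u) => val (f j) c i 0) wa).
Qed.

Lemma frame_overlap c d :
  loc (N := P1) c @` (dom (N := P1) c `&` dom (N := P1) d) =
  [set p | (loc c @` (dom c `&` dom d)) p.1 /\ p.2 \in unitmx].
Proof.
apply/seteqP; split=> [_ [u [cx dx] <-]|[y a] [[x [cx dx] /= <-] ua]] /=.
  by split; [exists (tag u) | exact: fmat_unit].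
have [u [ux ua']] := frame_ex cx ua; subst x.
by exists u => //; rewrite /= -/(fmat c u) ua'.
Qed.

Lemma fmat_transition c d u : dom c (tag u) -> dom d (tag u) ->
  fmat d u = jac (transition c d) (loc c (tag u)) *m fmat c u.
Proof.
move=> cx dx; apply/matrixP => i j; rewrite !mxE (tangent_val _ cx dx) jacE !mxE.
by apply: eq_bigr => k _; rewrite !mxE.
Qed.

Definition frame_transition c d (p : 'cV[R]_n * 'M[R]_n) : 'cV[R]_n * 'M[R]_n :=
  (transition c d p.1, jac (transition c d) p.1 *m p.2).

Lemma frame_transitionE c d u : dom c (tag u) -> dom d (tag u) ->
  loc (N := P1) d u = frame_transition c d (loc (N := P1) c u).
Proof.
move=> cx dx; rewrite /frame_transition /= transitionE //.
by rewrite -/(fmat c u) -/(fmat d u) -fmat_transition.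
Qed.

Global Instance atlas_frame : atlas P1.
Proof.
split=> [c u u' cx cx' /= [e1 e2]|u|c d]; first exact: frame_inj e2.
  by have [c cx] := atlas_cover (tag u); exists c.
pose proof (open_prod (open_overlap (N := M) c d) (@open_unitmx R n)) as Oo.
apply: (smooth_map_intro (f := fun u : P1 => u) (d := d) (F := frame_transition c d) _ Oo (frame_overlap c d)).
- by move=> u u' cx cx' /= [e1 e2]; exact: frame_inj e2.
- pose proof (transition_smooth (N := M) c d) as st.
  have s1 O (Op : open O) : smooth_on O (fun p : 'cV[R]_n * 'M[R]_n => p.1).
    by apply: smooth_fst => //; exact: smooth_id.
  apply: smooth_pair => //.
    by apply: (smooth_comp (f := transition (N := M) c d) _ _ st) => //; [by move=> ? []|exact: s1].
  apply: smooth_mulmx => //; last by apply: smooth_snd => //; exact: smooth_id.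
  pose proof (jac_smooth (open_overlap (N := M) c d) st) as sj.
  by apply: (smooth_comp (f := jac (transition (N := M) c d)) _ _ sj) => //; [by move=> ? []|exact: s1].
- by move=> u cx dx; exact: frame_transitionE.
Qed.

(** The derivative of the Jacobian along the base direction appears in the frame component: it is
    the source of the inhomogeneous term in the transformation rule of Christoffel symbols. *)
Lemma frame_transition_isdiff c d u : dom c (tag u) -> dom d (tag u) ->
  isdiff (frame_transition c d) (loc (N := P1) c u) (fun w =>
    (jac (transition c d) (loc c (tag u)) *m w.1,
     'd (jac (transition c d)) (loc c (tag u)) w.1 *m fmat c u
       + jac (transition c d) (loc c (tag u)) *m w.2)).
Proof.
move=> cx dx; set y := loc c (tag u).
have Oy : (loc c @` (dom c `&` dom d)) y by exists (tag u).
pose proof (transition_smooth c d) as st.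
pose proof (jac_smooth (open_overlap c d) st) as sj.
pose proof (isdiff_fst (loc (N := P1) c u)) as d1; pose proof (isdiff_snd (loc (N := P1) c u)) as d2.
pose proof (isdiff_comp_eq d1 (erefl : _ = y) (smooth_isdiff st Oy)) as H1.
pose proof (isdiff_comp_eq d1 (erefl : _ = y) (smooth_isdiff sj Oy)) as H2.
apply: isdiff_ext (isdiff_pair H1 (isdiff_mulmx H2 d2)) _ => w /=.
by rewrite jacE -/(fmat c u).
Qed.

Lemma frame_tangent_val c d u (T : tangent u) : dom c (tag u) -> dom d (tag u) ->
  val T d = (jac (transition c d) (loc c (tag u)) *m (val T c).1,
     'd (jac (transition c d)) (loc c (tag u)) (val T c).1 *m fmat c u
       + jac (transition c d) (loc c (tag u)) *m (val T c).2).
Proof.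
move=> cx dx; have -> := tangent_val (N := P1) T cx dx.
pose proof (isdiff_near (local_rep_near (f := fun u : P1 => u) atlas_smooth cx dx
  (fun u cu du => frame_transitionE cu du)) (frame_transition_isdiff cx dx)) as H.
by have [_ ->] := H.
Qed.

End FrameAtlas.

Section P1gAtlas.
Context {R : realType} {n : nat} {M : manifold R n}.

Global Instance atlas_P1g : atlas (P1g M).
Proof. exact: atlas_prod. Qed.

Definition P1g_transition c d (p : ('cV[R]_n * 'M[R]_n) * 'M[R]_n) :=
  (frame_transition (M := M) c d p.1, p.2).

Lemma P1g_tangent_val c d (q : P1g M) (T : tangent q) :
  dom c (tag q.1) -> dom d (tag q.1) ->
  val T (d, tt) =
    (jac (transition c d) (loc c (tag q.1)) *m (val T (c, tt)).1.1,
     'd (jac (transition c d)) (loc c (tag q.1)) (val T (c, tt)).1.1 *m fmat c q.1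
       + jac (transition c d) (loc c (tag q.1)) *m (val T (c, tt)).1.2,
     (val T (c, tt)).2).
Proof.
move=> cx dx.
have cq : dom (N := P1g M) (c, tt) q by [].
have dq : dom (N := P1g M) (d, tt) q by [].
have -> := tangent_val T cq dq.
have E (q' : P1g M) : dom (N := P1g M) (c, tt) q' -> dom (N := P1g M) (d, tt) q' ->
    loc (N := P1g M) (d, tt) q' = P1g_transition c d (loc (N := P1g M) (c, tt) q').
  by move=> [cu _] [du _]; rewrite /P1g_transition /= -frame_transitionE.
pose proof (isdiff_fst (loc (N := P1g M) (c, tt) q)) as d1.
pose proof (isdiff_snd (loc (N := P1g M) (c, tt) q)) as d2.
pose proof (isdiff_comp_eq d1 erefl (frame_transition_isdiff cx dx)) as H1.
pose proof (isdiff_near (local_rep_near (f := fun q : P1g M => q) atlas_smooth cq dq E)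
  (isdiff_pair H1 d2)) as H.
by have [_ ->] := H.
Qed.

End P1gAtlas.

(** * Adjoint actions *)

Section Arrays.
Context {R : realType} {n : nat}.
Implicit Types (b : 'M[R]_(n, n * n)) (v : 'cV[R]_n) (D : 'I_n -> 'M[R]_n).

Lemma array_eval_linearl v : linear (array_eval^~ v).
Proof.
move=> a b b'; apply/matrixP => i j; rewrite !mxE mulr_sumr -big_split /=.
by apply: eq_bigr => k _; rewrite !mxE mulrDl mulrA.
Qed.

Lemma array_eval_linearr b : linear (array_eval b).
Proof.
move=> a v w; apply/matrixP => i j; rewrite !mxE mulr_sumr -big_split /=.
by apply: eq_bigr => k _; rewrite !mxE mulrDr mulrCA.
Qed.

Lemma array_evalD b v w : array_eval b (v + w) = array_eval b v + array_eval b w.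
Proof. by have := array_eval_linearr b 1 v w; rewrite !scale1r. Qed.

Lemma array_evalZ b a v : array_eval b (a *: v) = a *: array_eval b v.
Proof.
have := array_eval_linearr b a v 0; rewrite !addr0 => ->.
have := array_eval_linearr b (-1) 0 0; rewrite scaler0 addr0 scaleN1r addNr => ->.
by rewrite addr0.
Qed.

Lemma array_eval0 b : array_eval b 0 = 0.
Proof. by have := array_evalZ b 0 0; rewrite !scale0r. Qed.

Lemma array_evalN b v : array_eval (- b) v = - array_eval b v.
Proof.
apply/matrixP => i j; rewrite !mxE -sumrN; apply: eq_bigr => k _.
by rewrite mxE mulNr.
Qed.

Lemma array_eval_sum b v : array_eval b v = \sum_k v k 0 *: array_eval b (delta_mx k 0).
Proof.
rewrite [in LHS](cV_sum_delta v) (big_morph (array_eval b) (array_evalD b) (array_eval0 b)).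
by apply: eq_bigr => k _; rewrite array_evalZ.
Qed.

Lemma array_eval_array D k : array_eval (array D) (delta_mx k 0) = D k.
Proof.
apply/matrixP => i j; rewrite mxE (bigD1 k) //= big1 ?addr0.
  by rewrite !mxE !eqxx mulr1 mxvecE mxE.
by move=> l /negbTE lk; rewrite [in X in _ * X]mxE lk mulr0.
Qed.

Lemma array_eval_delta b i j k : array_eval b (delta_mx k 0) i j = b i (mxvec_index j k).
Proof.
rewrite mxE (bigD1 k) //= big1 ?addr0 => [|l /negbTE lk]; rewrite !mxE ?eqxx ?mulr1 //.
by rewrite lk mulr0.
Qed.

Lemma array_evalK b : array (fun k => array_eval b (delta_mx k 0)) = b.
Proof.
apply/matrixP => i jk; case/mxvec_indexP: jk => j k.
by rewrite /array mxE mxvecE mxE array_eval_delta.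
Qed.

Lemma array_eval_inj b b' :
  (forall k, array_eval b (delta_mx k 0) = array_eval b' (delta_mx k 0)) -> b = b'.
Proof.
by move=> H; rewrite -(array_evalK b) -(array_evalK b'); congr array; apply/funext.
Qed.

Lemma array0 : array (fun=> 0 : 'M[R]_n) = 0.
Proof.
by apply/matrixP => i jk; case/mxvec_indexP: jk => j k; rewrite /array !mxE mxvecE !mxE.
Qed.

Lemma smooth_array_eval {V : normedModType R} (O : set V)
  (f : V -> 'M[R]_(n, n * n)) (g : V -> 'cV[R]_n) : open O ->
  smooth_on O f -> smooth_on O g -> smooth_on O (fun x => array_eval (f x) (g x)).
Proof.
by apply: (smooth_bilin (B := @array_eval R n)); [exact: array_eval_linearr|exact: array_eval_linearl].
Qed.

Lemma smooth_array {V : normedModType R} (O : set V) (f : 'I_n -> V -> 'M[R]_n) :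
  open O -> (forall k, smooth_on O (f k)) -> smooth_on O (fun x => array (f^~ x)).
Proof.
move=> Oo H; apply: smooth_matrix => // i jk; case/mxvec_indexP: jk => j k.
have -> : (fun x => array (f^~ x) i (mxvec_index j k) : R^o) = fun x => f k x i j.
  by apply/funext => x; rewrite /array mxE mxvecE mxE.
exact: smooth_coord.
Qed.

End Arrays.

Section AdjointActions.
Context {R : realType} {n : nat}.
Notation GL := (@GL R n).
Implicit Types (a A B : 'M[R]_n).

Lemma Ad_GL a A : Ad GL a A = a *m A *m invmx a.
Proof.
have [|_ H] := @isdiff_linear R _ _ _ (fun h => a *m h *m invmx a) 1%:M; last exact: H.
by move=> k u v; rewrite linearP /= mulmxDl -scalemxAl.
Qed.

(** Conjugation by g sends h to (Ad_{g.1} h.1, Ad_{g.1} (Ad_{h.1^-1} g.2 + h.2 - g.2)).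
    Differentiating Ad_{h.1^-1} g.2 at h.1 = 1 gives the bracket of g.2 with X.1. *)
Lemma Ad_semidirect_GL (g X : 'M[R]_n * 'M[R]_n) : g.1 \in unitmx ->
  Ad (semidirect GL) g X =
    (g.1 *m X.1 *m invmx g.1,
     g.1 *m (g.2 *m X.1 - X.1 *m g.2 + X.2) *m invmx g.1).
Proof.
move=> u1; set c := invmx g.1.
pose F (h : 'M[R]_n * 'M[R]_n) := (g.1 *m h.1 *m c,
  g.1 *m (invmx h.1 *m g.2 *m h.1 + h.2) *m c + (- (g.1 *m g.2 *m c))).
have uO : open [set h : 'M[R]_n * 'M[R]_n | h.1 \in unitmx] := open_prodl (@open_unitmx R n).
suff H : isdiff F (1%:M, 0) (fun X => (g.1 *m X.1 *m c, g.1 *m (g.2 *m X.1 - X.1 *m g.2 + X.2) *m c)).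
  suff E : \forall h \near (1%:M : 'M[R]_n, 0 : 'M[R]_n), F h =
      gmul (semidirect GL) (gmul (semidirect GL) g h) (ginv (semidirect GL) g).
    by have [_] := isdiff_near E H; apply.
  apply: (open_near uO); first exact: unitmx1.
  move=> h uh; rewrite /= !Ad_GL /F; congr (_, _).
  by rewrite invmxK (invmxK h.1).
pose z := (1%:M : 'M[R]_n, 0 : 'M[R]_n).
pose proof (isdiff_fst z) as d1; pose proof (isdiff_snd z) as d2.
pose proof (isdiff_invmx (x := z) (unitmx1 R n) d1) as di.
have dc (b : 'M[R]_n) := isdiff_cst b z.
have D1 := isdiff_mulmx (isdiff_mulmx (dc g.1) d1) (dc c).
have D2 := isdiffD (isdiff_mulmx (isdiff_mulmx di (dc g.2)) d1) d2.
have D3 := isdiffD (isdiff_mulmx (isdiff_mulmx (dc g.1) D2) (dc c)) (dc (- (g.1 *m g.2 *m c))).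
apply: isdiff_ext (isdiff_pair D1 D3) _ => Y /=; congr (_, _).
  by rewrite !mulmx0 mul0mx add0r addr0.
rewrite !mulmx0 !mul0mx !add0r !addr0 invmx1 !mul1mx !mulmx1 mulNmx.
by rewrite addrC [- _ + _]addrC addrC.
Qed.

Lemma ginv_semidirect_GL (g : 'M[R]_n * 'M[R]_n) :
  ginv (semidirect GL) g = (invmx g.1, - (g.1 *m g.2 *m invmx g.1)).
Proof. by rewrite /= Ad_GL. Qed.

Lemma Ad_ginv_semidirect_GL (g X : 'M[R]_n * 'M[R]_n) : g.1 \in unitmx ->
  let Y := invmx g.1 *m X.1 *m g.1 in
  Ad (semidirect GL) (ginv (semidirect GL) g) X =
    (Y, invmx g.1 *m X.2 *m g.1 - (g.2 *m Y - Y *m g.2)).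
Proof.
move=> u; rewrite ginv_semidirect_GL Ad_semidirect_GL /= ?unitmx_inv // invmxK.
congr (_, _); rewrite !(mulmxDr, mulmxDl, mulmxN, mulNmx) !mulmxA mulVmx // mul1mx.
rewrite -!mulmxA mulVmx // mulmx1 opprK !mulmxA.
by rewrite addrC [- _ + _]addrC opprB.
Qed.

(** Products with elements (a, 0) are those that the action of the subgroup GL and its adjoint
    action involve; the germ of (a, 0) is constant, which keeps the jet of the composite
    explicit. *)
Lemma gmul_G2l a (h : 'M[R]_n * 'M[R]_(n, n * n)) :
  gmul G2 (a, 0) h = (a *m h.1, array (fun k => a *m array_eval h.2 (delta_mx k 0))).
Proof.
pose F x := a *m germ2 h x.
have E : (fun x : 'cV[R]_n => germ2 (a, 0) (h.1 *m x) *m germ2 h x) = F.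
  apply/funext => x; congr (_ *m _); rewrite /germ2 /=.
  apply/matrixP => i j; rewrite !mxE big1 ?addr0 // => k _.
  by rewrite mxE mul0r.
have -> : gmul G2 (a, 0) h = jet2 F by rewrite -E.
rewrite /jet2; congr (_, _); first by rewrite /F /germ2 array_eval0 addr0.
congr array; apply/funext => k.
have D : isdiff F 0 (fun v => a *m array_eval h.2 v).
  apply: isdiff_ext (isdiff_mulmx (isdiff_cst a _) (isdiffD (isdiff_cst h.1 _)
    (isdiff_linear _ (array_eval_linearr h.2)))) _ => v.
  by rewrite mul0mx !add0r.
by have [_ ->] := D.
Qed.

Lemma gmul_G2r a (g : 'M[R]_n * 'M[R]_(n, n * n)) :
  gmul G2 g (a, 0) =
    (g.1 *m a, array (fun k => array_eval g.2 (a *m delta_mx k 0) *m a)).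
Proof.
pose F x := germ2 g (a *m x) *m a.
have E : (fun x : 'cV[R]_n => germ2 g ((a, 0 : 'M[R]_(n, n * n)).1 *m x) *m germ2 (a, 0) x) = F.
  apply/funext => x; congr (_ *m _); rewrite /germ2 /=.
  apply/matrixP => i j; rewrite !mxE big1 ?addr0 // => k _.
  by rewrite mxE mul0r.
have -> : gmul G2 g (a, 0) = jet2 F by rewrite -E.
rewrite /jet2; congr (_, _); first by rewrite /F /germ2 mulmx0 array_eval0 addr0.
congr array; apply/funext => k.
have D : isdiff F 0 (fun v => array_eval g.2 (a *m v) *m a).
  have L : linear (fun v => array_eval g.2 (a *m v)).
    by move=> c v w; rewrite linearP /= array_evalD array_evalZ.
  apply: isdiff_ext (isdiff_mulmx (isdiffD (isdiff_cst g.1 _)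
    (isdiff_linear _ L)) (isdiff_cst a _)) _ => v.
  by rewrite mulmx0 add0r addr0.
by have [_ ->] := D.
Qed.

Lemma ginv_G2 a : ginv G2 (a, 0 : 'M[R]_(n, n * n)) = (invmx a, 0).
Proof.
have -> : ginv G2 (a, 0 : 'M[R]_(n, n * n)) = jet2 (fun=> invmx a).
  congr jet2; apply/funext => x; congr invmx; rewrite /germ2 /=.
  apply/matrixP => i j; rewrite !mxE big1 ?addr0 // => k _.
  by rewrite mxE mul0r.
rewrite /jet2.
have -> // : array (fun k => 'd (fun _ : 'cV[R]_n => invmx a) 0 (delta_mx k 0)) = 0.
rewrite -array0; congr array; apply/funext => k.
by have [_ ->] := isdiff_cst (invmx a) (0 : 'cV[R]_n).
Qed.

(** Conjugation by (a, 0) is linear in the coordinates of the group, hence its own differential at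
    the unit. *)
Lemma Ad_G2 a (X : 'M[R]_n * 'M[R]_(n, n * n)) : 
  Ad G2 (a, 0) X = (a *m X.1 *m invmx a,
    array (fun k => a *m array_eval X.2 (invmx a *m delta_mx k 0) *m invmx a)).
Proof.
pose F (h : 'M[R]_n * 'M[R]_(n, n * n)) := (a *m h.1 *m invmx a,
    array (fun k => a *m array_eval h.2 (invmx a *m delta_mx k 0) *m invmx a)).
have E : (fun h => gmul G2 (gmul G2 (a, 0) h) (ginv G2 (a, 0))) = F.
  apply/funext => h; rewrite ginv_G2 gmul_G2l gmul_G2r; congr (_, _); congr array.
  apply/funext => k; congr (_ *m _); rewrite /= array_eval_sum [in RHS]array_eval_sum.
  by rewrite mulmx_sumr; apply: eq_bigr => l _; rewrite array_eval_array scalemxAr.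
rewrite /Ad E; have [|_ H] := @isdiff_linear R _ _ _ F (gone G2); last exact: H.
move=> k u v; apply/pair_equal_spec; split.
  by rewrite /= linearP /= mulmxDl -scalemxAl.
apply: array_eval_inj => l; rewrite /=.
rewrite (array_eval_linearl (delta_mx l 0) k) !array_eval_array.
rewrite (array_eval_linearl (invmx a *m delta_mx l 0) k).
by rewrite mulmxDr mulmxDl -scalemxAr -scalemxAl.
Qed.

End AdjointActions.

(** * Symbols and connection forms *)

Ltac smooth_rec := repeat first
  [ assumption | exact: openT
  | apply: smooth_pair | apply: smooth_fst | apply: smooth_snd
  | apply: smoothD | apply: smoothN | apply: smooth_mulmx | apply: smooth_array_eval
  | apply: smooth_id | apply: smooth_cst ].

Section Symbols.
Context {R : realType} {n : nat} (M : manifold R n).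
Notation E := 'cV[R]_n.

Definition symbols := chart M -> E -> 'M[R]_(n, n * n).

(* The transformation rule of Christoffel symbols, the argument of [array_eval]
   being the direction of differentiation. *)
Definition connection_symbols (G : symbols) :=
  (forall c, smooth_on (loc c @` dom c) (G c)) /\
  forall c d (x : M) v, dom c x -> dom d x ->
    let y := loc c x in let J := jac (transition c d) y in
    array_eval (G d (loc d x)) (J *m v) *m J + 'd (jac (transition c d)) y v =
      J *m array_eval (G c y) v.

Definition tensor_symbols (m : symbols) :=
  (forall c, smooth_on (loc c @` dom c) (m c)) /\
  forall c d (x : M) v, dom c x -> dom d x ->
    let y := loc c x in let J := jac (transition c d) y in
    array_eval (m d (loc d x)) (J *m v) *m J = J *m array_eval (m c y) v.

End Symbols.

Section ConnectionForms.
Context {R : realType} {n : nat} {M : manifold R n}.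
Notation E := 'cV[R]_n.
Notation P1g := (P1g M).
Implicit Types (c d : chart M) (q : P1g) (G m : symbols M).

Lemma P1g_dom c q : dom c (tag q.1) -> dom (N := P1g) (c, tt) q.
Proof. by []. Qed.

Lemma P1g_loc c q : loc (N := P1g) (c, tt) q = ((loc c (tag q.1), fmat c q.1), q.2).
Proof. by []. Qed.

Lemma P1g_inj c q q' : dom c (tag q.1) -> dom c (tag q'.1) ->
  loc (N := P1g) (c, tt) q = loc (N := P1g) (c, tt) q' -> q = q'.
Proof. by move=> cq cq'; apply: (atlas_inj (N := P1g)). Qed.

Lemma P1g_ex c (x : M) a (t : 'M[R]_n) : dom c x -> a \in unitmx ->
  exists q : P1g, [/\ tag q.1 = x, fmat c q.1 = a & q.2 = t].
Proof. by move=> cx ua; have [u [ux ua']] := frame_ex cx ua; exists (u, t). Qed.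

Lemma P1g_act_fmat c q (g : 'M[R]_n * 'M[R]_n) : dom c (tag q.1) -> g.1 \in unitmx ->
  fmat c (P1g_act q g).1 = fmat c q.1 *m g.1.
Proof. exact: frame_act_fmat. Qed.

Lemma P1g_act2 q (g : 'M[R]_n * 'M[R]_n) :
  (P1g_act q g).2 = invmx g.1 *m q.2 *m g.1 + g.2.
Proof. by rewrite /= Ad_GL invmxK. Qed.

Lemma P1g_act_loc c q (g : 'M[R]_n * 'M[R]_n) : dom c (tag q.1) -> g.1 \in unitmx ->
  loc (N := P1g) (c, tt) (P1g_act q g) =
  ((loc c (tag q.1), fmat c q.1 *m g.1), invmx g.1 *m q.2 *m g.1 + g.2).
Proof. by move=> cq ug; rewrite P1g_loc P1g_act_fmat // P1g_act2. Qed.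

Lemma P1g_open c : open [set p : (E * 'M[R]_n) * 'M[R]_n | (loc c @` dom c) p.1.1].
Proof. exact: (open_prodl (A := [set p : E * 'M[R]_n | _ p.1]) (open_prodl (open_dom c))). Qed.

Lemma P1g_act_smooth (g : 'M[R]_n * 'M[R]_n) : g.1 \in unitmx ->
  smooth_map (N1 := P1g) (N2 := P1g) (@P1g_act R n M ^~ g).
Proof.
move=> ug; apply: smooth_map_crit => -[d []] q [dq _].
exists (d, tt), [set p | (loc (N := M) d @` dom (N := M) d) p.1.1],
  (fun p => ((p.1.1, p.1.2 *m g.1), invmx g.1 *m p.2 *m g.1 + g.2)).
split=> //; [exact: P1g_open| by exists (tag q.1)| |].
  have Oo := P1g_open (c := d); smooth_rec.
by move=> q' [dq' _] _; split=> //; rewrite P1g_act_loc.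
Qed.

Lemma dmap_P1g_act c q (T : tangent q) (g : 'M[R]_n * 'M[R]_n) :
  dom c (tag q.1) -> g.1 \in unitmx ->
  val (dmap (@P1g_act R n M ^~ g) T) (c, tt) =
    let w := val T (c, tt) in ((w.1.1, w.1.2 *m g.1), invmx g.1 *m w.2 *m g.1).
Proof.
move=> cq ug.
pose F (p : (E * 'M[R]_n) * 'M[R]_n) := ((p.1.1, p.1.2 *m g.1), invmx g.1 *m p.2 *m g.1 + g.2).
pose D (p : (E * 'M[R]_n) * 'M[R]_n) := ((p.1.1, p.1.2 *m g.1), invmx g.1 *m p.2 *m g.1).
apply: (dmap_formula (F := F) (D := D) T (P1g_act_smooth ug) (P1g_dom cq)) => //.
  by move=> q' [cq' _] _; rewrite P1g_act_loc.
set z := loc _ _.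
pose proof (isdiff_fst z) as d1; pose proof (isdiff_snd z) as d2.
pose proof (isdiff_comp d1 (isdiff_fst z.1)) as d11.
pose proof (isdiff_comp d1 (isdiff_snd z.1)) as d12.
have dc (b : 'M[R]_n) := isdiff_cst b z.
have D1 := isdiff_pair d11 (isdiff_mulmx d12 (dc g.1)).
have D2 := isdiffD (isdiff_mulmx (isdiff_mulmx (dc (invmx g.1)) d2) (dc g.1)) (dc g.2).
apply: isdiff_ext (isdiff_pair D1 D2) _ => w /=; rewrite /D.
by rewrite !mulmx0 mul0mx add0r !addr0.
Qed.

(** Differentiating Ad_{g^-1} q.2 at the unit produces the bracket in the last component; this is
    the fundamental vector field of [A] in a chart. *)
Lemma vdiff_P1g_act c q (A : 'M[R]_n * 'M[R]_n) : dom c (tag q.1) ->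
  val (vdiff (P1g_act q) (1%:M, 0) A) (c, tt) =
    ((0, fmat c q.1 *m A.1), q.2 *m A.1 - A.1 *m q.2 + A.2).
Proof.
move=> cq; set a := fmat c q.1.
pose F (g : 'M[R]_n * 'M[R]_n) := ((loc c (tag q.1), a *m g.1), invmx g.1 *m q.2 *m g.1 + g.2).
pose D (A : 'M[R]_n * 'M[R]_n) := ((0 : E, a *m A.1), q.2 *m A.1 - A.1 *m q.2 + A.2).
pose z := (1%:M : 'M[R]_n, 0 : 'M[R]_n).
have dF : isdiff F z D.
  pose proof (isdiff_fst z) as d1; pose proof (isdiff_snd z) as d2.
  pose proof (isdiff_invmx (x := z) (unitmx1 R n) d1) as di.
  have dc (b : 'M[R]_n) := isdiff_cst b z.
  have D1 := isdiff_pair (isdiff_cst (loc c (tag q.1)) z) (isdiff_mulmx (dc a) d1).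
  have D2 := isdiffD (isdiff_mulmx (isdiff_mulmx di (dc q.2)) d1) d2.
  apply: isdiff_ext (isdiff_pair D1 D2) _ => w /=; rewrite /D.
  rewrite !mulmx0 !mul0mx !add0r !addr0 invmx1 !mul1mx !mulmx1 mulNmx.
  by rewrite [- _ + _]addrC.
have uO : open [set h : 'M[R]_n * 'M[R]_n | h.1 \in unitmx] := open_prodl (@open_unitmx R n).
have fF : \forall g \near z, F g = loc (N := P1g) (c, tt) (P1g_act q g).
  apply: (open_near uO); first exact: unitmx1.
  by move=> g ug; rewrite P1g_act_loc.
have dL := isdiff_near fF dF.
pose proof (vdiffE (N2 := P1g) (f := P1g_act q) (x := z) (d0 := (c, tt)) (d := (c, tt))) as V.
rewrite (isdiff_uniq (V _ _ _) dL) //; last by case: dL.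
by apply: (open_near uO); [exact: unitmx1 | move=> h _; exact: (P1g_dom (q := P1g_act q h))].
Qed.

(* Reproduction and equivariance force this value at the point p = (y, a, tau)
   and the tangent vector w, once g(v) and m(v) are the values of the form on
   the vectors (v, 0, 0) at the point (y, 1, 0). *)
Definition local_form (g m : 'M[R]_(n, n * n)) (p w : (E * 'M[R]_n) * 'M[R]_n)
    : 'M[R]_n * 'M[R]_n :=
  let a := p.1.2 in
  let theta := invmx a *m (array_eval g w.1.1 *m a + w.1.2) in
  (theta, invmx a *m array_eval m w.1.1 *m a + w.2 - (p.2 *m theta - theta *m p.2)).

Definition form_symbols (omega : forall q : P1g, tangent q -> 'M[R]_n * 'M[R]_n) G m :=
  forall c q (T : tangent q), dom c (tag q.1) ->
    omega q T = local_form (G c (loc c (tag q.1))) (m c (loc c (tag q.1)))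
      (loc (N := P1g) (c, tt) q) (val T (c, tt)).

Lemma mulmx3_linear k l (a : 'M[R]_k) (b : 'M[R]_l) : linear (fun x => a *m x *m b).
Proof. by move=> t x y; rewrite mulmxDr mulmxDl -scalemxAr -scalemxAl. Qed.

Lemma local_form_linear (g m : 'M[R]_(n, n * n)) p : linear (local_form g m p).
Proof.
move=> k w w'; pose a := p.1.2.
pose f (w : (E * 'M[R]_n) * 'M[R]_n) := invmx a *m (array_eval g w.1.1 *m a + w.1.2).
have fl : linear f.
  move=> t x y; rewrite /f /= array_evalD array_evalZ mulmxDl -scalemxAl.
  by rewrite addrACA -scalerDr mulmxDr -scalemxAr.
have gl : linear (fun x => p.2 *m x - x *m p.2).
  move=> t x y; rewrite mulmxDl mulmxDr -scalemxAl -scalemxAr opprD addrACA.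
  by rewrite -scalerBr.
apply/pair_equal_spec; split; first exact: fl.
pose h (w : (E * 'M[R]_n) * 'M[R]_n) := p.2 *m f w - f w *m p.2.
have hl : h (k *: w + w') = k *: h w + h w' by rewrite /h fl gl.
rewrite -[LHS]/(invmx a *m array_eval m (k *: w.1.1 + w'.1.1) *m a
  + (k *: w.2 + w'.2) - h (k *: w + w')) hl array_evalD array_evalZ mulmx3_linear.
rewrite -[RHS]/(k *: (invmx a *m array_eval m w.1.1 *m a + w.2 - h w) +
  (invmx a *m array_eval m w'.1.1 *m a + w'.2 - h w')).
by move: (h w) (h w') => y y'; rewrite opprD !scalerDr scalerN [X in X + _]addrACA [LHS]addrACA.
Qed.

Lemma invmx_mulmx k (a h : 'M[R]_n) (X : 'M[R]_(n, k)) : a \in unitmx -> h \in unitmx ->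
  invmx (a *m h) *m X = invmx h *m (invmx a *m X).
Proof.
move=> ua uh; rewrite -{1}(mulKVmx ua X) -{1}(mulKVmx uh (invmx a *m X)).
by rewrite [a *m (h *m _)]mulmxA mulKmx // unitmx_mul ua.
Qed.

(** Passing from the frame a to a g.1 conjugates theta by g.1^-1. The shift of p.2 by g.2 adds the
    bracket of g.2 with the conjugated theta, which is the correction term of
    [Ad_ginv_semidirect_GL]. *)
Lemma local_form_act (s m : 'M[R]_(n, n * n)) (p w : (E * 'M[R]_n) * 'M[R]_n)
    (g : 'M[R]_n * 'M[R]_n) : p.1.2 \in unitmx -> g.1 \in unitmx ->
  local_form s m ((p.1.1, p.1.2 *m g.1), invmx g.1 *m p.2 *m g.1 + g.2)
    ((w.1.1, w.1.2 *m g.1), invmx g.1 *m w.2 *m g.1) =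
  Ad (semidirect GL) (ginv (semidirect GL) g) (local_form s m p w).
Proof.
move=> ua ug; rewrite Ad_ginv_semidirect_GL // /local_form; cbn [fst snd].
set a := p.1.2 in ua *; set b := array_eval _ _; set b' := array_eval _ _.
have -> : b *m (a *m g.1) + w.1.2 *m g.1 = (b *m a + w.1.2) *m g.1.
  by rewrite mulmxDl mulmxA.
rewrite invmx_mulmx // -mulmxA invmx_mulmx //; set th := invmx a *m (b *m a + w.1.2).
rewrite [invmx a *m (_ *m g.1)]mulmxA -/th [invmx g.1 *m (th *m g.1)]mulmxA.
congr (_, _).
set Y := invmx g.1 *m th *m g.1.
rewrite [in LHS]mulmxDl [in LHS]mulmxDr.
have e1 : invmx g.1 *m p.2 *m g.1 *m Y = invmx g.1 *m (p.2 *m th) *m g.1.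
  by rewrite /Y -!mulmxA mulKVmx.
have e2 : Y *m (invmx g.1 *m p.2 *m g.1) = invmx g.1 *m (th *m p.2) *m g.1.
  by rewrite /Y -!mulmxA mulKVmx.
rewrite e1 e2 !(mulmxDr, mulmxDl, mulmxN, mulNmx) !mulmxA.
have zz (x y z t u : 'M[R]_n) : x - (y + z - (t + u)) = x - (y - t) - (z - u).
  by rewrite -[RHS]addrA -[in RHS]opprD [in RHS]addrACA -opprD.
exact: zz.
Qed.

Lemma invmx_mulK (J a X : 'M[R]_n) : a \in unitmx -> J *m a \in unitmx ->
  invmx (J *m a) *m (J *m X) = invmx a *m X.
Proof.
move=> ua ub; rewrite -{1}(mulKVmx ua X) [J *m (a *m _)]mulmxA.
by rewrite mulKmx.
Qed.

(** The second derivative of the transition map, present in the frame component of the vector, is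
    absorbed by the inhomogeneous term of the Christoffel rule; the remaining factor J cancels
    against [invmx (J *m a)]. *)
Lemma local_form_transition G m c d q (T : tangent q) :
  connection_symbols G -> tensor_symbols m ->
  dom c (tag q.1) -> dom d (tag q.1) ->
  local_form (G d (loc d (tag q.1))) (m d (loc d (tag q.1)))
    (loc (N := P1g) (d, tt) q) (val T (d, tt)) =
  local_form (G c (loc c (tag q.1))) (m c (loc c (tag q.1)))
    (loc (N := P1g) (c, tt) q) (val T (c, tt)).
Proof.
move=> [_ HG] [_ Hm] cq dq; rewrite (P1g_tangent_val T cq dq).
set w := val T (c, tt); rewrite !P1g_loc /local_form; cbn [fst snd].
have := HG c d _ w.1.1 cq dq; have := Hm c d _ w.1.1 cq dq.
set y := loc c (tag q.1); set J := jac (transition c d) y => Hm' HG'.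
have ua := fmat_unit cq; have ub := fmat_unit dq.
rewrite (fmat_transition cq dq) -/y -/J in ub *; set a := fmat c q.1 in ua ub *.
set b := array_eval (G d _) _; set b' := array_eval (m d _) _.
have -> : b *m (J *m a) + ('d (jac (transition c d)) y w.1.1 *m a + J *m w.1.2) =
          J *m (array_eval (G c y) w.1.1 *m a + w.1.2).
  by rewrite mulmxDr [in RHS]mulmxA -HG' mulmxDl -addrA mulmxA.
have -> : invmx (J *m a) *m b' *m (J *m a) =
          invmx (J *m a) *m (J *m (array_eval (m c y) w.1.1 *m a)).
  by rewrite -mulmxA [b' *m _]mulmxA Hm' -mulmxA.
by rewrite !invmx_mulK // [in X in (_, X + _ - _)]mulmxA.
Qed.

Definition some_chart (x : M) : chart M := sval (cid (atlas_cover x)).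

Lemma some_chartP (x : M) : dom (some_chart x) x.
Proof. by rewrite /some_chart; case: cid. Qed.

(** The choice of chart is harmless by [local_form_transition]. *)
Definition form_of G m q (T : tangent q) : 'M[R]_n * 'M[R]_n :=
  let c := some_chart (tag q.1) in
  local_form (G c (loc c (tag q.1))) (m c (loc c (tag q.1)))
      (loc (N := P1g) (c, tt) q) (val T (c, tt)).

Lemma form_of_symbols G m : connection_symbols G -> tensor_symbols m ->
  form_symbols (form_of G m) G m.
Proof.
by move=> HG Hm c q T cq; apply: local_form_transition => //; exact: some_chartP.
Qed.

Lemma local_form_smooth G m c : connection_symbols G -> tensor_symbols m ->
  smooth_on [set p : (((E * 'M[R]_n) * 'M[R]_n) * ((E * 'M[R]_n) * 'M[R]_n)) |
    (loc c @` dom c) p.1.1.1 /\ p.1.1.2 \in unitmx]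
    (fun p => local_form (G c p.1.1.1) (m c p.1.1.1) p.1 p.2).
Proof.
move=> [HG _] [Hm _]; set O := [set p | _].
have Oo : open O.
  exact: open_prodl (open_prodl (open_prod (open_dom c) (@open_unitmx R n))).
have s1 : smooth_on O (fun p => p.1.1.1) by smooth_rec.
have s2 : smooth_on O (fun p => p.1.1.2) by smooth_rec.
have si : smooth_on O (fun p => invmx p.1.1.2).
  by apply: (smooth_comp (f := @invmx R n) _ _ (@smooth_invmx R n)) => // p [].
have sG : smooth_on O (fun p => G c p.1.1.1).
  by apply: (smooth_comp (f := G c) _ _ (HG c)) => // p [].
have sm : smooth_on O (fun p => m c p.1.1.1).
  by apply: (smooth_comp (f := m c) _ _ (Hm c)) => // p [].
by rewrite /local_form; smooth_rec.
Qed.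

Lemma form_symbols_smooth omega G m : connection_symbols G -> tensor_symbols m ->
  form_symbols omega G m ->
  smooth_map (N1 := tangent_bundle P1g) (N2 := vec ('M[R]_n * 'M[R]_n)%type)
    (fun X => omega (tag X) (tagged X)).
Proof.
move=> HG Hm H; apply: smooth_map_crit => -[] [q T] _.
pose c := some_chart (tag q.1).
pose O := [set p : (((E * 'M[R]_n) * 'M[R]_n) * ((E * 'M[R]_n) * 'M[R]_n)) |
    (loc c @` dom c) p.1.1.1 /\ p.1.1.2 \in unitmx].
have cq := @some_chartP (tag q.1).
exists (c, tt), O, (fun p => local_form (G c p.1.1.1) (m c p.1.1.1) p.1 p.2); split.
- exact: (P1g_dom cq).
- exact: open_prodl (open_prodl (open_prod (open_dom c) (@open_unitmx R n))).
- by split; [exists (tag q.1) | exact: fmat_unit].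
- exact: local_form_smooth.
- by move=> [q' T'] [/= cq' _] _; split=> //; exact: H.
Qed.

Lemma form_symbols_connection omega G m : connection_symbols G -> tensor_symbols m ->
  form_symbols omega G m -> is_connection_form (semidirect GL) (@P1g_act R n M) omega.
Proof.
move=> HG Hm H; split.
- move=> q k T T'; have cq := @some_chartP (tag q.1); rewrite !(H _ _ _ cq).
  by rewrite val_tangentD val_tangentZ local_form_linear.
- exact: form_symbols_smooth H.
- move=> q A; have cq := @some_chartP (tag q.1); set c := some_chart _ in cq.
  rewrite (H c) // vdiff_P1g_act // P1g_act_loc ?unitmx1 // /local_form /=.
  have ua := fmat_unit cq; set a := fmat c q.1 in ua *.
  rewrite !array_eval0 invmx1 !mulmx1 !mul1mx mul0mx add0r addr0 mulKmx //.
  by rewrite mulmx0 mul0mx add0r addrC addrA addNr add0r -surjective_pairing.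
- move=> q g T; rewrite -[gdom _ g]/(is_true (g.1 \in unitmx)) => ug; have cq := @some_chartP (tag q.1); set c := some_chart _ in cq.
  have := H c (P1g_act q g) (dmap (@P1g_act R n M ^~ g) T) cq.
  rewrite (dmap_P1g_act T cq ug) (P1g_act_loc cq ug) => ->.
  rewrite (H c q T cq) -local_form_act ?P1g_loc //; exact: fmat_unit.
Qed.

Lemma form_exists G m : connection_symbols G -> tensor_symbols m ->
  exists omega : P1g_connection M, form_symbols (sval omega) G m.
Proof.
move=> HG Hm; have H := form_of_symbols HG Hm.
by exists (exist _ _ (form_symbols_connection HG Hm H)).
Qed.

End ConnectionForms.

Lemma pair_ext (A B : Type) (p q : A * B) : p.1 = q.1 -> p.2 = q.2 -> p = q.
Proof. by case: p q => [a b] [a' b'] /= -> ->. Qed.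

(** * Symbols of a given connection form *)

Section SymbolsOfForms.
Context {R : realType} {n : nat} {M : manifold R n}.
Notation E := 'cV[R]_n.
Notation P1g := (P1g M).
Implicit Types (c d : chart M) (q : P1g) (G m : symbols M).

Lemma linear_lincomb (U V : lmodType R) (f : U -> V) (I : Type) (r : seq I)
    (a : I -> R) (x : I -> U) : linear f ->
  f (\sum_(i <- r) a i *: x i) = \sum_(i <- r) a i *: f (x i).
Proof.
move=> lf; pose L : {linear U -> V} := HB.pack f (GRing.isLinear.Build _ _ _ _ f lf).
rewrite -[LHS]/(L _) linear_sum.
by apply: eq_bigr => i _; rewrite linearZ.
Qed.

(** [omega] is one object read in two charts: evaluate it on the vector (v, 0, 0) at the coordinate
    frame of [c]. In [d] this frame has matrix J, and the vector acquires the second derivative of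
    the transition map. *)
Lemma form_symbols_rules (omega : forall q : P1g, tangent q -> 'M[R]_n * 'M[R]_n) G m :
  form_symbols omega G m -> forall c d (x : M) v, dom c x -> dom d x ->
    let y := loc c x in let J := jac (transition c d) y in
    array_eval (G d (loc d x)) (J *m v) *m J + 'd (jac (transition c d)) y v =
      J *m array_eval (G c y) v /\
    array_eval (m d (loc d x)) (J *m v) *m J = J *m array_eval (m c y) v.
Proof.
move=> H c d x v cx dx; cbv zeta.
have [q [qx fq tq]] := P1g_ex 0 cx (unitmx1 R n); subst x.
pose T := tvec (N := P1g) (c, tt) q ((v, 0), 0).
have cq : dom (N := P1g) (c, tt) q by [].
have TE : val T (c, tt) = ((v, 0), 0) by exact: tvecK.
have Hc := H c q T cx; have Hd := H d q T dx.
have ub := fmat_unit dx; move: Hd; rewrite Hc (P1g_tangent_val T cx dx) TE !P1g_loc.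
move: ub; rewrite (fmat_transition cx dx) fq tq mulmx1.
set y := loc c (tag q.1); set J := jac (transition c d) y => uJ.
rewrite /local_form; cbn [fst snd].
rewrite ?mulmx1 ?mulmx0 ?mul0mx ?addr0 ?subr0 ?invmx1 ?mul1mx ?subr0 ?addr0.
move=> [-> e2]; split; first by rewrite mulKVmx.
by rewrite e2 -mulmxA mulKVmx.
Qed.

Section Symbols.
Variable omega : P1g_connection M.

Let rep c := local_rep (N1 := tangent_bundle P1g) (N2 := vec ('M[R]_n * 'M[R]_n)%type)
  (fun X => sval omega (tag X) (tagged X)) (c, tt) tt.

(** The base vector e_k at the coordinate frame (y, 1, 0): its vertical components are 0, whence the
    name. *)
Let vertical0 (y : E) (k : 'I_n) : ((E * 'M[R]_n) * 'M[R]_n) * ((E * 'M[R]_n) * 'M[R]_n) :=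
  (((y, 1%:M), 0), ((delta_mx k 0, 0), 0)).

Let G c y := array (fun k => (rep c (vertical0 y k)).1).
Let m c y := array (fun k => (rep c (vertical0 y k)).2).

Let repE c q (T : tangent q) : dom c (tag q.1) ->
  rep c (loc (N := P1g) (c, tt) q, val T (c, tt)) = sval omega q T.
Proof.
by move=> cq; apply: (local_repE (N1 := tangent_bundle P1g) (x := existT _ q T)).
Qed.

Let omega_linear q : linear (sval omega q).
Proof. by case: (svalP omega). Qed.

Let omega_horizontal c q v : dom c (tag q.1) ->
  loc (N := P1g) (c, tt) q = ((loc c (tag q.1), 1%:M), 0) ->
  sval omega q (tvec (N := P1g) (c, tt) q ((v, 0), 0)) =
  (array_eval (G c (loc c (tag q.1))) v, array_eval (m c (loc c (tag q.1))) v).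
Proof.
move=> cq qE; have cq' : dom (N := P1g) (c, tt) q by [].
have -> : tvec (N := P1g) (c, tt) q ((v, 0), 0) = \sum_k v k 0 *:
    tvec (N := P1g) (c, tt) q ((delta_mx k 0, 0), 0).
  apply: (tangent_inj cq'); rewrite tvecK // val_tangent_sum.
  under eq_bigr do rewrite val_tangentZ tvecK //.
  apply: pair_ext; last by rewrite snd_sum big1 //= => k _; rewrite scaler0.
  apply: pair_ext.
    by rewrite fst_sum fst_sum /= {1}(cV_sum_delta v).
  by rewrite fst_sum snd_sum big1 //= => k _; rewrite scaler0.
rewrite (linear_lincomb _ _ _ (@omega_linear q)) array_eval_sum [in RHS]array_eval_sum.
have sE k : sval omega q (tvec (N := P1g) (c, tt) q ((delta_mx k 0, 0), 0)) =
    rep c (vertical0 (loc c (tag q.1)) k).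
  by rewrite -(repE _ cq) qE tvecK.
apply: pair_ext; rewrite ?fst_sum ?snd_sum; apply: eq_bigr => k _.
  by rewrite array_eval_array /= sE.
by rewrite array_eval_array /= sE.
Qed.

Let P1g_act1 q : P1g_act q (1%:M, 0) = q.
Proof.
have cq := some_chartP (tag q.1); apply: (P1g_inj (c := some_chart (tag q.1))) => //.
by rewrite P1g_act_loc ?unitmx1 // P1g_loc !mulmx1 addr0 invmx1 mul1mx.
Qed.

(** At a coordinate frame a tangent vector is the sum of a base vector (v, 0, 0) and a fundamental
    vector; linearity and the reproduction property give the value. *)
Let omega_unit_frame c q (T : tangent q) : dom c (tag q.1) ->
  loc (N := P1g) (c, tt) q = ((loc c (tag q.1), 1%:M), 0) ->
  sval omega q T = local_form (G c (loc c (tag q.1))) (m c (loc c (tag q.1)))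
      (loc (N := P1g) (c, tt) q) (val T (c, tt)).
Proof.
move=> cq qE.
(* [vdiff] lands in the tangent space at [P1g_act q (1%:M, 0)], which is only provably equal to [q],
   so the claim is moved to that point. *)
suff H (T' : tangent (P1g_act q (1%:M, 0))) : sval omega _ T' =
   local_form (G c (loc c (tag q.1))) (m c (loc c (tag q.1)))
      (loc (N := P1g) (c, tt) q) (val T' (c, tt)).
  by move: H; rewrite P1g_act1; apply.
set q' := P1g_act q _ in T' *.
have cq' : dom (N := P1g) (c, tt) q' by [].
have qE' : loc (N := P1g) (c, tt) q' = ((loc c (tag q.1), 1%:M), 0).
  by rewrite /q' P1g_act1.
set w := val T' (c, tt).
have -> : T' = tvec (N := P1g) (c, tt) q' ((w.1.1, 0), 0) +
   vdiff (P1g_act q) (1%:M, 0) (w.1.2, w.2).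
  apply: (tangent_inj cq'); rewrite val_tangentD tvecK // vdiff_P1g_act //.
  move: qE; rewrite P1g_loc => -[-> ->].
  rewrite mul1mx mul0mx mulmx0 subr0 add0r -/w.
  by case: w => [[v A] B]; rewrite /= -[RHS]/((v + 0, 0 + A), 0 + B) addr0 !add0r.
have -> (X Y : tangent q') : sval omega q' (X + Y) = sval omega q' X + sval omega q' Y.
  by have := omega_linear 1 X Y; rewrite !scale1r.
rewrite omega_horizontal //.
have [_ _ rep1 _] := svalP omega; rewrite rep1.
rewrite qE /local_form; cbn [fst snd].
by rewrite invmx1 !mul1mx !mulmx1 mul0mx mulmx0 !subr0.
Qed.

Lemma symbols_smooth c :
  smooth_on (loc c @` dom c) (G c) /\ smooth_on (loc c @` dom c) (m c).
Proof.
pose proof (open_dom (N := M) c) as Oo.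
have [_ sm _ _] := svalP omega; have [_ srep] := sm (c, tt) tt.
have sW k : smooth_on (loc c @` dom c) (fun y => rep c (vertical0 y k)).
  apply: (smooth_comp (f := rep c) _ _ srep) => //; last by rewrite /vertical0; smooth_rec.
  move=> _ [x cx <-]; have [q [qx fq tq]] := P1g_ex 0 cx (unitmx1 R n); subst x.
  exists (existT _ q (tvec (N := P1g) (c, tt) q ((delta_mx k 0, 0), 0))) => //.
  by rewrite /vertical0 -tq -fq; apply: pair_ext; [by []|exact: (tvecK (N := P1g))].
by split; apply: smooth_array => // k; [apply: smooth_fst|apply: smooth_snd].
Qed.

(** Every point over the chart is the translate of a coordinate frame (y, 1, 0) by g = (a, q.2), and
    equivariance of [omega] carries the value from there. *)
Lemma omega_symbols : form_symbols (sval omega) G m.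
Proof.
move=> c q T cq; have ua := fmat_unit cq.
have [q0 [q0x f0 t0]] := P1g_ex 0 cq (unitmx1 R n).
have cq0 : dom c (tag q0.1) by rewrite q0x.
pose a := fmat c q.1; pose g : 'M[R]_n * 'M[R]_n := (a, q.2).
have ug : g.1 \in unitmx := ua.
have qE : P1g_act q0 g = q.
  apply: (P1g_inj (c := c)) => //; rewrite P1g_act_loc //.
  by rewrite P1g_loc q0x f0 t0 mul1mx mulmx0 mul0mx add0r.
suff H (T' : tangent (P1g_act q0 g)) : sval omega _ T' =
   local_form (G c (loc c (tag q.1))) (m c (loc c (tag q.1)))
      (loc (N := P1g) (c, tt) q) (val T' (c, tt)).
  by move: H; rewrite qE; apply.
have cq' : dom (N := P1g) (c, tt) (P1g_act q0 g) by [].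
set w : (E * 'M[R]_n) * 'M[R]_n := val T' (c, tt).
(* The preimage of [T'] under the differential of the right translation by [g]. *)
have -> : T' = dmap (@P1g_act R n M ^~ g)
    (tvec (N := P1g) (c, tt) q0 ((w.1.1, w.1.2 *m invmx a), a *m w.2 *m invmx a)).
  apply: (tangent_inj cq'); rewrite -[LHS]/w; symmetry.
  apply: (etrans (dmap_P1g_act _ cq0 ug)); cbv zeta; rewrite tvecK //; cbn [fst snd].
  by rewrite mulmxKV // !mulmxA mulVmx // mul1mx mulmxKV //; case: w => [[]].
have [_ _ _ eqv] := svalP omega; apply: (etrans (eqv q0 g _ ug)).
have e0 : loc (N := P1g) (c, tt) q0 = ((loc c (tag q0.1), 1%:M), 0).
  by rewrite P1g_loc f0 t0.
rewrite (omega_unit_frame (c := c) _ cq0 e0) tvecK //.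
rewrite -local_form_act ?e0 ?unitmx1 //; cbn [fst snd].
rewrite q0x P1g_loc mul1mx mulmx0 mul0mx add0r -[g.1]/a -[g.2]/(q.2) -/a.
congr (local_form _ _ _ _).
by rewrite mulmxKV // !mulmxA mulVmx // mul1mx mulmxKV //; case: w => [[]].
Qed.

End Symbols.
Lemma symbols_exist (omega : P1g_connection M) : exists G m,
  [/\ connection_symbols G, tensor_symbols m & form_symbols (sval omega) G m].
Proof.
have H := omega_symbols omega; have r := form_symbols_rules H.
set G := (X in form_symbols _ X _) in H r *; set m := (X in form_symbols _ _ X) in H r *.
exists G, m; split=> //; split.
- by move=> c; case: (symbols_smooth omega c).
- by move=> c d x v cx dx; case: (r c d x v cx dx).
- by move=> c; case: (symbols_smooth omega c).
- by move=> c d x v cx dx; case: (r c d x v cx dx).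
Qed.

End SymbolsOfForms.

(** * Formal frames and equivariant sections *)

(** Smoothness in one chart is carried to every other chart by the transition maps, on the open part
    of [O] that is sent into it. *)
Lemma smooth_germ_chart {R : realType} {V E : normedModType R} {fE : fin_dim E}
    {fV : fin_dim V} (N : charted E) {aN : atlas N} (f : V -> N) (P : V -> E)
    (O : set V) (c : chart N) v : open O -> O v -> smooth_on O P ->
  (forall z, O z -> dom c (f z) /\ loc c (f z) = P z) -> smooth_germ f v.
Proof.
move=> Oo Ov sP fP; exists O; split=> // d; cbv zeta.
have OE : O `&` f @^-1` dom d = O `&` P @^-1` (loc c @` (dom c `&` dom d)).
  apply/seteqP; split=> z [Oz] /=; have [cz <-] := fP z Oz.
    by move=> dz; split=> //; exists (f z).
  by move=> Pz; split=> //; exact: overlap_loc Pz.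
have Uo : open (O `&` f @^-1` dom d).
  rewrite OE; apply: open_preim => //; last exact: open_overlap.
  by move=> z Oz; exact: smooth_continuous sP Oz.
split=> //; apply: (smooth_ext (f := fun z => transition c d (P z))) => //.
  by move=> z [Oz dz]; have [cz <-] := fP z Oz; rewrite transitionE.
apply: (smooth_comp (f := transition c d) _ _ (transition_smooth c d)) => //.
  by move=> z; rewrite OE => -[].
by apply: smooth_sub sP => z [].
Qed.

Lemma smooth_germ_vdiff {R : realType} {V E : normedModType R} {fE : fin_dim E}
    {fV : fin_dim V} (N : charted E) {aN : atlas N} (f : V -> N) v c :
  smooth_germ f v -> dom c (f v) ->
  (\forall z \near v, dom c (f z)) /\
  isdiff (fun z => loc c (f z)) v (fun w => val (vdiff f v w) c).
Proof.
move=> [U [Uo Uv /(_ c)[Uco sU]]] cv.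
have nc : \forall z \near v, dom c (f z).
  by apply: (open_near Uco) => // z [].
split=> //; apply: (vdiffE nc) => //.
by have [] := smooth_isdiff sU (conj Uv cv).
Qed.

Section FormalFrames.
Context {R : realType} {n : nat} {M : manifold R n}.
Notation E := 'cV[R]_n.
Notation P1 := (frame_bundle M).
Notation P2 := (formal_frame_bundle M).
Implicit Types (c d : chart M).

Lemma fmat_delta c (u : P1) k : fmat c u *m delta_mx k 0 = val (fvec u k) c.
Proof.
apply/matrixP => i j; rewrite ord1 mxE (bigD1 k) //= big1 ?addr0 => [|l /negbTE lk].
  by rewrite !mxE !eqxx mulr1.
by rewrite [in X in _ * X]mxE lk mulr0.
Qed.

(* The condition [F_o = Df(o)], read on 1-jets. *)
Definition semiholonomic (j : jet1_pt M) :=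
  forall c k, dom c (tag (tag j)) ->
    (val (tagged j k) c).1 = fmat c (tag j) *m delta_mx k 0.

(** The base component of the differential of F is the differential of the base map f, which is F_o
    by definition of a formal frame. *)
Lemma formal_frame_semiholonomic (F : E -> P1) :
  is_formal_frame F -> semiholonomic (jet1 F).
Proof.
move=> [sF _ DF] c k cF; rewrite fmat_delta.
have [nc dF] := smooth_germ_vdiff sF cF.
pose proof (isdiff_comp dF (isdiff_fst _)) as df.
pose f x : M := tag (F x).
pose proof (vdiffE (N2 := M) (f := f) (d0 := c) (d := c) nc (proj1 df) cF) as dv.
by rewrite /= DF; have := isdiff_uniq df dv (delta_mx k 0).
Qed.

Lemma jet1_pt_ext c (j j' : jet1_pt M) : tag j = tag j' -> dom c (tag (tag j)) ->
  (forall k, val (tagged j k) c = val (tagged j' k) c) -> j = j'.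
Proof.
case: j j' => [u w] [u' w'] /= uu; subst u' => cu H.
congr existT; apply/funext => k; exact: (tangent_inj (N := P1) cu (H k)).
Qed.

Section Existence.
Variables (j : jet1_pt M) (c : chart M).
Hypotheses (cj : dom c (tag (tag j)))
  (jE : forall k, (val (tagged j k) c).1 = fmat c (tag j) *m delta_mx k 0).

Let u := tag j.
Let y := loc c (tag u).
Let a := fmat c u.
Let b := array (fun k => (val (tagged j k) c).2).
(** The affine germ with the prescribed value and first derivatives in the chart [c]; it represents
    frames over the chart only on [O]. *)
Let P (v : E) : E * 'M[R]_n := (y + a *m v, a + array_eval b v).
Let F (v : E) : P1 :=
  xget u [set u | dom (N := P1) c u /\ loc (N := P1) c u = P v].
Let O := [set v | (loc c @` dom c) (P v).1 /\ (P v).2 \in unitmx].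

Let P_smooth (U : set E) : open U -> smooth_on U P.
Proof. by move=> Uo; rewrite /P; smooth_rec. Qed.

Let P_isdiff : isdiff P 0 (fun v => (a *m v, array_eval b v)).
Proof.
have l1 : linear (fun v : E => a *m v) by move=> t v w; rewrite linearP.
apply: isdiff_ext (isdiff_pair (isdiffD (isdiff_cst y _) (isdiff_linear 0 l1))
  (isdiffD (isdiff_cst a _) (isdiff_linear _ (array_eval_linearr b)))) _ => v.
by rewrite !add0r.
Qed.

Let O_open : open O.
Proof.
have -> : O = setT `&` P @^-1` [set p | (loc c @` dom c) p.1 /\ p.2 \in unitmx].
  by apply/seteqP; split=> v; [split|case].
apply: open_preim; first exact: openT.
  by move=> v _; apply: (smooth_continuous (O := setT)) => //; exact: P_smooth openT.
exact: open_prod (open_dom c) (@open_unitmx R n).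
Qed.

Let P0 : P 0 = (y, a).
Proof. by rewrite /P mulmx0 array_eval0 !addr0. Qed.

Let O0 : O 0.
Proof. by rewrite /O /= mulmx0 array_eval0 !addr0; split; [exists (tag u) | exact: fmat_unit]. Qed.

Let FP v : O v -> dom c (tag (F v)) /\ loc (N := P1) c (F v) = P v.
Proof.
move=> [[x cx xE] uP]; rewrite /F; case: xgetP => [u' _ //|H].
have [u' [u'x u'a]] := frame_ex cx uP; subst x.
exfalso; apply: (H u'); split=> //; rewrite /= -/(fmat c u') u'a.
by apply: pair_ext.
Qed.

Let F0 : F 0 = u.
Proof.
have [c0 FE] := FP O0; apply: (atlas_inj (N := P1) (c := c)) => //.
by rewrite FE P0.
Qed.

Let F_base v : O v -> loc c (tag (F v)) = y + a *m v.
Proof. by move=> /FP[_] /(congr1 fst). Qed.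

Let ua : a \in unitmx. Proof. exact: fmat_unit. Qed.

Let F_local_diffeo d : dom d (tag (F 0)) ->
  local_diffeo (fun v => loc d (tag (F v))) 0.
Proof.
move=> d0; have [c0 _] := FP O0.
pose h (v : E) := y + a *m v.
have sh (U : set E) : open U -> smooth_on U h by move=> Uo; rewrite /h; smooth_rec.
pose g (z : E) := invmx a *m (transition d c z + - y).
have sg : smooth_on (loc d @` (dom d `&` dom c)) g.
  pose proof (open_overlap (N := M) d c) as Vo.
  by pose proof (transition_smooth (N := M) d c) as st; rewrite /g; smooth_rec.
pose U := O `&` h @^-1` (loc c @` (dom c `&` dom d)).
have Uo : open U.
  apply: open_preim => //; last exact: open_overlap.
  by move=> v Ov; exact: smooth_continuous (sh _ O_open) Ov.
have UP v : U v -> [/\ O v, dom c (tag (F v)), dom d (tag (F v)) & loc c (tag (F v)) = h v].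
  move=> [Ov Pv]; have [cv _] := FP Ov; have E1 := F_base Ov; split=> //.
  by apply: (overlap_loc (N := M) cv); rewrite E1.
have gf v : U v -> g (loc d (tag (F v))) = v.
  by move=> /UP[Ov cv dv E1]; rewrite /g transitionE // E1 /h addrAC subrr add0r mulKmx.
have UE : [set loc d (tag (F v)) | v in U] = loc d @` (dom d `&` dom c) `&` g @^-1` U.
  apply/seteqP; split=> [_ [v Uv <-]|_ [[x [dx cx] <-] Ug]].
    have [Ov cv dv _] := UP v Uv.
    by split; [exists (tag (F v)) | rewrite /= gf].
  have := UP _ Ug; set v := g _ in Ug *; move=> [Ov cv dv E1]; exists v => //.
  congr loc; apply: (atlas_inj (N := M) (c := c)) => //.
  by rewrite E1 /h /v /g mulKVmx // transitionE // addrC subrK.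
exists U, g; split; split=> //.
- by split=> //; rewrite /= /h mulmx0 addr0; exists (tag u) => //; split=> //; rewrite -F0.
- rewrite UE; apply: open_preim Uo; first exact: open_overlap.
  by move=> z Uz; exact: (smooth_continuous sg Uz).
- apply: (smooth_ext (f := fun v => transition c d (h v))) => //.
    by move=> v /UP[_ cv dv <-]; rewrite transitionE.
  apply: (smooth_comp (f := transition c d) _ _ (transition_smooth (N := M) c d)) => //.
    by move=> v [].
  exact: sh.
- by rewrite UE; apply: smooth_sub sg => z [].
Qed.

(** Converse of [formal_frame_semiholonomic], by an affine germ. Together they describe the points
    of the formal frame bundle as the 1-jets whose base part is the frame itself, a condition that
    can be checked in one chart. *)
Lemma formal_frame_exists : exists F, is_formal_frame F /\ j = jet1 F.
Proof.
have [c0 _] := FP O0.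
have sF : smooth_germ F 0 by exact: smooth_germ_chart (P_smooth O_open) FP.
have [nc dF] := smooth_germ_vdiff (N := P1) sF c0.
have dF' : isdiff (fun v => loc (N := P1) c (F v)) 0 (fun v => (a *m v, array_eval b v)).
  apply: isdiff_near P_isdiff; apply: (open_near O_open O0) => v /FP[_ ->] //.
have vF := isdiff_uniq dF dF'.
pose proof (isdiff_comp dF' (isdiff_fst _)) as df.
pose f x : M := tag (F x).
pose proof (vdiffE (N2 := M) (f := f) (d0 := c) (d := c) nc (proj1 df) c0) as dv.
have vf := isdiff_uniq dv df.
exists F; split.
  split=> // k; apply: (tangent_inj (N := M) c0).
  by apply: (etrans _ (esym (vf (delta_mx k 0)))); rewrite -fmat_delta F0.
apply: (jet1_pt_ext (c := c)) => //= k.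
by rewrite vF; apply: pair_ext; rewrite /= ?jE // array_eval_array.
Qed.

End Existence.

End FormalFrames.

Section FormalFrameBundle.
Context {R : realType} {n : nat} {M : manifold R n}.
Notation E := 'cV[R]_n.
Notation P1 := (frame_bundle M).
Notation P2 := (formal_frame_bundle M).
Implicit Types (c d : chart M) (j : P2).

Definition jet_array c j : 'M[R]_(n, n * n) :=
  array (fun k => (val (tagged (val j) k) c).2).

Lemma P2_semiholonomic j : semiholonomic (val j).
Proof.
have [F [fF ->]] := formal_frame_ex j; exact: formal_frame_semiholonomic.
Qed.

(** By semiholonomy the base part of the jet is the frame, so the frame and the array are
    coordinates on the formal frame bundle. *)
Lemma jet_val c j k : dom c (tag (pi21 j)) ->
  val (tagged (val j) k) c =
    (fmat c (pi21 j) *m delta_mx k 0, array_eval (jet_array c j) (delta_mx k 0)).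
Proof.
move=> cj; apply: pair_ext; first exact: P2_semiholonomic.
by rewrite /= array_eval_array.
Qed.

Lemma linear_delta_eq (W : lmodType R) (f g : E -> W) : linear f -> linear g ->
  (forall k, f (delta_mx k 0) = g (delta_mx k 0)) -> f =1 g.
Proof.
move=> lf lg fg v; rewrite (cV_sum_delta v) !linear_lincomb //.
by apply: eq_bigr => k _; rewrite fg.
Qed.

Lemma P2_inj c j j' : dom c (tag (pi21 j)) -> pi21 j = pi21 j' ->
  jet_array c j = jet_array c j' -> j = j'.
Proof.
move=> cj jj' e; apply/val_inj; apply: (jet1_pt_ext (c := c)) => // k.
by rewrite !jet_val // -?jj' // e.
Qed.

Lemma P2_ex c (u : P1) b : dom c (tag u) ->
  exists j : P2, pi21 j = u /\ jet_array c j = b.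
Proof.
move=> cu; pose w k := tvec (N := P1) c u (fmat c u *m delta_mx k 0, array_eval b (delta_mx k 0)).
have wE k : val (w k) c = (fmat c u *m delta_mx k 0, array_eval b (delta_mx k 0)).
  exact: tvecK.
have jP : `[< exists F, is_formal_frame F /\ existT _ u w = jet1 F >].
  apply/asboolP; apply: (formal_frame_exists (c := c)) => // k.
  by rewrite [X in X.1]wE.
exists (exist _ (existT _ u w) jP); split=> //.
apply: array_eval_inj => k; rewrite array_eval_array.
by rewrite [X in X.2]wE.
Qed.

(** The action is defined through a chosen representative. By the chain rule the resulting jet
    involves only the value and the differential of the representative at 0, which the jet [j]
    determines. *)
Lemma formal_frame_act_loc c j a : dom c (tag (pi21 j)) -> a \in unitmx ->
  pi21 (formal_frame_act j (a, 0)) = frame_act (pi21 j) a /\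
  jet_array c (formal_frame_act j (a, 0)) =
    array (fun k => array_eval (jet_array c j) (a *m delta_mx k 0) *m a).
Proof.
move=> cj ua.
pose F := representative j; have [fF jF] : is_formal_frame F /\ val j = jet1 F.
  by rewrite /F /representative; case: cid.
have [sF _ _] := fF.
have F0 : F 0 = pi21 j by rewrite /pi21 jF.
have c0 : dom c (tag (F 0)) by rewrite F0.
have [nc dF] := smooth_germ_vdiff (N := P1) sF c0.
pose H (x : E) := frame_act (F (a *m x)) a.
have HE : (fun x => frame_act (F ((a, 0 : 'M[R]_(n, n * n)).1 *m x)) (germ2 (a, 0) x)) = H.
  apply/funext => x; congr frame_act; rewrite /germ2 /=.
  apply/matrixP => i k; rewrite !mxE big1 ?addr0 // => l _.
  by rewrite mxE mul0r.
have H0 : H 0 = frame_act (pi21 j) a by rewrite /H mulmx0 F0.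
have la : linear (fun v : E => a *m v) by move=> t v w; rewrite linearP.
pose proof (isdiff_linear (0 : E) la) as da.
have cont := differentiable_continuous (proj1 da).
have ncH : \forall x \near (0 : E), dom c (tag (H x)).
  by move: cont; rewrite /prop_for /continuous_at mulmx0 => /(_ _ nc).
pose L (p : E * 'M[R]_n) := (p.1, p.2 *m a).
pose proof (isdiff_fst (loc (N := P1) c (F 0))) as d1.
pose proof (isdiff_mulmx (isdiff_snd (loc (N := P1) c (F 0)))
  (isdiff_cst a (loc (N := P1) c (F 0)))) as d2.
have dL := isdiff_pair d1 d2.
have dFa := isdiff_comp_eq da (mulmx0 _ a) (isdiff_comp dF dL).
have dH : isdiff (fun x => loc (N := P1) c (H x)) 0
    (fun v => let w := val (vdiff F 0 (a *m v)) c in (w.1, w.2 *m a)).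
  apply: (isdiff_near _ (isdiff_ext dFa _)) => [|v /=]; last first.
    by rewrite mulmx0 addr0.
  apply: filterS ncH => x cx; rewrite /H /=.
  rewrite -/(fmat c (frame_act (F (a *m x)) a)) frame_act_fmat //.
pose proof (vdiffE (N2 := P1) (f := H) (d := c) ncH (proj1 dH) (nbhs_singleton ncH)) as vH.
have jk k : val (tagged (val j) k) c = val (vdiff F 0 (delta_mx k 0)) c by rewrite jF.
have vF v : val (vdiff F 0 v) c = (fmat c (pi21 j) *m v, array_eval (jet_array c j) v).
  have [_ dFE] := dF; rewrite -dFE; move: v; apply: linear_delta_eq.
  - exact: linearP.
  - move=> t v w; apply: pair_ext; first by rewrite /= linearP.
    exact: array_eval_linearr.
  - by move=> k; rewrite dFE -jk jet_val.
have vH' k : val (vdiff H 0 (delta_mx k 0)) c = (fmat c (pi21 j) *m (a *m delta_mx k 0),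
    array_eval (jet_array c j) (a *m delta_mx k 0) *m a).
  by rewrite (isdiff_uniq vH dH) vF.
(* The germ [H] itself is not shown to be a formal frame: its jet is semiholonomic, which yields
   some formal frame with the same jet and keeps [insubd] from returning [j]. *)
have jP : `[< exists F, is_formal_frame F /\ jet1 H = jet1 F >].
  apply/asboolP; apply: (formal_frame_exists (c := c)) => [|k].
    by rewrite -[tag (jet1 H)]/(H 0) H0.
  by rewrite [X in X.1]vH' -[tag (jet1 H)]/(H 0) H0 frame_act_fmat // -mulmxA.
have actE : val (formal_frame_act j (a, 0)) = jet1 H.
  rewrite -HE in jP *; exact: (insubdK j jP).
split; first by rewrite /pi21 actE -H0.
by congr array; apply/funext => k; rewrite actE [X in X.2]vH'.
Qed.

End FormalFrameBundle.

(** * Equivariant sections and their symbols *)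

Section Sections.
Context {R : realType} {n : nat} {M : manifold R n}.
Notation E := 'cV[R]_n.
Notation P1 := (frame_bundle M).
Notation P2 := (formal_frame_bundle M).
Notation P1g := (P1g M).
Notation P2g := (P2g M).
Implicit Types (c d : chart M) (j : P2) (q : P1g) (G m : symbols M).

(* The derivatives at o of a moving frame through (y, a) which is horizontal for
   the symbols g. *)
Definition section_jet (g : 'M[R]_(n, n * n)) (a : 'M[R]_n) :=
  array (fun k => - (array_eval g (a *m delta_mx k 0) *m a)).

(** Up to sign, the components of the tensor in the frame [a]; this is why the value no longer
    depends on the chart in [section_tensor_transition]. *)
Definition section_tensor (m : 'M[R]_(n, n * n)) (a : 'M[R]_n) :=
  array (fun k => - (invmx a *m array_eval m (a *m delta_mx k 0) *m a)).

Definition section_symbols (s : P1g -> P2g) G m :=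
  forall c q, dom c (tag q.1) -> let y := loc c (tag q.1) in let a := fmat c q.1 in
    jet_array c (s q).1 = section_jet (G c y) a /\
    (s q).2.2 = section_tensor (m c y) a.

Lemma section_jetE g a v :
  array_eval (section_jet g a) v = - (array_eval g (a *m v) *m a).
Proof.
move: v; apply: linear_delta_eq => [|t v w|k]; first exact: array_eval_linearr.
  by rewrite linearP /= array_evalD array_evalZ mulmxDl -scalemxAl opprD scalerN.
by rewrite array_eval_array.
Qed.

Lemma section_tensorE (m : 'M[R]_(n, n * n)) a v :
  array_eval (section_tensor m a) v = - (invmx a *m array_eval m (a *m v) *m a).
Proof.
move: v; apply: linear_delta_eq => [|t v w|k]; first exact: array_eval_linearr.
  by rewrite linearP /= array_evalD array_evalZ mulmx3_linear opprD scalerN.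
by rewrite array_eval_array.
Qed.

Lemma jet_array_transition c d j : dom c (tag (pi21 j)) -> dom d (tag (pi21 j)) ->
  let y := loc c (tag (pi21 j)) in let J := jac (transition c d) y in
  let a := fmat c (pi21 j) in
  jet_array d j = array (fun k => 'd (jac (transition c d)) y (a *m delta_mx k 0) *m a
    + J *m array_eval (jet_array c j) (delta_mx k 0)).
Proof.
move=> cj dj; cbv zeta; congr array; apply/funext => k.
by rewrite (frame_tangent_val _ cj dj) jet_val.
Qed.

(** The Christoffel rule is exactly what makes the prescribed arrays transform like those of a
    formal 2-frame; compare [jet_array_transition]. *)
Lemma section_jet_transition G c d (u : P1) : connection_symbols G ->
  dom c (tag u) -> dom d (tag u) ->
  let y := loc c (tag u) in let J := jac (transition c d) y in
  section_jet (G d (loc d (tag u))) (fmat d u) =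
    array (fun k => 'd (jac (transition c d)) y (fmat c u *m delta_mx k 0) *m fmat c u
    + J *m array_eval (section_jet (G c y) (fmat c u)) (delta_mx k 0)).
Proof.
move=> [_ HG] cu du; cbv zeta; congr array; apply/funext => k.
have := HG c d _ (fmat c u *m delta_mx k 0) cu du; cbv zeta.
rewrite array_eval_array (fmat_transition cu du) mulmxN !mulmxA => <-.
by rewrite mulmxDl opprD addrC subrK -!mulmxA.
Qed.

Lemma section_tensor_transition m c d (u : P1) : tensor_symbols m ->
  dom c (tag u) -> dom d (tag u) ->
  section_tensor (m d (loc d (tag u))) (fmat d u) =
  section_tensor (m c (loc c (tag u))) (fmat c u).
Proof.
move=> [_ Hm] cu du; congr array; apply/funext => k; congr (- _).
have ua := fmat_unit cu; have := fmat_unit du.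
have := Hm c d _ (fmat c u *m delta_mx k 0) cu du; cbv zeta.
rewrite (fmat_transition cu du); set J := jac _ _; set a := fmat c u in ua *.
rewrite -[(J *m a) *m delta_mx k 0]mulmxA; set b := array_eval _ _ => H uJ.
rewrite -mulmxA [b *m _]mulmxA H -mulmxA invmx_mulK // mulmxA //.
Qed.

Lemma section_symbols_exist_at G m q : exists p : P2g, P2g_proj p = q /\
  let c := some_chart (tag q.1) in let y := loc c (tag q.1) in let a := fmat c q.1 in
    jet_array c p.1 = section_jet (G c y) a /\ p.2.2 = section_tensor (m c y) a.
Proof.
set c := some_chart (tag q.1); have cq : dom c (tag q.1) := some_chartP _.
have [j [ju jb]] := P2_ex (section_jet (G c (loc c (tag q.1))) (fmat c q.1)) cq.
pose p : P2g := (j, (q.2, section_tensor (m c (loc c (tag q.1))) (fmat c q.1))).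
by exists p; split=> //; rewrite /P2g_proj /p; case: (q) ju => u t /= ->.
Qed.

Definition section_of_symbols G m q : P2g := sval (cid (section_symbols_exist_at G m q)).

Lemma section_of_symbols_proj G m q : P2g_proj (section_of_symbols G m q) = q.
Proof. by rewrite /section_of_symbols; case: cid => p []. Qed.

Lemma section_proj1 (s : P1g -> P2g) q : P2g_proj (s q) = q -> pi21 (s q).1 = q.1.
Proof. exact: (congr1 fst). Qed.

Lemma section_proj2 (s : P1g -> P2g) q : P2g_proj (s q) = q -> (s q).2.1 = q.2.
Proof. exact: (congr1 snd). Qed.

Lemma section_of_symbolsP G m : connection_symbols G -> tensor_symbols m ->
  section_symbols (section_of_symbols G m) G m.
Proof.
move=> HG Hm c q cq; cbv zeta.
have sq := section_proj1 (section_of_symbols_proj G m q).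
move: sq; rewrite /section_of_symbols; case: cid => p /= [_ [pj pt]] pq.
have dq := some_chartP (tag q.1); set d := some_chart _ in dq pj pt.
have cp : dom c (tag (pi21 p.1)) by rewrite pq.
have dp : dom d (tag (pi21 p.1)) by rewrite pq.
split; last by rewrite pt (section_tensor_transition Hm cq dq).
by rewrite (jet_array_transition dp cp) (section_jet_transition HG dq cq) pj pq.
Qed.

Lemma section_symbols_smooth s G m : connection_symbols G -> tensor_symbols m ->
  (forall q, P2g_proj (s q) = q) -> section_symbols s G m ->
  smooth_map (N1 := P1g) (N2 := P2g) s.
Proof.
move=> [HG _] [Hm _] ps H; apply: smooth_map_crit => -[d []] q [dq _].
have dq' : dom (N := M) d (tag q.1) by rewrite -(section_proj1 (ps q)).
pose O := [set p : (E * 'M[R]_n) * 'M[R]_n |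
    (loc (N := M) d @` dom (N := M) d) p.1.1 /\ p.1.2 \in unitmx].
have Oo : open O.
  exact: open_prodl (open_prod (open_dom (N := M) d) (@open_unitmx R n)).
exists (d, tt), O, (fun p => ((p.1, section_jet (G d p.1.1) p.1.2),
   (p.2, section_tensor (m d p.1.1) p.1.2))); split=> //.
- by split; [exists (tag q.1) | exact: fmat_unit].
- have s1 : smooth_on O (fun p => p.1.1) by smooth_rec.
  have s2 : smooth_on O (fun p => p.1.2) by smooth_rec.
  have si : smooth_on O (fun p => invmx p.1.2).
    by apply: (smooth_comp (f := @invmx R n) _ _ (@smooth_invmx R n)) => // p [].
  have sG : smooth_on O (fun p => G d p.1.1).
    by apply: (smooth_comp (f := G d) _ _ (HG d)) => // p [].
  have sm : smooth_on O (fun p => m d p.1.1).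
    by apply: (smooth_comp (f := m d) _ _ (Hm d)) => // p [].
  have sj : smooth_on O (fun p => section_jet (G d p.1.1) p.1.2).
    by apply: smooth_array => // k; smooth_rec.
  have st : smooth_on O (fun p => section_tensor (m d p.1.1) p.1.2).
    by apply: smooth_array => // k; smooth_rec.
  by smooth_rec.
- move=> q' [cq' _] _; have pq := section_proj1 (ps q').
  split; first by split=> //; move: cq'; rewrite -pq.
  have [H1 H2] := H d q' cq'.
  apply: pair_ext; last first.
    by apply: pair_ext; [exact: section_proj2 (ps q') | exact: H2].
  by apply: pair_ext; [exact: (congr1 (loc (N := P1) d) pq)|exact: H1].
Qed.

Lemma P2g_act_GLg_inj (p : P2g) (h : 'M[R]_n * 'M[R]_n) :
  P2g_act p (GLg_inj h) = (formal_frame_act p.1 (h.1, 0),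
    (invmx h.1 *m p.2.1 *m h.1 + h.2, array (fun k =>
       invmx h.1 *m array_eval p.2.2 (h.1 *m delta_mx k 0) *m h.1))).
Proof.
apply: pair_ext => //.
have -> : (P2g_act p (GLg_inj h)).2 = Ad G2 (ginv G2 (h.1, 0)) p.2 + (h.2, 0) by [].
rewrite ginv_G2 Ad_G2 invmxK; apply: pair_ext => //=.
by rewrite addr0.
Qed.

Lemma section_symbols_act s G m q (h : 'M[R]_n * 'M[R]_n) : h.1 \in unitmx ->
  (forall q, P2g_proj (s q) = q) -> section_symbols s G m ->
  s (P1g_act q h) = P2g_act (s q) (GLg_inj h).
Proof.
move=> uh ps H; rewrite P2g_act_GLg_inj.
have cq := some_chartP (tag q.1); set c := some_chart _ in cq.
have cq' : dom c (tag (P1g_act q h).1) by [].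
have [H1 H2] := H c q cq; have [H1' H2'] := H c (P1g_act q h) cq'.
have cs : dom c (tag (pi21 (s q).1)) by rewrite (section_proj1 (ps q)).
have ua := fmat_unit cq; rewrite P1g_act_fmat // in H1' H2'.
have [A1 A2] := formal_frame_act_loc cs uh.
apply: pair_ext.
  apply: (P2_inj (c := c)).
  - by rewrite (section_proj1 (ps _)).
  - by rewrite (section_proj1 (ps _)) A1 (section_proj1 (ps _)).
  rewrite A2 H1 H1'; congr array; apply/funext => k.
  by rewrite section_jetE !mulNmx -!mulmxA.
apply: pair_ext.
  by rewrite (section_proj2 (ps _)) P1g_act2 /= (section_proj2 (ps q)).
rewrite H2'; cbn [snd]; congr array; apply/funext => k; rewrite H2 section_tensorE.
by rewrite mulmxN mulNmx -mulmxA invmx_mulmx // -!mulmxA.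
Qed.

Lemma equivariant_section_exists G m : connection_symbols G -> tensor_symbols m ->
  exists s : equivariant_section M, section_symbols (sval s) G m.
Proof.
move=> HG Hm; have ps := section_of_symbols_proj G m.
have H := section_of_symbolsP HG Hm.
have sP : is_equivariant_section (section_of_symbols G m).
  split=> //; first exact: section_symbols_smooth HG Hm ps H.
  by move=> q h uh; exact: (section_symbols_act q uh ps H).
by exists (exist _ _ sP).
Qed.

(** As for forms, the section is read in two charts at the coordinate frame of [c]. The arrays give
    the Christoffel rule; the Lie algebra component, which is the same in both charts, gives the
    tensor rule. *)
Lemma section_symbols_rules s G m : (forall q, P2g_proj (s q) = q) ->
  section_symbols s G m -> forall c d (x : M) v, dom c x -> dom d x ->
    let y := loc c x in let J := jac (transition c d) y in
    array_eval (G d (loc d x)) (J *m v) *m J + 'd (jac (transition c d)) y v =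
      J *m array_eval (G c y) v /\
    array_eval (m d (loc d x)) (J *m v) *m J = J *m array_eval (m c y) v.
Proof.
move=> ps H c d x v cx dx; cbv zeta.
have [q [qx fq tq]] := P1g_ex 0 cx (unitmx1 R n); subst x.
have [c1 c2] := H c q cx; have [d1 d2] := H d q dx.
have pq := section_proj1 (ps q).
have cs : dom c (tag (pi21 (s q).1)) by rewrite pq.
have ds : dom d (tag (pi21 (s q).1)) by rewrite pq.
have uJ := fmat_unit dx.
move: (jet_array_transition cs ds); cbv zeta; rewrite pq c1 d1 fq => e1.
have e2 : section_tensor (m d (loc d (tag q.1))) (fmat d q.1) =
  section_tensor (m c (loc c (tag q.1))) (fmat c q.1) by rewrite -c2 -d2.
move: e1 e2 uJ; rewrite (fmat_transition cx dx) fq mulmx1.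
set y := loc c (tag q.1); set J := jac (transition c d) y => e1 e2 uJ.
(* The arrays compare the two sides on basis vectors only; both sides are linear in the
   direction. *)
have j1 v' : 'd (jac (transition c d)) y v' - J *m array_eval (G c y) v' =
    - (array_eval (G d (loc d (tag q.1))) (J *m v') *m J).
  move: v'; apply: linear_delta_eq.
  - move=> t v1 w; rewrite linearP /= array_evalD array_evalZ mulmxDr -scalemxAr.
    by rewrite opprD addrACA -scalerBr.
  - move=> t v1 w; rewrite linearP /= array_evalD array_evalZ mulmxDl -scalemxAl.
    by rewrite opprD scalerN.
  - move=> k; have := congr1 (fun b => array_eval b (delta_mx k 0)) e1.
    by rewrite section_jetE !array_eval_array mul1mx !mulmx1 mulmxN.
split.
  by apply/eqP; rewrite -subr_eq0 -addrA j1 subrr.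
have := congr1 (fun b => array_eval b v) e2; rewrite !section_tensorE => /oppr_inj.
by rewrite invmx1 !mul1mx mulmx1 -mulmxA => <-; rewrite mulKVmx.
Qed.

Section Symbols.
Variable s : equivariant_section M.

Let rep c := local_rep (N1 := P1g) (N2 := P2g) (sval s) (c, tt) (c, tt).
(** At the identity frame [section_jet] and [section_tensor] reduce to a change of sign, which the
    minus signs here undo. *)
Let G c y := - (rep c ((y, 1%:M), 0)).1.2.
Let m c y := - (rep c ((y, 1%:M), 0)).2.2.

Let s_proj q : P2g_proj (sval s q) = q.
Proof. by case: (svalP s). Qed.

Let s_dom c q : dom c (tag q.1) -> dom (N := P2g) (c, tt) (sval s q).
Proof. by move=> cq; split=> //; rewrite -(section_proj1 (s_proj q)) in cq. Qed.

Lemma section_smooth_symbols c :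
  smooth_on (loc c @` dom c) (G c) /\ smooth_on (loc c @` dom c) (m c).
Proof.
pose proof (open_dom (N := M) c) as Oo.
have [sm _ _] := svalP s; have [_ srep] := sm (c, tt) (c, tt).
have sW : smooth_on (loc c @` dom c) (fun y => rep c ((y, 1%:M), 0)).
  apply: (smooth_comp (f := rep c) _ _ srep) => //; last by smooth_rec.
  move=> _ [x cx <-]; have [q [qx fq tq]] := P1g_ex 0 cx (unitmx1 R n); subst x.
  exists q; last by rewrite -fq -tq.
  by split => //; exact: s_dom.
by split; rewrite /G /m; smooth_rec.
Qed.

Lemma equivariant_section_symbols : section_symbols (sval s) G m.
Proof.
move=> c q cq; cbv zeta; have ua := fmat_unit cq.
have [q0 [q0x f0 t0]] := P1g_ex 0 cq (unitmx1 R n).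
have cq0 : dom c (tag q0.1) by rewrite q0x.
pose h : 'M[R]_n * 'M[R]_n := (fmat c q.1, q.2).
have uh : h.1 \in unitmx := ua.
have qE : P1g_act q0 h = q.
  apply: (P1g_inj (c := c)) => //; rewrite P1g_act_loc //.
  by rewrite P1g_loc q0x f0 t0 mul1mx mulmx0 mul0mx add0r.
have rE : rep c ((loc c (tag q.1), 1%:M), 0) = loc (N := P2g) (c, tt) (sval s q0).
  rewrite -q0x -f0 -t0.
  exact: (local_repE (N1 := P1g) (f := sval s) (c := (c, tt)) (d := (c, tt)) (P1g_dom cq0) (s_dom cq0)).
have [_ _ eqv] := svalP s; have sq := eqv q0 h uh; rewrite qE P2g_act_GLg_inj in sq.
have cs : dom c (tag (pi21 (sval s q0).1)) by rewrite (section_proj1 (s_proj q0)).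
have [_ A2] := formal_frame_act_loc cs uh.
rewrite sq; split.
  by rewrite A2; congr array; apply/funext => k; rewrite /G rE array_evalN mulNmx opprK.
cbn [snd]; congr array; apply/funext => k.
by rewrite /m rE array_evalN mulmxN mulNmx opprK.
Qed.
End Symbols.

Lemma section_symbols_exist (s : equivariant_section M) : exists G m,
  [/\ connection_symbols G, tensor_symbols m & section_symbols (sval s) G m].
Proof.
have ps : forall q, P2g_proj (sval s q) = q by case: (svalP s).
have H := equivariant_section_symbols s; have r := section_symbols_rules ps H.
set G := (X in section_symbols _ X _) in H r *; set m := (X in section_symbols _ _ X) in H r *.
exists G, m; split=> //; split.
- by move=> c; case: (section_smooth_symbols s c).
- by move=> c d x v cx dx; case: (r c d x v cx dx).
- by move=> c; case: (section_smooth_symbols s c).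
- by move=> c d x v cx dx; case: (r c d x v cx dx).
Qed.

Lemma P1g_fst_smooth : smooth_map (N1 := P1g) (N2 := P1) (fun q => q.1).
Proof.
apply: smooth_map_crit => d q dq; exists (d, tt), setT, (@fst (E * 'M[R]_n) 'M[R]_n).
split=> //; first exact: openT.
  by apply: smooth_fst; [exact: openT | apply: smooth_id; exact: openT].
by move=> q' [].
Qed.

Lemma P1g_snd_smooth : smooth_map (N1 := P1g) (N2 := vec 'M[R]_n) (fun q => q.2).
Proof.
apply: smooth_map_crit => d q _; have dq := some_chartP (tag q.1).
exists (some_chart (tag q.1), tt), setT, (@snd (E * 'M[R]_n) 'M[R]_n).
split=> //; first exact: openT.
by apply: smooth_snd; [exact: openT | apply: smooth_id; exact: openT].
Qed.

Lemma P1g_base_smooth : smooth_map (N1 := P1g) (N2 := M) (fun q => tag q.1).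
Proof.
apply: smooth_map_crit => d q dq.
exists (d, tt), setT, (fun p : (E * 'M[R]_n) * 'M[R]_n => p.1.1).
split=> //; first exact: openT.
  by have Oo : open [set: (E * 'M[R]_n) * 'M[R]_n] := openT; smooth_rec.
by move=> q' [].
Qed.

Lemma dmap_P1g_fst c q (T : tangent q) : dom c (tag q.1) ->
  val (dmap (N2 := P1) (fun q : P1g => q.1) T) c = (val T (c, tt)).1.
Proof.
move=> cq; apply: (dmap_formula (F := fst) (D := fst) T P1g_fst_smooth (P1g_dom cq)) => //.
exact: isdiff_fst.
Qed.

Lemma dmap_P1g_snd c q (T : tangent q) : dom c (tag q.1) ->
  val (dmap (N2 := vec 'M[R]_n) (fun q : P1g => q.2) T) tt = (val T (c, tt)).2.
Proof.
move=> cq; apply: (dmap_formula (F := snd) (D := snd) T P1g_snd_smooth (P1g_dom cq)) => //.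
exact: isdiff_snd.
Qed.

Lemma dmap_P1g_base c q (T : tangent q) : dom c (tag q.1) ->
  val (dmap (N2 := M) (fun q : P1g => tag q.1) T) c = (val T (c, tt)).1.1.
Proof.
move=> cq; pose F (p : (E * 'M[R]_n) * 'M[R]_n) := p.1.1.
apply: (dmap_formula (F := F) (D := F) T P1g_base_smooth (P1g_dom cq)) => //.
exact: isdiff_linear.
Qed.

(** The vector T has base part a e_k and frame part -G(a e_k) a, so the first component theta
    vanishes. The bracket in [local_form] vanishes with it, and the second component a^-1 m(a e_k) a
    is the opposite of the value of tau. *)
Lemma section_of_formP (omega : P1g_connection M) (s : equivariant_section M) G m :
  form_symbols (sval omega) G m -> section_symbols (sval s) G m -> section_of omega s.
Proof.
move=> Ho Hs u k; cbv zeta; have [_ ps _] := svalP s.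
have cu := some_chartP (tag u); set c := some_chart _ in cu.
have pu := section_proj1 (ps (u, 0)).
have [H1 H2] := Hs c (u, 0) cu.
set j := (sval s (u, 0)).1 in pu H1 *; set tau := (sval s (u, 0)).2 in H2 *.
have cj : dom c (tag (pi21 j)) by rewrite pu.
move=> T T1 T2.
have w1 : (val T (c, tt)).1 = val (tagged (val j) k) c.
  apply: (etrans (esym (dmap_P1g_fst T cj))).
  exact: (congr1 (fun v : tangent (pi21 j) => val v c) T1).
have w2 : (val T (c, tt)).2 = 0.
  apply: (etrans (esym (dmap_P1g_snd T cj))).
  exact: (congr1 (fun v : tangent (0 : vec 'M[R]_n) => val v tt) T2).
apply: (etrans (Ho c (pi21 j, 0 : 'M[R]_n) T cj)).
rewrite /local_form w2 w1 jet_val // P1g_loc; cbn [fst snd].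
have ua := fmat_unit cj.
move: H1 H2; rewrite -pu; cbn [fst snd]; move=> -> ->.
rewrite section_jetE section_tensorE opprK subrr mulmx0.
by rewrite mulmx0 !subr0 addr0.
Qed.

End Sections.

(** * Cutoff functions and vector fields *)

Section Bump.
Context {R : realType}.

Lemma isdiff_intro (V W : normedModType R) (f : V -> W) x (df : {linear V -> W}) :
  continuous df ->
  (forall e, 0 < e -> \forall h \near 0, `|f (h + x) - (f x + df h)| <= e * `|h|) ->
  isdiff f x df.
Proof.
move=> dc H.
have o : f \o shift x = cst (f x) + df +o_ 0 id by apply/eqaddoP.
have dE := diff_unique dc o.
by split; [apply/diff_locallyP; rewrite dE | move=> v; rewrite dE].
Qed.

Lemma isdiff_expR (x : R^o) : isdiff (expR : R^o -> R^o) x (fun v => v * expR x).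
Proof.
split; first by apply/derivable1_diffP; exact: derivable_expR.
move=> v; have dx : derivable (expR : R^o -> R^o) x 1 by exact: derivable_expR.
rewrite (deriv1E dx) derive1E; congr (v * _).
exact: (congr1 (fun f : R -> R => f x) (derive_expR R)).
Qed.

Lemma isdiff_exp (V : normedModType R) (f df : V -> R^o) x k : isdiff f x df ->
  isdiff (fun y => f y ^+ k : R^o) x (fun v => k%:R * f x ^+ k.-1 * df v : R^o).
Proof.
move=> Hf; elim: k => [|k IH].
  by apply: isdiff_ext (isdiff_cst (1 : R^o) x) _ => v; rewrite !mul0r.
have H := isdiff_scale (fin_dim_R (R := R)) Hf IH.
have -> : (fun y => f y ^+ k.+1) = fun y => f y *: (f y ^+ k : R^o).
  by apply/funext => y; rewrite exprS.
apply: isdiff_ext H _ => v.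
rewrite -[LHS]/(df v * f x ^+ k + f x * (k%:R * f x ^+ k.-1 * df v)) /=.
case: k {IH} => [|k]; first by rewrite mul0r mul0r mulr0 addr0 expr0 mul1r mulr1 mul1r.
have key (a b : R) : b * a ^+ k.+1 + a * (k.+1%:R * a ^+ k * b) = k.+2%:R * a ^+ k.+1 * b.
  by rewrite -[k.+2%:R]natr1 exprS; ring.
exact: key.
Qed.

(** The powers t^-k are included because derivatives of exp(-1/t) produce them: the family is closed
    under differentiation up to linear combinations, so smoothness is an induction over all [k] at
    once. *)
Definition flat (k : nat) (t : R^o) : R^o :=
  if 0 < t then (t^-1) ^+ k * expR (- t^-1) else 0.

Lemma flat_ge0 k t : 0 <= flat k t.
Proof.
rewrite /flat; case: ifP => // t0; apply: mulr_ge0; last exact: expR_ge0.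
by apply: exprn_ge0; rewrite invr_ge0 ltW.
Qed.

Lemma flat_le0 k t : t <= 0 -> flat k t = 0.
Proof. by move=> t0; rewrite /flat ltNge t0. Qed.

Lemma flat0_gt0 t : 0 < t -> 0 < flat 0 t.
Proof. by move=> t0; rewrite /flat t0 expr0 mul1r expR_gt0. Qed.

(** With u = 1/t, the inequality exp u >= u^(k+2) / (k+2)! leaves the factor u^-2 = t^2. A quadratic
    bound makes the derivative at 0 vanish. *)
Lemma flat_bound k t : `|flat k t| <= (k.+2)`!%:R * t ^+ 2.
Proof.
have f0 : (0 : R) < (k.+2)`!%:R by rewrite ltr0n fact_gt0.
rewrite ger0_norm ?flat_ge0 // /flat; case: ifP => t0; last first.
  by rewrite mulr_ge0 ?sqr_ge0 // ltW.
have u0 : 0 < t^-1 by rewrite invr_gt0.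
have -> : t ^+ 2 = t^-1 ^- 2 by rewrite exprVn invrK.
move: (t^-1) u0 => u u0; rewrite expRN.
have := expR_ge1Dxn k.+1 (ltW u0) => H.
have {}H : u ^+ k.+2 / (k.+2)`!%:R <= expR u by apply: le_trans H; rewrite lerDr.
rewrite ler_pdivrMr // mulrC in H.
rewrite ler_pdivlMr ?exprn_gt0 // mulrAC -exprD addn2.
by rewrite ler_pdivrMr ?expR_gt0 // mulrC.
Qed.

Lemma isdiff_flat k (t : R^o) : isdiff (flat k) t
  (fun v => v * (flat k.+2 t - k%:R * flat k.+1 t) : R^o).
Proof.
have [t0|t0|t0] := ltgtP t 0.
- apply: isdiff_ext (isdiff_near _ (isdiff_cst (0 : R^o) t)) _ => [|v].
    apply: (open_near (@open_lt R 0)) => // s /= s0.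
    by rewrite flat_le0 // ltW.
  by rewrite !flat_le0 1?ltW // mulr0 subrr mulr0.
- have tn0 : t != 0 by rewrite gt_eqF.
  have d1 := isdiff_inv tn0.
  have dk := isdiff_exp k d1.
  have de := isdiff_comp (isdiffN d1) (isdiff_expR _).
  have H := isdiff_scale (fin_dim_R (R := R)) dk de.
  apply: isdiff_ext (isdiff_near _ H) _ => [|v].
    by apply: (open_near (@open_gt R 0)) => // s /= s0; rewrite /flat s0.
  rewrite /flat t0.
  (* The exponent [k.-1] forces a separate case [k = 0], where the factor [k%:R] kills the term. *)
  have key (u e w : R) : k%:R * u ^+ k.-1 * (- (u ^+ 2) * w) * e + u ^+ k * (- (- (u ^+ 2) * w) * e)
      = w * (u ^+ k.+2 * e - k%:R * (u ^+ k.+1 * e)).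
    case: (k) => [|j] /=; first by rewrite expr0 mul0r !mul0r add0r mul1r; ring.
    by rewrite !exprS; ring.
  by have := key t^-1 (expR (- t^-1)) v; rewrite [t^-1 ^+ 2]exprVn.
- subst t; pose z : {linear R^o -> R^o} := \0.
  have zc : continuous z by move=> y; exact: cst_continuous.
  have : isdiff (flat k) 0 z.
    apply: isdiff_intro => // e e0.
    pose C := (k.+2)`!%:R : R.
    have C0 : 0 < C by rewrite ltr0n fact_gt0.
    (* On |h| <= e / C the bound C h^2 is at most e |h|. *)
    have eC : 0 < e / C by rewrite divr_gt0.
    apply: filterS (nbhs0_lt eC) => h /ltW hC; have -> : flat k (h + 0) - (flat k 0 + z h) = flat k h.
      by rewrite addr0 (flat_le0 k (lexx 0)) add0r subr0.
    apply: (le_trans (flat_bound _ _)); rewrite -/C -real_normK ?num_real // expr2 mulrA.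
    by apply: ler_wpM2r => //; rewrite mulrC -ler_pdivlMr.
  by move=> H; apply: isdiff_ext H _ => v; rewrite !flat_le0 // mulr0 subrr mulr0.
Qed.

Lemma smooth_flat k : smooth_on setT (flat k).
Proof.
move=> m; elim: m k => [|m IH] k.
  by move=> t _; apply: differentiable_continuous; case: (isdiff_flat k t).
pose df (t v : R^o) : R^o := v *: flat k.+2 t + (- (v * k%:R)) *: flat k.+1 t.
apply: (@class_C_isdiff R R^o R^o m _ _ df); first exact: openT.
  move=> t _; apply: isdiff_ext (isdiff_flat k t) _ => v.
  by rewrite mulrBr /df mulrA; congr (_ + _); rewrite -mulNr.
move=> v; apply: class_CD; [exact: openT|..].
  apply: (class_C_scale (a := fun=> v)); [exact: openT|..|exact: IH].
  by apply: class_C_cst; exact: openT.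
apply: (class_C_scale (a := fun=> - (v * k%:R) : R^o)); [exact: openT|..|exact: IH].
by apply: class_C_cst; exact: openT.
Qed.

(** A smooth passage from 1 on t <= 1 to 0 on t >= 2. The denominator is positive everywhere, since
    2 - t or t - 1 is positive. *)
Definition step (t : R^o) : R^o :=
  flat 0 (2 - t) * (flat 0 (2 - t) + flat 0 (t - 1))^-1.

Lemma smooth_step : smooth_on setT step.
Proof.
have Oo : open [set: R^o] := openT.
have s1 : smooth_on setT (fun t : R^o => flat 0 (2 - t)).
  apply: (smooth_comp (O' := setT) (f := flat 0)) => //; first exact: smooth_flat.
  by apply: smoothD => //; [exact: smooth_cst|apply: smoothN => //; exact: smooth_id].
have s2 : smooth_on setT (fun t : R^o => flat 0 (t - 1)).
  apply: (smooth_comp (O' := setT) (f := flat 0)) => //; first exact: smooth_flat.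
  by apply: smoothD => //; [exact: smooth_id|exact: smooth_cst].
apply: smoothM => //.
apply: (smooth_comp (O' := [set x : R^o | x != 0]) (f := fun x : R^o => x^-1 : R^o)) => //.
- move=> t _ /=; have [t2|t2] := ltP t 2.
    by rewrite gt_eqF // ltr_wpDr ?flat_ge0 // flat0_gt0 // subr_gt0.
  by rewrite gt_eqF // ltr_wpDl ?flat_ge0 // flat0_gt0 // subr_gt0 (lt_le_trans _ t2) // ltr1n.
- exact: smooth_inv.
- exact: smoothD.
Qed.

Lemma step1 t : t <= 1 -> step t = 1.
Proof.
move=> t1; rewrite /step [flat 0 (t - 1)]flat_le0 ?subr_le0 // addr0 divff //.
by rewrite gt_eqF // flat0_gt0 // subr_gt0 (le_lt_trans t1) // ltr1n.
Qed.

Lemma step0 t : 2 <= t -> step t = 0.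
Proof. by move=> t2; rewrite /step flat_le0 ?subr_le0 // mul0r. Qed.

Lemma bump_exists n (x : 'cV[R]_n) (rho : R) : 0 < rho ->
  exists psi : 'cV[R]_n -> R^o,
    [/\ smooth_on setT psi, exists2 O, open O /\ O x & forall y, O y -> psi y = 1
     & forall y, psi y != 0 -> forall i, `|y i 0 - x i 0| <= rho].
Proof.
(* With the Euclidean norm, s |y - x|^2 is below 1 near x, and below 2 only if |y - x| < rho. The
   sum of squares replaces the sup norm, which is not smooth. *)
move=> rho0; pose s := 2 / rho ^+ 2; have r2 : 0 < rho ^+ 2 by rewrite exprn_gt0.
have s0 : 0 < s by rewrite divr_gt0.
have Oo : open [set: 'cV[R]_n] := openT.
pose r (y : 'cV[R]_n) : R^o := \sum_i ((y - x) i 0 : R^o) * (y - x) i 0.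
have sr : smooth_on setT (fun y => s * r y : R^o).
  apply: smoothM => //; first exact: smooth_cst.
  have sd : smooth_on setT (fun y => y - x).
    by apply: smoothD => //; [exact: smooth_id|exact: smooth_cst].
  by apply: smooth_sum => // i; apply: smoothM => //; apply: smooth_coord.
exists (fun y => step (s * r y)); split.
- by apply: (smooth_comp (O' := setT) (f := step) _ _ smooth_step).
- exists (setT `&` (fun y => s * r y : R^o) @^-1` [set t | t < 1]).
    split; last first.
      split=> //=; rewrite /r big1 ?mulr0 ?ltr01 // => i _.
      by rewrite subrr mxE mul0r.
    apply: open_preim => //.
    by move=> y Ty; exact: smooth_continuous sr Ty.
  by move=> y [_ /= /ltW]; exact: step1.
- move=> y py i; rewrite leNgt; apply: contra py => yi.
  rewrite step0 // /s mulrAC ler_pdivlMr // ler_pM2l //.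
  rewrite /r (bigD1 i) //= ler_wpDr //.
    by apply: sumr_ge0 => j _; rewrite -expr2 sqr_ge0.
  rewrite !mxE -expr2 -[leRHS]real_normK ?num_real // lerXn2r ?nnegrE ?(ltW rho0) //.
  exact: ltW.
Qed.

End Bump.

Section Cutoff.
Context {R : realType} {n : nat} {M : manifold R n}.
Notation E := 'cV[R]_n.
Implicit Types (c d : chart M).

(** The bridge between the topology of M and open sets of R^n: the chart is an open map for one
    direction and continuous for the other. *)
Lemma near_chart c (x : M) (P : M -> Prop) : dom c x ->
  nbhs (x : mspace M) P <->
  exists O, [/\ open O, O (loc c x) & forall z, dom c z -> O (loc c z) -> P z].
Proof.
move=> cx; split=> [|[A [Oo Ox H]]].
  rewrite nbhsE => -[U [Uo Ux] UP]; exists (loc c @` (U `&` dom c)); split.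
  - apply: mloc_open; last by move=> z [].
    by apply: openI => //; exact: mdom_open.
  - by exists x.
  - by move=> z cz [z' [Uz' cz'] /(atlas_inj cz' cz) <-]; exact: UP.
have nO : nbhs (x : mspace M) (loc c @^-1` A).
  by apply: (mloc_continuous cx); exact: open_nbhs_nbhs.
have nd : nbhs (x : mspace M) (dom c).
  by apply: open_nbhs_nbhs; split=> //; exact: mdom_open.
by apply: filterS (filterI nO nd) => z [Oz cz]; exact: H.
Qed.

Lemma chart_near c (x : M) (P : M -> Prop) (Q : E -> Prop) : dom c x ->
  nbhs (x : mspace M) P -> (forall z, dom c z -> P z -> Q (loc c z)) ->
  \forall y \near loc c x, Q y.
Proof.
move=> cx /(near_chart _ cx)[A [Oo Ox H]] PQ.
apply: (open_near (openI Oo (open_dom c))); first by split=> //; exists x.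
by move=> y [Oy [z cz zE]]; subst y; apply: PQ => //; exact: H.
Qed.

(** The set is the image of a compact box of R^n under the inverse chart, hence compact, hence
    closed since M is Hausdorff. Closedness in M, not just in the chart domain, makes extension by
    zero smooth at points outside the chart. *)
Lemma box_compact c (x : M) (rho : R) :
  (forall y : E, (forall i, `|y i 0 - loc c x i 0| <= rho) -> (loc c @` dom c) y) ->
  closed [set z : mspace M | dom c z /\ forall i, `|loc c z i 0 - loc c x i 0| <= rho].
Proof.
move=> box; apply: compact_closed; first exact: mhausdorff.
pose y0 := loc c x.
(* Rows rather than columns, to apply [rV_compact]. *)
pose B := [set v : 'rV[R]_n | forall i, v 0 i \in `[y0 i 0 - rho, y0 i 0 + rho]].
have Bc : compact B.
  apply: (rV_compact (A := fun i => [set` `[y0 i 0 - rho, y0 i 0 + rho]])).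
  by move=> i; exact: segment_compact.
pose h (v : 'rV[R]_n) : mspace M := xget x [set z | dom c z /\ loc c z = v^T].
have BP v : B v -> dom c (h v) /\ loc c (h v) = v^T.
  move=> Bv; rewrite /h; case: xgetP => [z _ //|H].
  have [z cz zE] : (loc c @` dom c) v^T.
    by apply: box => i; rewrite mxE; have := Bv i; rewrite in_itv /= ler_distl.
  by exfalso; apply: (H z).
have hP v z : dom c z -> loc c z = v^T -> h v = z.
  move=> cz zE; rewrite /h; case: xgetP => [z' _ [cz' z'E]|H].
    by apply: (atlas_inj cz' cz); rewrite zE z'E.
  by exfalso; apply: (H z).
have -> : [set z : mspace M | dom c z /\ forall i, `|loc c z i 0 - loc c x i 0| <= rho] = h @` B.
  apply/seteqP; split=> [z [cz zb]|_ [v Bv <-]].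
    exists (loc c z)^T; last by apply: hP => //; rewrite trmxK.
    by move=> i; rewrite mxE in_itv /= -ler_distl.
  have [cv vE] := BP v Bv; split=> // i.
  by rewrite vE mxE; have := Bv i; rewrite in_itv /= ler_distl.
apply: continuous_compact Bc; apply: continuous_in_subspaceT => v /set_mem Bv.
have [cv vE] := BP v Bv.
move=> W; rewrite nbhsE => -[U [Uo Uv] UW].
have lt : linear (fun v : 'rV[R]_n => v^T) by move=> a u w; rewrite linearP.
pose proof (isdiff_linear v lt) as [dt _].
have /= := differentiable_continuous dt.
have Oo : open (loc c @` (U `&` dom c)).
  apply: mloc_open; last by move=> z [].
  by apply: openI => //; exact: mdom_open.
move=> /(_ (loc c @` (U `&` dom c))) H.
have {}H : nbhs v ((fun v => v^T) @^-1` (loc c @` (U `&` dom c))).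
  by apply: H; apply: open_nbhs_nbhs; split=> //; exists (h v).
apply: filterS H => w /= [z [Uz cz] zE]; apply: UW.
by rewrite (hP w z).
Qed.

Lemma cutoff_exists c (x : M) : dom c x -> exists psi : M -> R^o,
  [/\ smooth_map (N2 := vec R^o) psi,
      nbhs (x : mspace M) (fun z => psi z = 1)
    & forall y, ~ dom c y -> nbhs (y : mspace M) (fun z => psi z = 0)].
Proof.
move=> cx; pose y0 := loc c x.
have : nbhs y0 (loc c @` dom c).
  by apply: open_nbhs_nbhs; split; [exact: open_dom | exists x].
(* Matrices carry the sup norm, so halving the radius puts the closed box inside the open ball. *)
move=> /nbhs_ballP[e /= e0 eb]; pose rho := e / 2.
have rho0 : 0 < rho by rewrite divr_gt0.
have box (y : E) : (forall i, `|y i 0 - y0 i 0| <= rho) -> (loc c @` dom c) y.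
  move=> H; apply: eb; split=> // i j; rewrite ord1 /ball /= distrC.
  by apply: le_lt_trans (H i) _; rewrite /rho ltr_pdivrMr // ltr_pMr // ltr1n.
have [psi [sp [A [Oo Ox] O1] sup]] := bump_exists y0 rho0.
pose f (z : M) : R^o := if pselect (dom c z) then psi (loc c z) else 0.
have fc z : dom c z -> f z = psi (loc c z) by rewrite /f; case: pselect.
have Kc := box_compact box.
have f0 y : ~ dom c y -> nbhs (y : mspace M) (fun z => f z = 0).
  move=> ncy; have := closed_openC Kc => Ko.
  have : nbhs (y : mspace M) (~` [set z : mspace M | dom c z /\ forall i, `|loc c z i 0 - y0 i 0| <= rho]).
    by apply: open_nbhs_nbhs; split=> //= -[/ncy].
  apply: filterS => z nz; rewrite /f; case: pselect => // cz.
  by apply/eqP; apply: contrapT => /negP /sup H; apply: nz.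
exists f; split=> //; last by apply/(near_chart _ cx); exists A; split=> // z cz Oz; rewrite fc ?O1.
apply: smooth_map_crit => -[] z _; have [cz|ncz] := pselect (dom c z).
  exists c, (loc c @` dom c), psi; split=> //.
  - exact: open_dom.
  - exact: smooth_sub sp.
  - by move=> z' cz' _; rewrite /= fc.
have dz := some_chartP z; have /(near_chart _ dz)[W [Wo Wz H]] := f0 z ncz.
exists (some_chart z), W, (fun=> 0); split=> //; first exact: smooth_cst.
by move=> z' dz' Wz'; split=> //; exact: H.
Qed.

End Cutoff.

(** * Functions and vector fields in charts *)

Section VectorFields.
Context {R : realType} {n : nat} {M : manifold R n}.
Notation E := 'cV[R]_n.
Implicit Types (c d : chart M) (X Y Z : vfield M) (f : M -> R^o).

Definition fcomp c f : E -> R^o := local_rep (N2 := vec R^o) f c tt.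

Definition vcomp c X : E -> E := fun y => (local_rep (N2 := tangent_bundle M)
  (fun x : M => existT _ x (sval X x) : tangent_bundle M) c c y).2.

Lemma fcompE c f (x : M) : dom c x -> fcomp c f (loc c x) = f x.
Proof. by move=> cx; rewrite /fcomp (local_repE (N2 := vec R^o)). Qed.

Lemma vcompE c X (x : M) : dom c x -> vcomp c X (loc c x) = val (sval X x) c.
Proof. by move=> cx; rewrite /vcomp (local_repE (N2 := tangent_bundle M)). Qed.

Lemma fcomp_smooth c f : smooth_map (N2 := vec R^o) f -> smooth_on (loc c @` dom c) (fcomp c f).
Proof.
move=> sf; have [_] := sf c tt.
by rewrite (_ : dom c `&` _ = dom c) //; apply/seteqP; split=> // x [].
Qed.

Lemma vcomp_smooth c X : smooth_on (loc c @` dom c) (vcomp c X).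
Proof.
have [_] := svalP X c c.
rewrite (_ : dom c `&` _ = dom c); last by apply/seteqP; split=> // x [].
by move=> sX; apply: smooth_snd => //; exact: open_dom.
Qed.

Lemma dom_isdiff (V : normedModType R) c (x : M) (F : E -> V) : dom c x ->
  smooth_on (loc c @` dom c) F -> isdiff F (loc c x) ('d F (loc c x)).
Proof. by move=> cx sF; apply: (smooth_isdiff sF); exists x. Qed.

Lemma dirderE c f (x : M) (v : tangent x) : smooth_map (N2 := vec R^o) f ->
  dom c x -> dirder f v = 'd (fcomp c f) (loc c x) (val v c).
Proof. by move=> sf cx; rewrite /dirder (dmapE (N2 := vec R^o) v (c := c)). Qed.

Lemma dirder_near c f (x : M) (v : tangent x) (F : E -> R^o) D :
  smooth_map (N2 := vec R^o) f -> dom c x ->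
  nbhs (x : mspace M) (fun z => dom c z -> f z = F (loc c z)) ->
  isdiff F (loc c x) D -> dirder f v = D (val v c).
Proof.
move=> sf cx fF dF; rewrite (dirderE _ sf cx).
have e : \forall y \near loc c x, F y = fcomp c f y.
  by apply: (chart_near cx fF) => z cz /(_ cz) <-; rewrite fcompE.
by have [_ ->] := isdiff_near e dF.
Qed.

Lemma vcomp_near c X (x : M) (F : E -> E) D : dom c x ->
  nbhs (x : mspace M) (fun z => dom c z -> val (sval X z) c = F (loc c z)) ->
  isdiff F (loc c x) D -> 'd (vcomp c X) (loc c x) =1 D.
Proof.
move=> cx XF dF.
have e : \forall y \near loc c x, F y = vcomp c X y.
  by apply: (chart_near cx XF) => z cz /(_ cz) <-; rewrite vcompE.
by have [] := isdiff_near e dF.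
Qed.

Lemma smooth_function_crit f :
  (forall x : M, exists c F, [/\ dom c x, smooth_on (loc c @` dom c) F &
     nbhs (x : mspace M) (fun z => dom c z -> f z = F (loc c z))]) ->
  smooth_map (N2 := vec R^o) f.
Proof.
move=> H; apply: smooth_map_crit => -[] x _; have [c [F [cx sF]]] := H x.
move=> /(near_chart _ cx)[W [Wo Wx WF]].
pose proof (openI (open_dom (N := M) c) Wo) as Vo.
exists c, (loc c @` dom c `&` W), F; split=> //.
  by apply: smooth_sub sF => y [].
by move=> z cz [_ Wz]; split=> //; apply: WF.
Qed.

Lemma smooth_field_crit (X : forall x : M, tangent x) :
  (forall x : M, exists c F, [/\ dom c x, smooth_on (loc c @` dom c) F &
     nbhs (x : mspace M) (fun z => dom c z -> val (X z) c = F (loc c z))]) ->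
  exists Y : vfield M, forall x, sval Y x = X x.
Proof.
move=> H; suff sX : smooth_map (fun x : M => existT _ x (X x) : tangent_bundle M).
  by exists (exist _ X sX).
apply: smooth_map_crit => d' x dx'; pose d : chart M := d'.
have dx : dom d x := dx'; have [c [F [cx sF]]] := H x.
move=> /(near_chart _ cx)[W [Wo Wx WF]].
pose V := loc c @` (dom c `&` dom d) `&` W.
have Vo : open V by apply: openI => //; exact: open_overlap.
exists c, V, (fun y => (transition c d y, 'd (transition c d) y (F y))); split=> //.
- by split=> //; exists x.
- pose proof (transition_smooth (N := M) c d) as st.
  have sF' : smooth_on V F.
    by apply: smooth_sub sF => _ [[z [cz _] <-] _]; exists z.
  apply: smooth_pair => //; first by apply: smooth_sub st => y [].
  by apply: (smooth_diff _ st) => //; [move=> y [] | exact: smooth_id].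
- move=> z cz [Oz Wz]; have dz : dom d z by exact: overlap_loc Oz.
  split; first exact: dz.
  rewrite -[LHS]/(loc d z, val (X z) d) transitionE //.
  by rewrite (tangent_val _ cz dz) WF.
Qed.

Lemma vzero : exists Z, forall x, sval Z x = 0.
Proof.
apply: smooth_field_crit => x; have cx := some_chartP x.
exists (some_chart x), (fun=> 0); split=> //; first by apply: smooth_cst; exact: open_dom.
by apply: filterE => z cz; exact: val_tangent0.
Qed.

Lemma vaxpy f X Y : smooth_map (N2 := vec R^o) f ->
  exists Z, forall x, sval Z x = f x *: sval X x + sval Y x.
Proof.
move=> sf; apply: smooth_field_crit => x; have cx := some_chartP x.
set c := some_chart x in cx.
exists c, (fun y => fcomp c f y *: vcomp c X y + vcomp c Y y); split=> //.
  pose proof (open_dom (N := M) c) as Oo.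
  have sf' := fcomp_smooth c sf; have sX := vcomp_smooth c X.
  have sY := vcomp_smooth c Y.
  by apply: smoothD => //; apply: smooth_scale.
apply: filterE => z cz; rewrite fcompE // !vcompE //.
Qed.

(** Near points outside the chart domain the product vanishes identically, whatever [h (loc c x)] is
    there. *)
Lemma smooth_cutoff_mul (psi : M -> R^o) c (h : E -> R^o) :
  smooth_map (N2 := vec R^o) psi ->
  (forall y, ~ dom c y -> nbhs (y : mspace M) (fun z => psi z = 0)) ->
  smooth_on (loc c @` dom c) h -> smooth_map (N2 := vec R^o) (fun x => psi x * h (loc c x)).
Proof.
move=> sp p0 sh; apply: smooth_function_crit => x; have [cx|ncx] := pselect (dom c x).
  exists c, (fun y => fcomp c psi y * h y); split=> //.
    by apply: smoothM => //; [exact: open_dom | exact: fcomp_smooth].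
  by apply: filterE => z cz; rewrite fcompE.
exists (some_chart x), (fun=> 0); split; first exact: some_chartP.
  by apply: smooth_cst; exact: open_dom.
by apply: filterS (p0 x ncx) => z -> _; rewrite mul0r.
Qed.

Lemma cutoff_field (psi : M -> R^o) c (V : E -> E) :
  smooth_map (N2 := vec R^o) psi ->
  (forall y, ~ dom c y -> nbhs (y : mspace M) (fun z => psi z = 0)) ->
  smooth_on (loc c @` dom c) V ->
  exists X, forall x, sval X x = psi x *: tvec c x (V (loc c x)).
Proof.
move=> sp p0 sV; apply: smooth_field_crit => x; have [cx|ncx] := pselect (dom c x).
  exists c, (fun y => fcomp c psi y *: V y); split=> //.
    apply: smooth_scale => //; [exact: open_dom | exact: fcomp_smooth].
  by apply: filterE => z cz; rewrite fcompE // val_tangentZ tvecK.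
exists (some_chart x), (fun=> 0); split; first exact: some_chartP.
  by apply: smooth_cst; exact: open_dom.
by apply: filterS (p0 x ncx) => z -> _; rewrite scale0r val_tangent0.
Qed.

Lemma vector_extension (x : M) (v : tangent x) : exists X, sval X x = v.
Proof.
have cx := some_chartP x; set c := some_chart x in cx.
have [psi [sp p1 p0]] := cutoff_exists cx.
have [|X XE] := cutoff_field (V := fun=> val v c) sp p0.
  by apply: smooth_cst; exact: open_dom.
exists X; rewrite XE (nbhs_singleton p1) scale1r.
by apply: (tangent_inj cx); rewrite tvecK.
Qed.

(** Differentiate the relation between the components of X in the two charts, the second being J
    times the first; the product rule brings in the second derivative of the transition map. *)
Lemma vcomp_transition c d X (x : M) v : dom c x -> dom d x ->
  let y := loc c x in let J := jac (transition c d) y in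
  'd (vcomp d X) (loc d x) (J *m v) =
    'd (jac (transition c d)) y v *m val (sval X x) c + J *m 'd (vcomp c X) y v.
Proof.
move=> cx dx; cbv zeta; set y := loc c x; set J := jac _ _.
pose proof (open_overlap (N := M) c d) as Oo.
have Oy : (loc c @` (dom c `&` dom d)) y by exists x.
pose proof (transition_smooth (N := M) c d) as st.
have dt := smooth_isdiff st Oy.
have dj := smooth_isdiff (jac_smooth Oo st) Oy.
have dX := dom_isdiff cx (vcomp_smooth c X).
have dX' := dom_isdiff dx (vcomp_smooth d X).
pose proof (isdiff_comp_eq dt (transitionE (N := M) cx dx) dX') as H1.
have H2 := isdiff_mulmx dj dX.
have e : \forall z \near y, jac (transition c d) z *m vcomp c X z = vcomp d X (transition c d z).
  apply: (open_near Oo Oy) => _ [z [cz dz] <-].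
  by rewrite transitionE // !vcompE // (tangent_val _ cz dz) jacE.
have E1 := isdiff_uniq H1 (isdiff_near e H2) v.
rewrite -(vcompE X cx) /J -(jacE (transition c d) y v).
exact: E1.
Qed.

End VectorFields.

(** * Covariant derivatives *)

Section CovariantDerivatives.
Context {R : realType} {n : nat} {M : manifold R n}.
Notation E := 'cV[R]_n.
Implicit Types (c d : chart M) (X Y Z : vfield M) (f : M -> R^o) (G m : symbols M).

Lemma tangent_jac c d (x : M) (v : tangent x) : dom c x -> dom d x ->
  val v d = jac (transition c d) (loc c x) *m val v c.
Proof. by move=> cx dx; rewrite (tangent_val _ cx dx) jacE. Qed.

Definition covariant_derivative G c (x : M) X Y : E :=
  'd (vcomp c Y) (loc c x) (val (sval X x) c) +
  array_eval (G c (loc c x)) (val (sval X x) c) *m val (sval Y x) c.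

Definition derivative_symbols (nabla : vfield M -> vfield M -> vfield M) G :=
  forall c (x : M) X Y, dom c x ->
    val (sval (nabla X Y) x) c = covariant_derivative G c x X Y.

Definition deformation_symbols (mu : forall x : M, tangent x -> tangent x -> tangent x) m :=
  forall c (x : M) (v w : tangent x), dom c x ->
    val (mu x v w) c = array_eval (m c (loc c x)) (val v c) *m val w c.

(** The second-derivative term of [vcomp_transition] is compensated by the inhomogeneous term of the
    Christoffel rule, so the expression transforms as a vector. *)
Lemma covariant_derivative_transition G c d (x : M) X Y : connection_symbols G ->
  dom c x -> dom d x ->
  covariant_derivative G d x X Y = jac (transition c d) (loc c x) *m covariant_derivative G c x X Y.
Proof.
move=> [_ HG] cx dx; rewrite /covariant_derivative.
rewrite (tangent_jac (sval X x) cx dx) (tangent_jac (sval Y x) cx dx).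
have VT := vcomp_transition Y (val (sval X x) c) cx dx.
apply: (etrans (congr1 (fun z => z + _) VT)).
have := HG c d x (val (sval X x) c) cx dx; cbv zeta.
set y := loc c x; set J := jac _ _; set b := array_eval _ _ => e.
rewrite mulmxDr !mulmxA -e mulmxDl -mulmxA.
by rewrite [RHS]addrA [RHS]addrC [RHS]addrA.
Qed.

Lemma derivative_exists_at G X Y : connection_symbols G -> exists Z, forall c (x : M),
  dom c x -> val (sval Z x) c = covariant_derivative G c x X Y.
Proof.
move=> HG.
pose W (x : M) := tvec (some_chart x) x (covariant_derivative G (some_chart x) x X Y).
have WE c x : dom c x -> val (W x) c = covariant_derivative G c x X Y.
  move=> cx; have dx := some_chartP x.
  by rewrite (tangent_jac _ dx cx) tvecK // -covariant_derivative_transition.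
have [|Z ZE] := smooth_field_crit (X := W).
  move=> x; set c := some_chart x; have cx : dom c x := some_chartP x.
  exists c, (fun y => 'd (vcomp c Y) y (vcomp c X y) +
     array_eval (G c y) (vcomp c X y) *m vcomp c Y y); split=> //.
    pose proof (open_dom (N := M) c) as Oo; have [sG _] := HG.
    have sX := vcomp_smooth c X; have sY := vcomp_smooth c Y; have sGc := sG c.
    apply: smoothD => //; last by smooth_rec.
    by apply: (smooth_diff _ sY) => //; exact: smooth_id.
  by apply: filterE => z cz; rewrite WE // /covariant_derivative !vcompE.
by exists Z => c x cx; rewrite ZE WE.
Qed.

Lemma leibniz_algebra (B : 'M[R]_n) (dz dy dy' z y y' : E) (a da : R) :
  dz = da *: y + a *: dy + dy' -> z = a *: y + y' ->
  dz + B *m z = da *: y + a *: (dy + B *m y) + (dy' + B *m y').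
Proof.
move=> -> ->; rewrite mulmxDr -scalemxAr scalerDr addrACA -!addrA.
by congr (_ + _); rewrite addrA.
Qed.

Lemma derivative_symbols_covariant nabla G : derivative_symbols nabla G ->
  is_covariant_derivative nabla.
Proof.
move=> H; split=> [f X X' Z Y sf ZE x|f X Y Y' Z sf ZE x];
  set c := some_chart x; have cx : dom c x := some_chartP x; apply: (tangent_inj cx).
  rewrite val_tangentD val_tangentZ !(H c) // /covariant_derivative ZE.
  rewrite val_tangentD val_tangentZ linearP array_evalD array_evalZ mulmxDl -scalemxAl.
  by rewrite addrACA scalerDr.
rewrite !val_tangentD !val_tangentZ !(H c) // /covariant_derivative (dirderE _ sf cx).
have dY := dom_isdiff cx (vcomp_smooth c Y).
have dY' := dom_isdiff cx (vcomp_smooth c Y').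
have df := dom_isdiff cx (fcomp_smooth c sf).
have dZ := isdiffD (isdiff_scale (fin_dim_matrix n 1) df dY) dY'.
have e : nbhs (x : mspace M) (fun z => dom c z ->
    val (sval Z z) c = fcomp c f (loc c z) *: vcomp c Y (loc c z) + vcomp c Y' (loc c z)).
  by apply: filterE => z cz; rewrite ZE val_tangentD val_tangentZ fcompE // !vcompE.
have V1 := vcomp_near cx e dZ (val (sval X x) c).
rewrite (fcompE f cx) (vcompE Y cx) in V1.
have V2 : val (sval Z x) c = f x *: val (sval Y x) c + val (sval Y' x) c by rewrite ZE.
exact: (leibniz_algebra _ V1 V2).
Qed.

Lemma connection_exists G : connection_symbols G ->
  exists nabla : connection M, derivative_symbols (sval nabla) G.
Proof.
move=> HG; pose nabla X Y := sval (cid (derivative_exists_at X Y HG)).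
have H : derivative_symbols nabla G.
  by move=> c x X Y cx; rewrite /nabla; case: cid => Z /= ->.
by exists (exist _ nabla (derivative_symbols_covariant H)).
Qed.

Lemma deformation_exists m : tensor_symbols m ->
  exists mu : deformation M, deformation_symbols (sval mu) m.
Proof.
move=> [sm Hm].
pose mu (x : M) (v w : tangent x) := tvec (some_chart x) x
  (array_eval (m (some_chart x) (loc (some_chart x) x)) (val v (some_chart x))
     *m val w (some_chart x)).
have H : deformation_symbols mu m.
  move=> d x v w dx; rewrite /mu; set c := some_chart x.
  have cx : dom c x := some_chartP x.
  rewrite (tangent_jac _ cx dx) tvecK // (tangent_jac v cx dx) (tangent_jac w cx dx).
  by rewrite !mulmxA (Hm c d x _ cx dx).
suff Hd : is_deformation mu by exists (exist _ mu Hd).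
move=> c; exists (fun i j k y => m c y i (mxvec_index j k)); split.
  by move=> i j k; apply: smooth_coord; [exact: open_dom | exact: sm].
move=> x v w cx; rewrite (H c) //; apply/matrixP => i l; rewrite ord1 !mxE.
apply: eq_bigr => j _; rewrite mxE mulr_suml; apply: eq_bigr => k _.
by rewrite mulrAC.
Qed.

(** The tensor rule holds because [mu] takes values in tangent vectors, whose components in two
    charts are related by J; [tvec] makes arbitrary components v and w available. *)
Lemma deformation_has_symbols (mu : deformation M) :
  exists m, tensor_symbols m /\ deformation_symbols (sval mu) m.
Proof.
pose co c := sval (cid (svalP mu c)).
have coP c : (forall i j k, smooth_on (loc c @` dom c) (co c i j k)) /\
    forall x (v w : tangent x), dom c x ->
      val (sval mu x v w) c = \col_i \sum_j \sum_k
        co c i j k (loc c x) * val w c j 0 * val v c k 0.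
  by rewrite /co; case: cid.
pose m c y : 'M[R]_(n, n * n) := array (fun k => \matrix_(i, j) co c i j k y).
have H : deformation_symbols (sval mu) m.
  move=> c x v w cx; have [_ ->] // := coP c; apply/matrixP => i l; rewrite ord1 !mxE.
  apply: eq_bigr => j _; rewrite mxE mulr_suml; apply: eq_bigr => k _.
  by rewrite -array_eval_delta array_eval_array mxE mulrAC.
exists m; split=> //; split.
  move=> c; pose proof (open_dom (N := M) c) as Oo; apply: smooth_array => // k.
  apply: smooth_matrix => // i j; have [sco _] := coP c.
  by apply: smooth_ext (sco i j k) => // y _; rewrite mxE.
move=> c d x v cx dx; cbv zeta; set J := jac _ _.
apply/matrixP => i j.
have e (w : E) : (array_eval (m d (loc d x)) (J *m v) *m J) *m w =
           (J *m array_eval (m c (loc c x)) v) *m w.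
  have := H d x (tvec c x v) (tvec c x w) dx.
  rewrite !(tangent_jac _ cx dx) (H c) // !tvecK // !mulmxA.
  by rewrite -/J => ->.
have := congr1 (fun A : E => A i 0) (e (delta_mx j 0)).
by rewrite -!colE !mxE.
Qed.

End CovariantDerivatives.

(** * Locality of covariant derivatives *)

Section SymbolsOfConnections.
Context {R : realType} {n : nat} {M : manifold R n}.
Notation E := 'cV[R]_n.
Implicit Types (c d : chart M) (X Y Z : vfield M) (f : M -> R^o) (G m : symbols M).

Section Nabla.
Variable nabla : vfield M -> vfield M -> vfield M.
Hypothesis nablaP : is_covariant_derivative nabla.

Let smooth_one : smooth_map (N2 := vec R^o) (fun _ : M => 1 : R^o).
Proof.
apply: smooth_function_crit => x; exists (some_chart x), (fun=> 1).
split; [exact: some_chartP | apply: smooth_cst; exact: open_dom | exact: filterE].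
Qed.

(** The axioms of a covariant derivative give the value on f X + X' in each argument. Vanishing on
    the zero field comes from f = 1 with all fields zero, that is from v = v + v. *)
Let double_eq0 (V : lmodType R) (v : V) : v = 1 *: v + v -> v = 0.
Proof. by move=> /esym/eqP; rewrite scale1r -subr_eq0 addrK => /eqP. Qed.

Lemma nabla_combination (r : seq 'I_n) (f : 'I_n -> M -> R^o) (Y : 'I_n -> vfield M) :
  (forall j, smooth_map (N2 := vec R^o) (f j)) ->
  exists Z, [/\ forall x, sval Z x = \sum_(j <- r) f j x *: sval (Y j) x,
    forall X x, sval (nabla X Z) x = \sum_(j <- r)
      (dirder (f j) (sval X x) *: sval (Y j) x + f j x *: sval (nabla X (Y j)) x) &
    forall W x, sval (nabla Z W) x = \sum_(j <- r) f j x *: sval (nabla (Y j) W) x].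
Proof.
have [nl nr] := nablaP => sf; elim: r => [|j r [Z [Z0 Z1 Z2]]].
  have [Z ZE] := @vzero R n M; exists Z; split=> [x|X x|W x]; rewrite big_nil //.
    apply: double_eq0.
    have ZZ y : sval Z y = (1 : R^o) *: sval Z y + sval Z y by rewrite !ZE scaler0 addr0.
    have := nr _ X Z Z Z smooth_one ZZ x.
    by rewrite ZE scaler0 add0r.
  apply: double_eq0.
  have ZZ y : sval Z y = (1 : R^o) *: sval Z y + sval Z y by rewrite !ZE scaler0 addr0.
  exact: (nl _ Z Z Z W smooth_one ZZ x).
have [Z' Z'E] := vaxpy (Y j) Z (sf j).
exists Z'; split=> [x|X x|W x]; rewrite big_cons ?Z'E ?Z0 //.
  by rewrite (nr _ X (Y j) Z Z' (sf j) Z'E) Z1.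
by rewrite (nl _ (Y j) Z Z' W (sf j) Z'E) Z2.
Qed.

(** Let E_j be the coordinate fields times a cutoff psi. Then W = (1 - psi^2) W + sum_j (psi W^j)
    E_j on all of M. Where psi is 1 nearby, the coefficient 1 - psi^2 vanishes together with its
    derivative, so the axioms express nabla_X Y through the nabla_{E_k} E_j. The same fields serve a
    whole neighbourhood of x, for the smoothness of the symbols. *)
Lemma nabla_local c (x : M) : dom c x -> exists Ef : 'I_n -> vfield M,
  nbhs (x : mspace M) (fun z => dom c z ->
    (forall j, val (sval (Ef j) z) c = delta_mx j 0 /\
       forall v, 'd (vcomp c (Ef j)) (loc c z) v = 0) /\
    forall X Y, val (sval (nabla X Y) z) c =
      'd (vcomp c Y) (loc c z) (val (sval X z) c) +
      \sum_j \sum_k (val (sval Y z) c j 0 * val (sval X z) c k 0) *: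
         val (sval (nabla (Ef k) (Ef j)) z) c).
Proof.
move=> cx; have [psi [sp p1 p0]] := cutoff_exists cx.
pose V (j : 'I_n) (y : E) : E := delta_mx j 0.
have sV j : smooth_on (loc c @` dom c) (V j) by apply: smooth_cst; exact: open_dom.
have /choice[Ef EfE] : forall j, exists Xj : vfield M, forall z,
    sval Xj z = psi z *: tvec c z (V j (loc c z)).
  by move=> j; exact: cutoff_field.
(* At interior points z the cutoff is 1 in a neighbourhood of z, so derivatives at z are controlled
   as well as values. *)
exists Ef; have := nbhs_interior p1; apply: filterS => z zp cz.
have {}zp : nbhs (z : mspace M) (fun z => psi z = 1) by [].
have pz := nbhs_singleton zp.
have Efz j : val (sval (Ef j) z) c = delta_mx j 0.
  by rewrite EfE pz scale1r tvecK.
split=> [j|X Y].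
  split=> // v; pose D (_ : E) : E := 0.
  rewrite -[RHS]/(D v); apply: (vcomp_near (F := V j) cz); last exact: isdiff_cst.
  by apply: filterS zp => w pw cw; rewrite EfE pw scale1r tvecK.
have [nl nr] := nablaP.
pose comp (W : vfield M) (j : 'I_n) (w : M) : R^o := psi w * (vcomp c W (loc c w)) j 0.
have scomp W j : smooth_map (N2 := vec R^o) (comp W j).
  apply: (smooth_cutoff_mul (h := fun y => vcomp c W y j 0 : R^o) sp p0).
  by apply: smooth_coord; [exact: open_dom | exact: vcomp_smooth].
(* One factor [psi] comes from [comp] and one from [Ef]. *)
pose g (w : M) : R^o := 1 - psi w * psi w.
have sg : smooth_map (N2 := vec R^o) g.
  apply: smooth_function_crit => w; set d := some_chart w.
  exists d, (fun y => 1 - fcomp d psi y * fcomp d psi y); split; first exact: some_chartP.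
    pose proof (open_dom (N := M) d) as Oo; have sfp := fcomp_smooth d sp.
    apply: smoothD => //; first exact: smooth_cst.
    by apply: smoothN => //; exact: smoothM.
  by apply: filterE => u du; rewrite fcompE.
have split_field (W Z : vfield M) : (forall w, sval Z w = \sum_(j <- index_enum 'I_n) comp W j w *: sval (Ef j) w) ->
    forall w, sval W w = g w *: sval W w + sval Z w.
  move=> ZE w; rewrite ZE; have [cw|ncw] := pselect (dom c w); last first.
    have pw : psi w = 0 := nbhs_singleton (p0 w ncw).
    rewrite /g pw mulr0 subr0 scale1r big1 ?addr0 // => j _.
    by rewrite /comp pw mul0r scale0r.
  apply: (tangent_inj cw); rewrite val_tangentD val_tangentZ val_tangent_sum.
  under eq_bigr do rewrite val_tangentZ EfE val_tangentZ tvecK // /comp vcompE // /V scalerA mulrAC -scalerA.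
  by rewrite -scaler_sumr -cV_sum_delta -scalerDl /g subrK scale1r.
have gz : g z = 0 by rewrite /g pz mulr1 subrr.
have [ZX [ZX0 _ ZX2]] := nabla_combination (index_enum 'I_n) Ef (scomp X).
have [ZY [ZY0 ZY1 _]] := nabla_combination (index_enum 'I_n) Ef (scomp Y).
have compz W j : comp W j z = val (sval W z) c j 0.
  by rewrite /comp pz mul1r vcompE.
have nX W : sval (nabla X W) z = \sum_k val (sval X z) c k 0 *: sval (nabla (Ef k) W) z.
  rewrite (nl g X ZX X W sg (split_field X ZX ZX0)) gz scale0r add0r ZX2.
  by apply: eq_bigr => k _; rewrite compz.
have dg v : dirder g (x := z) v = 0.
  pose D (_ : E) : R^o := 0.
  rewrite -[RHS]/(D (val v c)); apply: (dirder_near (F := fun=> 0) _ sg cz); last exact: isdiff_cst.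
  by apply: filterS zp => w pw cw; rewrite /g pw mulr1 subrr.
have dcomp j v : dirder (comp Y j) (x := z) v = ('d (vcomp c Y) (loc c z) (val v c)) j 0.
  have dY := dom_isdiff cz (vcomp_smooth c Y).
  have lc : linear (fun A : E => A j 0 : R^o) by move=> a u w; rewrite !mxE.
  pose proof (isdiff_comp dY (isdiff_linear _ lc)) as dF.
  apply: (dirder_near _ (scomp Y j) cz _ dF).
  by apply: filterS zp => w pw cw; rewrite /comp pw mul1r.
rewrite (nr g X Y ZY Y sg (split_field Y ZY ZY0)) dg scale0r gz scale0r !add0r ZY1.
rewrite val_tangent_sum.
under eq_bigr => j _.
  rewrite val_tangentD !val_tangentZ Efz dcomp compz nX val_tangent_sum.
  rewrite scaler_sumr; under [X in _ + X]eq_bigr do rewrite val_tangentZ scalerA.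
  over.
by rewrite big_split /= -cV_sum_delta.
Qed.

End Nabla.

End SymbolsOfConnections.

(** * Christoffel symbols, uniqueness of symbols and the intrinsic form of the first
    correspondence *)

Section ChristoffelSymbols.
Context {R : realType} {n : nat} {M : manifold R n}.
Notation E := 'cV[R]_n.
Implicit Types (c d : chart M) (X Y Z : vfield M) (f : M -> R^o) (G m : symbols M).

Lemma mulmx_ext (A B : 'M[R]_n) : (forall w : E, A *m w = B *m w) -> A = B.
Proof.
move=> H; apply/matrixP => i j; have := congr1 (fun A : E => A i 0) (H (delta_mx j 0)).
by rewrite -!colE !mxE.
Qed.

Lemma array_eval_mul (N : 'I_n -> 'I_n -> E) (v w : E) :
  \sum_j \sum_k (w j 0 * v k 0) *: N k j =
    array_eval (array (fun k => \matrix_(i, j) N k j i 0)) v *m w.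
Proof.
apply/matrixP => i l; rewrite ord1 summxE mxE; apply: eq_bigr => j _.
rewrite summxE mxE mulr_suml; apply: eq_bigr => k _.
rewrite -array_eval_delta array_eval_array !mxE.
by rewrite [RHS]mulrC [N k j i 0 * _]mulrC mulrA.
Qed.

Section Connection.
Variable nabla : connection M.

Let christoffel c (x : M) (g : 'M[R]_(n, n * n)) := forall X Y,
  val (sval (sval nabla X Y) x) c = 'd (vcomp c Y) (loc c x) (val (sval X x) c) +
    array_eval g (val (sval X x) c) *m val (sval Y x) c.

Let G c y : 'M[R]_(n, n * n) :=
  xget 0 [set g | exists x : M, [/\ dom c x, loc c x = y & christoffel c x g]].

Let GP c x : dom c x -> christoffel c x (G c (loc c x)).
Proof.
move=> cx; rewrite /G; case: xgetP => [g _ [z [cz zx H]]|H].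
  by have <- : z = x by exact: (atlas_inj cz cx).
have [Ef /nbhs_singleton/(_ cx)[_ L]] := nabla_local (svalP nabla) cx.
exfalso; apply: (H (array (fun k => \matrix_(i, j) val (sval (sval nabla (Ef k) (Ef j)) x) c i 0))).
by exists x; split=> // X Y; rewrite L array_eval_mul.
Qed.

(** [G] is chosen point by point. Locally it coincides with the components of nabla_{E_k} E_j,
    because the fields of [nabla_local] have components delta_j with zero derivative. *)
Let G_smooth c : smooth_on (loc c @` dom c) (G c).
Proof.
apply: smooth_local => _ [x cx <-].
have [Ef /(near_chart _ cx)[W [Wo Wx L]]] := nabla_local (svalP nabla) cx.
pose proof (openI Wo (open_dom (N := M) c)) as Vo.
exists (W `&` loc c @` dom c); first by split=> //; exists x.
apply: (smooth_ext (f := fun y => array (fun k =>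
  \matrix_(i, j) vcomp c (sval nabla (Ef k) (Ef j)) y i 0))) => //.
  move=> y [Wz [z cz zy]]; subst y; apply: array_eval_inj => k; rewrite array_eval_array.
  have [L1 _] := L z cz Wz cz.
  apply/matrixP => i j; rewrite mxE vcompE // (GP cz).
  have [-> _] := L1 k; have [-> ->] := L1 j.
  by rewrite add0r -colE mxE.
apply: smooth_array => // k; apply: smooth_matrix => // i j.
have s : smooth_on (W `&` loc c @` dom c) (vcomp c (sval nabla (Ef k) (Ef j))).
  by apply: smooth_sub (vcomp_smooth c _) => y [].
apply: smooth_ext (smooth_coord i 0 Vo s) => // y _.
by rewrite mxE.
Qed.

(** Arbitrary vectors v and w at x extend to vector fields X and Y, and the components of nabla_X Y
    in two charts are compared; the term J dY(v) occurs on both sides and cancels. *)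
Lemma connection_has_symbols :
  exists G, connection_symbols G /\ derivative_symbols (sval nabla) G.
Proof.
exists G; split; last by move=> c x X Y cx; exact: GP.
split=> // c d x v cx dx; cbv zeta; apply: mulmx_ext => w.
have [X XE] := vector_extension (tvec c x v).
have [Y YE] := vector_extension (tvec c x w).
have Xc : val (sval X x) c = v by rewrite XE tvecK.
have Yc : val (sval Y x) c = w by rewrite YE tvecK.
have Hc := GP cx X Y; have Hd := GP dx X Y.
have VT := vcomp_transition Y v cx dx.
rewrite (tangent_jac _ cx dx) Hc (tangent_jac (sval X x) cx dx) (tangent_jac (sval Y x) cx dx) Xc Yc in Hd.
have {}Hd := etrans Hd (congr1 (fun z => z + _) VT).
move: Hd; rewrite Yc; set J := jac _ _; set y := loc c x => /esym.
rewrite mulmxDr [X in _ = X]addrC addrAC => /addIr.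
by rewrite mulmxDl addrC !mulmxA.
Qed.

End Connection.

Lemma array_eval_ext (g g' : 'M[R]_(n, n * n)) :
  (forall v w : E, array_eval g v *m w = array_eval g' v *m w) -> g = g'.
Proof. by move=> H; apply: array_eval_inj => k; apply: mulmx_ext => w; exact: H. Qed.

(** Cutoffs are needed here too: every pair of vectors at a point is attained by global fields, and
    the derivative term is common to both formulas. *)
Lemma derivative_symbols_uniq nabla G G' : derivative_symbols nabla G ->
  derivative_symbols nabla G' -> forall c (x : M), dom c x -> G c (loc c x) = G' c (loc c x).
Proof.
move=> H H' c x cx; apply: array_eval_ext => v w.
have [X XE] := vector_extension (tvec c x v).
have [Y YE] := vector_extension (tvec c x w).
have Xc : val (sval X x) c = v by rewrite XE tvecK.
have Yc : val (sval Y x) c = w by rewrite YE tvecK.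
have := H c x X Y cx; rewrite (H' c x X Y cx) /covariant_derivative Xc Yc.
by move=> /addrI.
Qed.

Lemma deformation_symbols_uniq mu m m' : deformation_symbols mu m ->
  deformation_symbols mu m' -> forall c (x : M), dom c x -> m c (loc c x) = m' c (loc c x).
Proof.
move=> H H' c x cx; apply: array_eval_ext => v w.
have := H c x (tvec c x v) (tvec c x w) cx; rewrite (H' c x _ _ cx) !tvecK //.
Qed.

Lemma form_symbols_uniq (omega : forall q : P1g M, tangent q -> 'M[R]_n * 'M[R]_n) G m G' m' :
  form_symbols omega G m -> form_symbols omega G' m' ->
  forall c (x : M), dom c x ->
    G c (loc c x) = G' c (loc c x) /\ m c (loc c x) = m' c (loc c x).
Proof.
move=> H H' c x cx.
have [q [qx fq tq]] := P1g_ex 0 cx (unitmx1 R n); subst x.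
have e v : array_eval (G c (loc c (tag q.1))) v = array_eval (G' c (loc c (tag q.1))) v /\
   array_eval (m c (loc c (tag q.1))) v = array_eval (m' c (loc c (tag q.1))) v.
  pose T := tvec (N := P1g M) (c, tt) q ((v, 0), 0).
  have TE : val T (c, tt) = ((v, 0), 0) by exact: tvecK.
  have := H c q T cx; rewrite (H' c q T cx) TE P1g_loc fq tq /local_form; cbn [fst snd].
  by rewrite !invmx1 !mul1mx !mulmx1 !mul0mx !mulmx0 !addr0 !subr0 => -[-> ->].
by split; apply: array_eval_inj => k; case: (e (delta_mx k 0)).
Qed.

Lemma section_symbols_uniq (s : equivariant_section M) G m G' m' :
  section_symbols (sval s) G m -> section_symbols (sval s) G' m' ->
  forall c (x : M), dom c x ->
    G c (loc c x) = G' c (loc c x) /\ m c (loc c x) = m' c (loc c x).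
Proof.
move=> H H' c x cx.
have [q [qx fq tq]] := P1g_ex 0 cx (unitmx1 R n); subst x.
have [H1 H2] := H c q cx; have [H1' H2'] := H' c q cx.
split; apply: array_eval_inj => k; apply: oppr_inj.
  have := congr1 (fun b => array_eval b (delta_mx k 0)) H1.
  by rewrite H1' !section_jetE fq mul1mx !mulmx1 => ->.
have := congr1 (fun b => array_eval b (delta_mx k 0)) H2.
by rewrite H2' !section_tensorE fq invmx1 !mul1mx !mulmx1 => ->.
Qed.

Lemma frame_components_smooth Y :
  smooth_map (N1 := P1g M) (N2 := vec E)
    (fun q : P1g M => frame_coord (u := q.1) (sval Y (tag q.1))).
Proof.
apply: smooth_map_crit => -[] q _; pose c := some_chart (tag q.1).
have cq : dom c (tag q.1) := some_chartP _.
pose O := [set p : (E * 'M[R]_n) * 'M[R]_n | (loc c @` dom c) p.1.1 /\ p.1.2 \in unitmx].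
have Oo : open O.
  exact: open_prodl (open_prod (open_dom (N := M) c) (@open_unitmx R n)).
exists (c, tt), O, (fun p => invmx p.1.2 *m vcomp c Y p.1.1); split=> //.
- by split; [exists (tag q.1) | exact: fmat_unit].
- have s1 : smooth_on O (fun p => p.1.1) by smooth_rec.
  have s2 : smooth_on O (fun p => p.1.2) by smooth_rec.
  apply: smooth_mulmx => //.
    by apply: (smooth_comp (f := @invmx R n) _ _ (@smooth_invmx R n)) => // p [].
  by apply: (smooth_comp (f := vcomp c Y) _ _ (vcomp_smooth c Y)) => // p [].
- by move=> q' [cq' _] _; split=> //; rewrite vcompE //; exact: frame_coordE.
Qed.

Lemma dmap_frame_components Y (q : P1g M) (T : tangent q) c : dom c (tag q.1) ->
  let a := fmat c q.1 in let w := val T (c, tt) in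
  val (dmap (N2 := vec E) (fun q : P1g M => frame_coord (u := q.1) (sval Y (tag q.1))) T) tt =
    - (invmx a *m w.1.2 *m invmx a) *m val (sval Y (tag q.1)) c +
    invmx a *m 'd (vcomp c Y) (loc c (tag q.1)) w.1.1.
Proof.
move=> cq; cbv zeta; set a := fmat c q.1; set y := loc c (tag q.1).
pose F (p : (E * 'M[R]_n) * 'M[R]_n) : E := invmx p.1.2 *m vcomp c Y p.1.1.
pose D (w : (E * 'M[R]_n) * 'M[R]_n) : E :=
  - (invmx a *m w.1.2 *m invmx a) *m vcomp c Y y + invmx a *m 'd (vcomp c Y) y w.1.1.
rewrite -(vcompE Y cq) -[RHS]/(D (val T (c, tt))).
apply: (dmap_formula (F := F) (D := D) T (@frame_components_smooth Y) (P1g_dom cq)) => //.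
  by move=> q' [cq' _] _; rewrite /F P1g_loc vcompE //; exact: frame_coordE.
set z := loc _ _.
pose proof (isdiff_comp (isdiff_fst z) (isdiff_fst z.1)) as d11.
pose proof (isdiff_comp (isdiff_fst z) (isdiff_snd z.1)) as d12.
have ua : z.1.2 \in unitmx := fmat_unit cq.
have dY := dom_isdiff cq (vcomp_smooth c Y).
pose proof (isdiff_mulmx (isdiff_invmx (f := fun p : (E * 'M[R]_n) * 'M[R]_n => p.1.2) ua d12)
  (isdiff_comp_eq d11 (erefl : z.1.1 = y) dY)) as dF.
exact: dF.
Qed.

(** The vertical part A of the vector cancels against the derivative of a^-1 in u^-1(Y), so the
    formula for nabla holds for every lift of X. *)
Lemma horizontal_algebra (a A B : 'M[R]_n) (y dy : E) : a \in unitmx ->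
  - (invmx a *m A *m invmx a) *m y + invmx a *m dy +
    invmx a *m (B *m a + A) *m (invmx a *m y) = invmx a *m (dy + B *m y).
Proof.
move=> ua; rewrite [invmx a *m (B *m a + A)]mulmxDr mulmxDl mulNmx !mulmxA mulmxK //.
by rewrite mulmxDr mulmxA addrC -addrA [X in _ + X]addrA subrr add0r addrC.
Qed.

(** Both the point (u, 0) and the vector T have zero Lie algebra component, so the bracket and the
    additive term of [local_form] disappear and the second component is the tensor conjugated by the
    frame. *)
Lemma connection_form_ofP (p : connection M * deformation M) (omega : P1g_connection M) G m :
  derivative_symbols (sval p.1) G -> deformation_symbols (sval p.2) m ->
  form_symbols (sval omega) G m -> connection_form_of p omega.
Proof.
move=> Hn Hm Ho; rewrite /connection_form_of.
move=> u T X Y; set c := some_chart (tag u); have cu : dom c (tag u) := some_chartP _.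
move=> T1 T2; cbv zeta.
have w1 : (val T (c, tt)).1.1 = val (sval X (tag u)) c.
  apply: (etrans (esym (dmap_P1g_base T cu))).
  exact: (congr1 (fun v : tangent (tag u) => val v c) T1).
have w2 : (val T (c, tt)).2 = 0.
  apply: (etrans (esym (dmap_P1g_snd T cu))).
  exact: (congr1 (fun v : tangent (0 : vec 'M[R]_n) => val v tt) T2).
have ua := fmat_unit cu.
rewrite (Ho c (u, 0 : 'M[R]_n) T cu).
split.
  apply: (etrans (frame_coordE _ cu)).
  rewrite (Hn c (tag u) X Y cu).
  apply: esym; apply: (etrans (congr1 (fun z => z + _) (dmap_frame_components Y T cu))).
  rewrite -[frame_coord _ in X in _ + X]/(frame_coord (sval Y (tag u))) (frame_coordE _ cu).
  rewrite /local_form /covariant_derivative w1; cbn [fst snd].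
  exact: horizontal_algebra.
apply: (etrans (frame_coordE _ cu)); rewrite (Hm c (tag u) _ _ cu).
rewrite (frame_coordE _ cu) /local_form w1 w2 P1g_loc; cbn [fst snd].
by rewrite mul0mx mulmx0 !subr0 addr0 !mulmxA mulmxK.
Qed.

End ChristoffelSymbols.

(** * The correspondences *)

Lemma relation_bijective (A B : Type) (r : A -> B -> Prop) :
  (forall a, exists b, r a b) -> (forall b, exists a, r a b) ->
  (forall a b b', r a b -> r a b' -> b = b') ->
  (forall a a' b, r a b -> r a' b -> a = a') ->
  exists f : A -> B, bijective f /\ forall a, r a (f a).
Proof.
move=> /choice[f rf] /choice[g rg] fun1 fun2; exists f; split=> //.
by exists g => x; [apply: fun2 (rg _) (rf _) | apply: fun1 (rf _) (rg _)].
Qed.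

(** Proof irrelevance lets equality of connections, forms and sections be tested on the underlying
    data, hence on symbols. *)
Lemma sig_val_inj (A : Type) (P : A -> Prop) (x y : {a | P a}) : sval x = sval y -> x = y.
Proof. by case: x y => x px [y py] /= e; subst y; congr exist; exact: Prop_irrelevance. Qed.

Section Correspondence.
Context {R : realType} {n : nat} {M : manifold R n}.
Implicit Types (G m : symbols M).

(** Equality at points of the charts only, the values outside the chart images being arbitrary. *)
Definition same_symbols G G' :=
  forall c (x : M), dom c x -> G c (loc c x) = G' c (loc c x).

Lemma connection_inj (nabla nabla' : connection M) G G' : same_symbols G G' ->
  derivative_symbols (sval nabla) G -> derivative_symbols (sval nabla') G' -> nabla = nabla'.
Proof.
move=> GG H H'; apply/sig_val_inj/funext => X; apply/funext => Y.
apply/sig_val_inj; apply: functional_extensionality_dep => x.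
have cx := some_chartP x; apply: (tangent_inj cx); rewrite (H _ x X Y cx) (H' _ x X Y cx).
by rewrite /covariant_derivative GG.
Qed.

Lemma deformation_inj (mu mu' : deformation M) m m' : same_symbols m m' ->
  deformation_symbols (sval mu) m -> deformation_symbols (sval mu') m' -> mu = mu'.
Proof.
move=> mm H H'; apply/sig_val_inj; apply: functional_extensionality_dep => x.
apply/funext => v; apply/funext => w.
have cx := some_chartP x; apply: (tangent_inj cx); rewrite (H _ x v w cx) (H' _ x v w cx).
by rewrite mm.
Qed.

Lemma form_inj (omega omega' : P1g_connection M) G m G' m' :
  same_symbols G G' -> same_symbols m m' ->
  form_symbols (sval omega) G m -> form_symbols (sval omega') G' m' -> omega = omega'.
Proof.
move=> GG mm H H'; apply/sig_val_inj; apply: functional_extensionality_dep => q.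
apply/funext => T; have cx := some_chartP (tag q.1).
by rewrite (H _ q T cx) (H' _ q T cx) GG // mm.
Qed.

Lemma section_inj (s s' : equivariant_section M) G m G' m' :
  same_symbols G G' -> same_symbols m m' ->
  section_symbols (sval s) G m -> section_symbols (sval s') G' m' -> s = s'.
Proof.
move=> GG mm H H'; apply/sig_val_inj/funext => q.
have cx := some_chartP (tag q.1); have [H1 H2] := H _ q cx; have [H1' H2'] := H' _ q cx.
have [[_ ps _] [_ ps' _]] := (svalP s, svalP s').
have pq := section_proj1 (ps q); have pq' := section_proj1 (ps' q).
apply: pair_ext.
  by apply: (P2_inj (c := some_chart (tag q.1))); rewrite ?pq ?pq' // H1 H1' GG.
apply: pair_ext; first by rewrite (section_proj2 (ps q)) (section_proj2 (ps' q)).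
by rewrite H2 H2' mm.
Qed.

(** Bijectivity is proved for this relation; the intrinsic condition [connection_form_of] is then
    deduced by [connection_form_ofP]. *)
Definition form_relation (p : connection M * deformation M) (omega : P1g_connection M) :=
  exists G m, [/\ derivative_symbols (sval p.1) G, deformation_symbols (sval p.2) m
    & form_symbols (sval omega) G m].

Definition section_relation (omega : P1g_connection M) (s : equivariant_section M) :=
  exists G m, form_symbols (sval omega) G m /\ section_symbols (sval s) G m.

Lemma form_correspondence : exists Phi : connection M * deformation M -> P1g_connection M,
  bijective Phi /\ forall p, form_relation p (Phi p).
Proof.
apply: relation_bijective.
- move=> [nabla mu]; have [G [HG HGn]] := connection_has_symbols nabla.
  have [m [Hm Hmu]] := deformation_has_symbols mu.
  by have [omega Ho] := form_exists HG Hm; exists omega, G, m.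
- move=> omega; have [G [m [HG Hm Ho]]] := symbols_exist omega.
  have [nabla Hn] := connection_exists HG; have [mu Hmu] := deformation_exists Hm.
  by exists (nabla, mu), G, m.
- move=> p omega omega' [G [m [Hn Hm Ho]]] [G' [m' [Hn' Hm' Ho']]].
  apply: (form_inj _ _ Ho Ho'); first exact: derivative_symbols_uniq Hn Hn'.
  exact: deformation_symbols_uniq Hm Hm'.
- move=> [nabla mu] [nabla' mu'] omega [G [m [Hn Hm Ho]]] [G' [m' [Hn' Hm' Ho']]].
  have e c x (cx : dom c x) := form_symbols_uniq Ho Ho' cx.
  congr (_, _).
    by apply: (connection_inj _ Hn Hn') => c x cx; case: (e c x cx).
  by apply: (deformation_inj _ Hm Hm') => c x cx; case: (e c x cx).
Qed.

Lemma section_correspondence : exists Psi : P1g_connection M -> equivariant_section M,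
  bijective Psi /\ forall omega, section_relation omega (Psi omega).
Proof.
apply: relation_bijective.
- move=> omega; have [G [m [HG Hm Ho]]] := symbols_exist omega.
  by have [s Hs] := equivariant_section_exists HG Hm; exists s, G, m.
- move=> s; have [G [m [HG Hm Hs]]] := section_symbols_exist s.
  by have [omega Ho] := form_exists HG Hm; exists omega, G, m.
- move=> omega s s' [G [m [Ho Hs]]] [G' [m' [Ho' Hs']]].
  have e c x (cx : dom c x) := form_symbols_uniq Ho Ho' cx.
  by apply: (section_inj _ _ Hs Hs') => c x cx; case: (e c x cx).
- move=> omega omega' s [G [m [Ho Hs]]] [G' [m' [Ho' Hs']]].
  have e c x (cx : dom c x) := section_symbols_uniq Hs Hs' cx.
  by apply: (form_inj _ _ Ho Ho') => c x cx; case: (e c x cx).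
Qed.

End Correspondence.

Theorem theorem6p5 (R : realType) (n : nat) (M : manifold R n) :
  exists (Phi : connection M * deformation M -> P1g_connection M)
         (Psi : P1g_connection M -> equivariant_section M),
    [/\ bijective Phi,
        bijective Psi,
        (forall p, connection_form_of p (Phi p))
      & (forall omega, section_of omega (Psi omega))].
Proof.
have [Phi [bPhi rPhi]] := @form_correspondence R n M.
have [Psi [bPsi rPsi]] := @section_correspondence R n M.
exists Phi, Psi; split=> // [p|omega].
  by have [G [m [Hn Hm Ho]]] := rPhi p; exact: connection_form_ofP Hn Hm Ho.
by have [G [m [Ho Hs]]] := rPsi omega; exact: section_of_formP Ho Hs.
Qed.
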